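(* Let $W$ be a Coxeter group with finite generating set $S$. The longest element functor $L:\mathbf{W}_{\mathcal{S}}\to\mathbf{W}$, $vW_I\mapsto v_I$, where $v_I$ is the longest element of the coset $vW_I$, pulls back homotopy colimits: for any diagram of spaces $D:\mathbf{W}\to\mathbf{Spaces}$ the natural map $$\mathrm{hocolim}_{\mathbf{W}_{\mathcal{S}}}\,DL\longrightarrow\mathrm{hocolim}_{\mathbf{W}}\,D$$ is a weak homotopy equivalence.
   Context: A Coxeter group here is a finitely generated group with presentation $\langle s_1,\dots,s_n\mid s_i^2=1,(s_is_j)^{m_{ij}}=1\rangle$, $2\le m_{ij}=m_{ji}\le\infty$ for $i\ne j$ ($m_{ij}=\infty$ meaning no relation), and $S=\{s_1,\dots,s_n\}$. $\mathbf{W}$ is $W$ viewed as a poset (category) under the weak Bruhat order: $v\le w$ iff $w=vx$ with $l(w)=l(v)+l(x)$, $l$ being reduced word length. For $I\subseteq S$, $W_I=\langle I\rangle$, and $\mathcal{S}=\{I\subseteq S: |W_I|<\infty\}$ (ordered by inclusion). $\mathbf{W}_{\mathcal{S}}$ is the poset of cosets $wW_I$ with $w\in W$, $I\in\mathcal{S}$, ordered by inclusion (its geometric realization is the Davis complex). Each finite type coset $wW_I$, $I\in\mathcal{S}$, has a unique longest element. $\mathbf{Spaces}$ may be taken to be topological spaces, CW-complexes or simplicial sets. *)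

(* Defs.v *)
From HB Require Import structures.
From mathcomp Require Import all_boot all_order all_algebra.
From mathcomp Require Import generic_quotient.
From mathcomp Require Import all_classical all_reals all_analysis.
From Stdlib Require Import Relation_Operators.

Set Implicit Arguments.
Unset Strict Implicit.
Unset Printing Implicit Defensive.

Import Order.TTheory GRing.Theory Num.Theory.
Import numFieldNormedType.Exports.

Local Open Scope classical_set_scope.
Local Open Scope ring_scope.

Section Presentation.
Variables (n : nat) (m : 'I_n -> 'I_n -> option nat).

(* m i j = None encodes the label oo (no relation); diagonal values of m are
   never used. *)
Inductive coxeter_relator : seq 'I_n -> Prop :=
| CoxeterInvolution i : coxeter_relator [:: i; i]
| CoxeterBraid i j k : i != j -> m i j = Some k ->
    coxeter_relator (flatten (nseq k [:: i; j])).

Inductive coxeter_insert : seq 'I_n -> seq 'I_n -> Prop :=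
| CoxeterInsert u r v : coxeter_relator r ->
    coxeter_insert (u ++ v) (u ++ r ++ v).

(* As every generator is an involution, positive words suffice: the words
   modulo this congruence form the group presented by the relators. *)
Definition coxeter_congr : seq 'I_n -> seq 'I_n -> Prop :=
  clos_refl_sym_trans _ coxeter_insert.

End Presentation.

Definition word_eval (W : groupType) n (s : 'I_n -> W) (u : seq 'I_n) : W :=
  (\prod_(i <- u) s i)%g.

Record coxeterSystem (n : nat) := CoxeterSystem {
  cox_group :> groupType;
  cox_gen : 'I_n -> cox_group;
  cox_m : 'I_n -> 'I_n -> option nat;
  cox_m_sym : forall i j, cox_m i j = cox_m j i;
  cox_m_ge2 : forall i j k, i != j -> cox_m i j = Some k -> (2 <= k)%N;
  cox_generated : forall w, exists u, word_eval cox_gen u = w;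
  cox_presented : forall u v,
    word_eval cox_gen u = word_eval cox_gen v <-> coxeter_congr cox_m u v
}.

Section Coxeter.
Variables (n : nat) (C : coxeterSystem n).
Implicit Types (v w x : C) (I : {set 'I_n}).

Local Notation eval := (word_eval (@cox_gen n C)).

Lemma coxlen_subproof w :
  exists k, `[< exists2 u : seq 'I_n, size u = k & eval u = w >].
Proof.
by have [u <-] := cox_generated w; exists (size u); apply/asboolP; exists u.
Qed.

Definition coxlen w : nat := ex_minn (coxlen_subproof w).

Lemma coxlen_min u : (coxlen (eval u) <= size u)%N.
Proof.
rewrite /coxlen; case: ex_minnP => k _; apply.
by apply/asboolP; exists u.
Qed.

Lemma coxlen_word w : exists2 u : seq 'I_n, size u = coxlen w & eval u = w.
Proof. by rewrite /coxlen; case: ex_minnP => k /asboolP. Qed.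

Lemma coxlen1 : coxlen 1%g = 0%N.
Proof.
apply/eqP; rewrite -leqn0; have := coxlen_min [::].
by rewrite /word_eval big_nil.
Qed.

Lemma coxlen_eq0 w : coxlen w = 0%N -> w = 1%g.
Proof.
move=> w0; have [u] := coxlen_word w; rewrite w0 => /size0nil -> <-.
by rewrite /word_eval big_nil.
Qed.

Lemma coxlenM v w : (coxlen (v * w)%g <= coxlen v + coxlen w)%N.
Proof.
have [u <- <-] := coxlen_word v; have [u' <- <-] := coxlen_word w.
by rewrite -size_cat /word_eval -big_cat; exact: coxlen_min.
Qed.

Definition weak_le v w : Prop :=
  exists2 x, w = (v * x)%g & coxlen w = (coxlen v + coxlen x)%N.

Lemma weak_le_refl v : weak_le v v.
Proof. by exists 1%g; rewrite ?mulg1 // coxlen1 addn0. Qed.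

Lemma weak_le_anti v w : weak_le v w -> weak_le w v -> v = w.
Proof.
move=> [x -> vx] [y _ /eqP]; rewrite vx -addnA -{1}[coxlen v]addn0 eqn_add2l.
by rewrite eq_sym addn_eq0 => /andP[/eqP/coxlen_eq0 -> _]; rewrite mulg1.
Qed.

Lemma weak_le_trans w v x : weak_le v w -> weak_le w x -> weak_le v x.
Proof.
move=> [y -> vy] [z -> vyz]; exists (y * z)%g; first by rewrite mulgA.
apply/eqP; rewrite eqn_leq {2}vyz vy -addnA leq_add2l coxlenM andbT.
by rewrite -mulgA coxlenM.
Qed.

Definition weak_order : Type := C.
HB.instance Definition _ := Choice.on weak_order.

Definition weak_leb (v w : weak_order) : bool := `[< weak_le v w >].

Lemma weak_leb_refl : reflexive weak_leb.
Proof. by move=> v; apply/asboolP; exact: weak_le_refl. Qed.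

Lemma weak_leb_anti : antisymmetric weak_leb.
Proof. by move=> v w /andP[/asboolP vw /asboolP]; exact: weak_le_anti. Qed.

Lemma weak_leb_trans : transitive weak_leb.
Proof.
move=> w v x /asboolP vw /asboolP wx; apply/asboolP.
exact: weak_le_trans vw wx.
Qed.

Fact weak_display : Order.disp_t. Proof. exact: Order.Disp tt tt. Qed.
HB.instance Definition _ := Order.Le_isPOrder.Build weak_display weak_order
  weak_leb_refl weak_leb_anti weak_leb_trans.

(* W_I; inverses are not needed since the generators are involutions. *)
Definition parabolic I : set C :=
  [set w | exists2 u : seq 'I_n, {subset u <= I} & eval u = w].

Definition parabolic_coset w I : set C := [set (w * x)%g | x in parabolic I].

Definition finite_type_coset (A : set C) : Prop :=
  exists w I, finite_set (parabolic I) /\ A = parabolic_coset w I.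

Definition davis_poset : Type := {A : set C | `[< finite_type_coset A >]}.
HB.instance Definition _ := Choice.on davis_poset.

Definition davis_leb (A B : davis_poset) : bool := `[< sval A `<=` sval B >].

Lemma davis_leb_refl : reflexive davis_leb.
Proof. by move=> A; exact/asboolP. Qed.

Lemma davis_leb_anti : antisymmetric davis_leb.
Proof.
move=> A B /andP[/asboolP AB /asboolP BA]; apply: val_inj.
by apply/seteqP; split.
Qed.

Lemma davis_leb_trans : transitive davis_leb.
Proof.
move=> B A D /asboolP AB /asboolP BD; apply/asboolP.
exact: subset_trans AB BD.
Qed.

Fact davis_display : Order.disp_t. Proof. exact: Order.Disp tt tt. Qed.
HB.instance Definition _ := Order.Le_isPOrder.Build davis_display davis_poset
  davis_leb_refl davis_leb_anti davis_leb_trans.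

Definition is_longest (A : set C) w : Prop :=
  A w /\ forall v, A v -> v <> w -> (coxlen v < coxlen w)%N.

End Coxeter.

Record diagram d (P : porderType d) := Diagram {
  diag_obj :> P -> topologicalType;
  diag_map : forall x y : P, (x <= y)%O -> diag_obj x -> diag_obj y;
  diag_map_continuous : forall x y (h : (x <= y)%O), continuous (diag_map h);
  diag_map_id : forall x (h : (x <= x)%O) a, diag_map h a = a;
  diag_map_comp : forall x y z (h : (x <= y)%O) (k : (y <= z)%O)
    (l : (x <= z)%O) a, diag_map l a = diag_map k (diag_map h a)
}.
Arguments diag_map {d P} D {x y} h a : rename.
Arguments diag_map_continuous {d P} D {x y} h : rename.
Arguments diag_map_id {d P} D {x} h a : rename.
Arguments diag_map_comp {d P} D {x y z} h k l a : rename.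

Definition diagram_comp d d' (P : porderType d) (Q : porderType d')
    (D : diagram Q) (F : {omorphism P -> Q}) : diagram P :=
  {| diag_obj := fun x => D (F x);
     diag_map := fun x y h => diag_map D (omorph_le F h);
     diag_map_continuous := fun x y h => diag_map_continuous D (omorph_le F h);
     diag_map_id := fun x h => diag_map_id D (omorph_le F h);
     diag_map_comp := fun x y z h k l =>
       diag_map_comp D (omorph_le F h) (omorph_le F k) (omorph_le F l) |}.

Section Simplex.
Variable R : realType.

Definition simplex n : set 'rV[R]_n.+1 :=
  [set t | (forall i, 0 <= t 0 i) /\ \sum_i t 0 i = 1].
Arguments simplex : clear implicits.

Definition simplex_push_row m n (f : 'I_m.+1 -> 'I_n.+1) (t : 'rV[R]_m.+1) :
  'rV[R]_n.+1 := \row_j \sum_(i | f i == j) t 0 i.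

Lemma simplex_push_rowP m n (f : 'I_m.+1 -> 'I_n.+1) t :
  simplex m t -> simplex n (simplex_push_row f t).
Proof.
move=> [t0 t1]; split=> [i|]; first by rewrite mxE; exact: sumr_ge0.
rewrite -[RHS]t1 (partition_big f xpredT)//=.
by apply: eq_bigr => j _; rewrite mxE.
Qed.

Definition simplex_push m n (f : 'I_m.+1 -> 'I_n.+1) (t : simplex m) :
    simplex n :=
  exist _ (simplex_push_row f (set_val t))
    (mem_set (simplex_push_rowP f (set_valP t))).

End Simplex.
Arguments simplex : clear implicits.

Definition chain d (P : porderType d) (n : nat) : Type :=
  {omorphism 'I_n.+1 -> P}.
HB.instance Definition _ d (P : porderType d) n := gen_eqMixin (chain P n).
HB.instance Definition _ d (P : porderType d) n := gen_choiceMixin (chain P n).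

(* Bousfield-Kan model: the geometric realization of the simplicial space
   whose n-simplices are the disjoint union of the D c_0 over all chains
   c_0 <= ... <= c_n. *)
Section Hocolim.
Variables (R : realType) (d : Order.disp_t) (P : porderType d).
Variable D : diagram P.

Definition chain_index : choiceType := {n : nat & chain P n}.

Definition hocolim_cell (c : chain_index) : topologicalType :=
  (D (projT2 c ord0) * simplex R (projT1 c))%type.

Definition hocolim_cells : topologicalType :=
  {c : chain_index & hocolim_cell c}.

Definition hocolim_pt n (c : chain P n) (x : D (c ord0)) (t : simplex R n) :
    hocolim_cells :=
  existT hocolim_cell (existT _ n c) (x, t).

(* f ranges over all simplicial operators, so this covers both faces and
   degeneracies; c' is the chain c \o f. *)
Inductive hocolim_glue : hocolim_cells -> hocolim_cells -> Prop :=
| HocolimGlue m n (f : {omorphism 'I_m.+1 -> 'I_n.+1})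
    (c : chain P n) (c' : chain P m)
    (cf : forall i, c' i = c (f i)) (h : (c ord0 <= c' ord0)%O)
    (x : D (c ord0)) (t : simplex R m) :
    hocolim_glue (hocolim_pt (diag_map D h x) t)
                 (hocolim_pt x (simplex_push f t)).

Definition hocolim_eq (p q : hocolim_cells) : bool :=
  `[< clos_refl_sym_trans _ hocolim_glue p q >].

Lemma hocolim_eq_refl : reflexive hocolim_eq.
Proof. by move=> p; apply/asboolP; exact: rst_refl. Qed.

Lemma hocolim_eq_sym : symmetric hocolim_eq.
Proof.
by move=> p q; apply/asboolP/asboolP => pq; exact: rst_sym.
Qed.

Lemma hocolim_eq_trans : transitive hocolim_eq.
Proof.
move=> q p r /asboolP pq /asboolP qr; apply/asboolP.
exact: rst_trans pq qr.
Qed.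

Canonical hocolim_eq_equiv :=
  EquivRel hocolim_eq hocolim_eq_refl hocolim_eq_sym hocolim_eq_trans.

Definition hocolim : topologicalType :=
  quotient_topology {eq_quot hocolim_eq_equiv}%qT.

Definition hocolim_pi (p : hocolim_cells) : hocolim :=
  (\pi_({eq_quot hocolim_eq_equiv}) p)%qT.

Definition hocolim_repr (z : hocolim) : hocolim_cells :=
  repr (z : {eq_quot hocolim_eq_equiv}%qT).

Lemma hocolim_piP p q :
  hocolim_pi p = hocolim_pi q <-> clos_refl_sym_trans _ hocolim_glue p q.
Proof.
by split=> [/eqquotP/asboolP//|pq]; apply/eqquotP/asboolP.
Qed.

Lemma hocolim_reprK z : hocolim_pi (hocolim_repr z) = z.
Proof. exact: reprK. Qed.

End Hocolim.
Arguments hocolim_pi {R d P D}.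
Arguments hocolim_repr {R d P D}.

Section HocolimMap.
Variables (R : realType) (d d' : Order.disp_t).
Variables (P : porderType d) (Q : porderType d').
Variables (D : diagram Q) (F : {omorphism P -> Q}).

Definition hocolim_cells_map (p : hocolim_cells R (diagram_comp D F)) :
    hocolim_cells R D :=
  let: existT (existT n c) (x, t) := p in
  @hocolim_pt R _ _ D n (F \o c : {omorphism _ -> _}) x t.

Definition hocolim_map (z : hocolim R (diagram_comp D F)) : hocolim R D :=
  hocolim_pi (hocolim_cells_map (hocolim_repr z)).

Lemma hocolim_mapE p :
  hocolim_map (hocolim_pi p) = hocolim_pi (hocolim_cells_map p).
Proof.
apply/hocolim_piP; have /hocolim_piP := hocolim_reprK (hocolim_pi p).
rewrite /hocolim_map; move: (hocolim_repr _) => q.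
elim=> {p q} [_ _ [m n f c c' cf h x t]|p|p q _ +|p q r _ + _].
- have cFf i : (F \o c' : {omorphism _ -> _}) i =
      (F \o c : {omorphism _ -> _}) (f i) by rewrite /= cf.
  by apply: rst_step; exact: HocolimGlue cFf (omorph_le F h) x t.
- exact: rst_refl.
- exact: rst_sym.
- by move=> pq; exact: rst_trans pq.
Qed.

End HocolimMap.
Arguments hocolim_map R {d d' P Q} D F z.

Section WeakEquivalence.
Variable R : realType.

Definition unit_interval : set R := [set s | 0 <= s <= 1].

Definition cube n : set 'rV[R]_n := [set t | forall i, unit_interval (t 0 i)].

Definition cube_boundary n : set 'rV[R]_n :=
  [set t | cube t /\ exists i, t 0 i = 0 \/ t 0 i = 1].

Section Space.
Variable X : topologicalType.

Definition joined_by_path (x y : X) : Prop :=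
  exists g : R -> X,
    [/\ {within unit_interval, continuous g}, g 0 = x & g 1 = y].

Definition cube_loop n (x : X) (a : 'rV[R]_n -> X) : Prop :=
  {within @cube n, continuous a} /\
  forall t, cube_boundary t -> a t = x.

Definition cube_homotopic n (x : X) (a b : 'rV[R]_n -> X) : Prop :=
  exists H : R * 'rV[R]_n -> X,
    [/\ {within unit_interval `*` @cube n, continuous H},
        forall t, cube t -> H (0, t) = a t,
        forall t, cube t -> H (1, t) = b t &
        forall s t, unit_interval s -> cube_boundary t -> H (s, t) = x].

End Space.

Section Map.
Variables (X Y : topologicalType) (f : X -> Y).

Definition pi0_bijective : Prop :=
  (forall x x', joined_by_path (f x) (f x') -> joined_by_path x x') /\
  (forall y, exists x, joined_by_path (f x) y).

Definition pi_bijective n (x : X) : Prop :=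
  (forall a b : 'rV[R]_n -> X, cube_loop x a -> cube_loop x b ->
     cube_homotopic (f x) (f \o a) (f \o b) -> cube_homotopic x a b) /\
  (forall b : 'rV[R]_n -> Y, cube_loop (f x) b ->
     exists2 a : 'rV[R]_n -> X, cube_loop x a &
       cube_homotopic (f x) (f \o a) b).

Definition weak_homotopy_equivalence : Prop :=
  [/\ continuous f, pi0_bijective &
      forall n x, (0 < n)%N -> pi_bijective n x].

End Map.
End WeakEquivalence.

(* Main.v *)
(** A point of a homotopy colimit over a poset P is an element of some D p
    together with a probability measure carried by a finite chain above p, so
    natural continuous operations on chain-supported measures induce maps of
    homotopy colimits. Write L : W_S -> W for the longest element map.

    For w in W, the cosets A with w <= L A have a contractible order complex:
    they are the cosets meeting {x >= w}. Adding the elements x by increasing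
    length, the new cosets are those containing x, a cone with apex {x}; they
    meet the earlier ones in the cosets containing x and some x s < x with
    w <= x s. These s are right descents of x, so they generate a finite
    parabolic subgroup and this intersection is contractible too; the diamond
    lemma for descents above w ensures that a coset containing x that also
    contains an earlier element contains such an x s. Gluing explicit
    contractions gives one retraction of a cone for every w.

    Replacing the atoms of a measure on W, from long to short elements, by means
    of these retractions turns a measure mu on a chain of W and a measure nu on
    a chain of W_S with w <= L A throughout into a measure on a chain of W_S.
    With nu = 0 this is a map g of homotopy colimits in the direction opposite
    to the given map f; splitting a measure into its lower and upper parts, and
    sweeping only one of them, interpolates between the identity and g o f, and
    between the identity and f o g. Hence f is a homotopy equivalence. *)
Require Import Defs.
From HB Require Import structures.
From mathcomp Require Import all_boot all_order all_algebra.
From mathcomp Require Import all_classical all_reals all_analysis.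
From mathcomp Require Import zify lra.
From Stdlib Require Import Relation_Operators.

Set Implicit Arguments.
Unset Strict Implicit.
Unset Printing Implicit Defensive.

Import Order.TTheory GRing.Theory Num.Theory.
Import numFieldNormedType.Exports.

Local Open Scope classical_set_scope.
Local Open Scope ring_scope.

(** * Exchange, descents and longest elements *)

(** The retractions chosen for different w need not be compatible, and no coherence between them is
    ever established. Sweeping one atom at a time makes this harmless: for w <= x every coset with x
    <= L A also has w <= L A, so once the longer atoms have been swept, the measure lies where the
    retraction for w is controlled, and independent choices can be composed. Atoms that tend to zero
    cause no jump because a retraction is the identity when the cone point carries no mass.

    As W may be infinite, spaces of measures are never topologized. Continuity is required of
    families with a common finite support, which is what a cell provides, and case distinctions are
    handled by finite closed covers.

    Both homotopies move base points, so comparing homotopy groups requires a change of base point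
    along a path. On the algebraic side, the group is given by words modulo relators; the exchange
    condition is extracted from this by counting reflections modulo 2. *)

Section CoxeterCombinatorics.
Variables (n : nat) (C : coxeterSystem n).
Implicit Types (v w x y z a t : C) (u : seq 'I_n) (s i j : 'I_n).
Implicit Types (I F : {set 'I_n}) (A : set C).

Local Notation ev := (word_eval (@cox_gen n C)).
Local Notation g := (@cox_gen n C).
Local Notation len := (@coxlen n C).
Local Open Scope group_scope.

Lemma word_eval_nil : ev [::] = 1.
Proof. by rewrite /word_eval big_nil. Qed.

Lemma word_eval_cons i u : ev (i :: u) = g i * ev u.
Proof. by rewrite /word_eval big_cons. Qed.

Lemma word_eval_cat u u' : ev (u ++ u') = ev u * ev u'.
Proof. by rewrite /word_eval big_cat. Qed.

Lemma word_eval_rcons u i : ev (rcons u i) = ev u * g i.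
Proof. by rewrite -cats1 word_eval_cat word_eval_cons word_eval_nil mulg1. Qed.

Lemma word_eval_relator u : coxeter_relator (@cox_m n C) u -> ev u = 1.
Proof.
move=> ru; have <- := word_eval_nil; apply/cox_presented/rst_sym/rst_step.
by have := @CoxeterInsert _ _ [::] u [::] ru; rewrite /= cats0.
Qed.

Lemma cox_genK i : g i * g i = 1.
Proof.
have := word_eval_relator (CoxeterInvolution _ i).
by rewrite !word_eval_cons word_eval_nil mulg1.
Qed.

Lemma cox_genV i : (g i)^-1 = g i.
Proof. by apply: (mulgI (g i)); rewrite mulgV cox_genK. Qed.

Lemma mulg_genK w i : w * g i * g i = w.
Proof. by rewrite -mulgA cox_genK mulg1. Qed.

(* For u = u1 ++ i :: u2, right multiplication by the reflection
   g i ^ ev u2 deletes the letter i. *)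
Fixpoint reflections u : seq C :=
  if u is i :: u' then g i ^ ev u' :: reflections u' else [::].

Lemma reflections_cat u u' :
  reflections (u ++ u') = map (conjg^~ (ev u')) (reflections u) ++ reflections u'.
Proof. by elim: u => //= i u ->; rewrite word_eval_cat conjgM. Qed.

Lemma mem_reflections u t : t \in reflections u ->
  exists u1 i u2, u = u1 ++ i :: u2 /\ ev u * t = ev (u1 ++ u2).
Proof.
elim: u => //= i u IHu; rewrite inE => /predU1P[->|/IHu[u1 [j [u2 [-> E]]]]].
  exists [::], i, u; split=> //=.
  by rewrite word_eval_cons conjgE !mulgA mulgK cox_genK mul1g.
by exists (i :: u1), j, u2; rewrite /= !word_eval_cons -mulgA E.
Qed.

Lemma word_eval_braid i j k : ev (flatten (nseq k [:: i; j])) = (g i * g j) ^+ k.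
Proof.
elim: k => [|k IHk]; first by rewrite word_eval_nil.
by rewrite /= !word_eval_cons IHk mulgA -expgS.
Qed.

Lemma reflections_braid i j k :
  reflections (flatten (nseq k [:: i; j])) =
  rev (mkseq (fun p => (g j * g i) ^+ p * g j) (k + k)).
Proof.
have swap l : g j * (g i * g j) ^+ l = (g j * g i) ^+ l * g j.
  by elim: l => [|l IHl]; rewrite ?mulg1 ?mul1g// !expgS -!mulgA -IHl !mulgA.
have inv l : ((g i * g j) ^+ l)^-1 = (g j * g i) ^+ l.
  by rewrite -expVgn invgM !cox_genV.
elim: k => [//|k IHk]; rewrite [flatten _]/= [reflections _]/= IHk.
rewrite addnS addSn !mkseqS !rev_rcons !word_eval_cons !word_eval_braid !conjgE.
rewrite invgM inv cox_genV -!mulgA; congr [:: _, _ & _].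
  by rewrite swap !mulgA -[_ * g j * g i]mulgA -expgSr -expgnDr addSn.
by rewrite swap mulgA -expgnDr.
Qed.

(** Since [(g j * g i) ^+ k = 1], the list computed in [reflections_braid] runs through the same [k]
    entries twice. *)
Lemma reflections_relator u t :
  coxeter_relator (@cox_m n C) u -> ~~ odd (count_mem t (reflections u)).
Proof.
move=> ru; case: ru (word_eval_relator ru) => {u} [i|i j k _ _] uE.
  rewrite /= !word_eval_cons word_eval_nil mulg1 conjgE cox_genK mulg1.
  by rewrite cox_genV conjg1; case: eqP.
have ord1 : (g j * g i) ^+ k = 1.
  apply: invg_inj; rewrite invg1 -uE word_eval_braid -expVgn invgM.
  by rewrite !cox_genV.
rewrite reflections_braid /mkseq iotaD map_cat count_rev count_cat add0n.
have -> : iota k k = map (addn k) (iota 0 k) by rewrite -iotaDl addn0.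
rewrite -map_comp (@eq_map _ _ (_ \o _) (fun p => (g j * g i) ^+ p * g j)).
  by rewrite addnn odd_double.
by move=> p; rewrite /= expgnDr ord1 mul1g.
Qed.

(** An inserted relator evaluates to 1, so it leaves the other entries alone and adds only its own
    reflections, conjugated: an even number of each. The parity is thus a function of the group
    element; it replaces the action on roots in the proof of the exchange condition. *)
Lemma reflections_parity u u' t : ev u = ev u' ->
  odd (count_mem t (reflections u)) = odd (count_mem t (reflections u')).
Proof.
move=> /cox_presented; elim=> {u u'} [_ _ [u r v rr]|//|u u' _ ->//|].
  rewrite !reflections_cat !count_cat !oddD word_eval_cat (word_eval_relator rr).
  rewrite mul1g [in RHS](count_map _ _ (reflections r)).
  rewrite (@eq_count _ (preim _ _) (pred1 (t ^ (ev v)^-1))).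
    by rewrite (negPf (reflections_relator _ rr)).
  by move=> x /=; rewrite -(inj_eq (@conjg_inj _ (ev v)^-1)) conjgK.
by move=> u u' u'' _ -> _ ->.
Qed.

(** All relators have even length. Hence a generator never preserves [coxlen], and a non-descent
    raises it by exactly one. *)
Lemma size_parity u u' : ev u = ev u' -> odd (size u) = odd (size u').
Proof.
move=> /cox_presented; elim=> {u u'} [_ _ [u r v rr]|//|u u' _ ->//|].
  rewrite !size_cat !oddD; suff -> : odd (size r) = false by [].
  case: rr => // i j k _ _; rewrite size_flatten /shape map_nseq sumn_nseq.
  by rewrite oddM.
by move=> u u' u'' _ -> _ ->.
Qed.

Lemma coxlen_gen w s : odd (len (w * g s)) = ~~ odd (len w).
Proof.
have [u <- wE] := coxlen_word w; have [u' <- w'E] := coxlen_word (w * g s).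
by rewrite (@size_parity u' (rcons u s)) ?size_rcons// w'E word_eval_rcons wE.
Qed.

Lemma coxlen_gen_le w s : (len (w * g s) <= (len w).+1)%N.
Proof.
have [u <- <-] := coxlen_word w.
by rewrite -word_eval_rcons -(size_rcons u s) coxlen_min.
Qed.

Definition right_descent w s : Prop := (len (w * g s) < len w)%N.

Lemma right_descentP w s : right_descent w s -> len w = (len (w * g s)).+1.
Proof.
move=> ws; apply/eqP; rewrite eqn_leq ws andbT -[w in (len w <= _)%N](mulg_genK w s).
exact: coxlen_gen_le.
Qed.

Lemma right_ascentP w s : ~ right_descent w s -> len (w * g s) = (len w).+1.
Proof.
move=> ws; apply/eqP; rewrite eqn_leq coxlen_gen_le ltn_neqAle.
move/negP: ws; rewrite -leqNgt => ->; rewrite andbT.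
by apply/negP => /eqP/(congr1 odd); rewrite coxlen_gen; case: odd.
Qed.

Lemma coxeter_exchange u s : size u = len (ev u) -> right_descent (ev u) s ->
  exists u1 i u2, u = u1 ++ i :: u2 /\ ev u * g s = ev (u1 ++ u2).
Proof.
move=> ru us; apply: mem_reflections.
have [v vs vE] := coxlen_word (ev u * g s).
have vsE : ev (rcons v s) = ev u by rewrite word_eval_rcons vE mulg_genK.
have gs1 x : (x ^ g s == g s) = (x == g s).
  have gsE : g s ^ g s = g s by rewrite conjgE mulgA mulVg mul1g.
  by rewrite -{2}gsE (inj_eq (@conjg_inj _ _)).
(* The parity is read off the word [rcons v s]. Its last letter contributes [g s] once; an
   occurrence coming from [v] would allow deleting a letter of [v] to spell [ev u], two letters
   short of its length. *)
have : odd (count_mem (g s) (reflections u)).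
  rewrite -(reflections_parity _ vsE) -cats1 reflections_cat count_cat oddD.
  rewrite /= conjgE word_eval_nil mulg1 invg1 mul1g eqxx.
  suff /count_memPn-> : g s \notin map (conjg^~ (ev [:: s])) (reflections v) by [].
  apply/mapP => -[x /mem_reflections[v1 [i [v2 [vE' E]]]] /esym/eqP].
  rewrite word_eval_cons word_eval_nil mulg1 gs1 => /eqP xE.
  have := coxlen_min C (v1 ++ v2); rewrite -E vE xE mulg_genK.
  move: (right_descentP us) vs; rewrite vE' !size_cat/= => ->.
  lia.
by case: (boolP (_ \in _)) => // /count_memPn->.
Qed.

(** Exchange only deletes letters, so reducing a word brings in no new generator: elements of a
    parabolic subgroup have reduced words inside it. *)
Lemma reduced_subword u : exists u',
  [/\ ev u' = ev u, size u' = len (ev u) & {subset u' <= u}].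
Proof.
elim/last_ind: u => [|u s [u' [E sz sub]]].
  by exists [::]; rewrite word_eval_nil coxlen1.
rewrite word_eval_rcons; have [us|us] := pselect (right_descent (ev u) s).
  have := us; rewrite -E => /coxeter_exchange[|u1 [i [u2 [u'E E']]]].
    by rewrite E.
  exists (u1 ++ u2); split=> [|| x xu].
  - by rewrite -E'.
  - have := right_descentP us; rewrite -sz u'E !size_cat/= => szE.
    by rewrite -u'E E; lia.
  - rewrite mem_rcons inE sub ?orbT// u'E mem_cat inE.
    by move: xu; rewrite mem_cat => /orP[]->; rewrite ?orbT.
exists (rcons u' s); rewrite word_eval_rcons size_rcons sz E (right_ascentP us).
by split=> // x; rewrite !mem_rcons !inE => /predU1P[->|/sub->]; rewrite ?eqxx ?orbT.
Qed.

Lemma parabolicP I w : parabolic I w <->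
  exists u, [/\ ev u = w, size u = len w & {subset u <= I}].
Proof.
split=> [[u uI <-]|[u [E _ uI]]]; last by exists u.
have [u' [E sz sub]] := reduced_subword u.
by exists u'; split=> // x /sub/uI.
Qed.

Lemma parabolic1 I : parabolic I (1 : C).
Proof. by exists [::]; rewrite ?word_eval_nil. Qed.

Lemma parabolicM I v w : parabolic I v -> parabolic I w -> parabolic I (v * w).
Proof.
move=> [u uI <-] [u' u'I <-]; exists (u ++ u'); rewrite ?word_eval_cat//.
by move=> x; rewrite mem_cat => /orP[/uI|/u'I].
Qed.

Lemma parabolic_gen I s : s \in I -> parabolic I (g s).
Proof.
move=> sI; exists [:: s]; first by move=> x; rewrite inE => /eqP->.
by rewrite word_eval_cons word_eval_nil mulg1.
Qed.

Lemma word_evalV u : (ev u)^-1 = ev (rev u).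
Proof.
elim: u => [|i u IHu]; first by rewrite word_eval_nil invg1.
by rewrite rev_cons word_eval_rcons word_eval_cons invgM cox_genV IHu.
Qed.

Lemma parabolicV I w : parabolic I w -> parabolic I w^-1.
Proof. by move=> [u uI <-]; exists (rev u); rewrite ?word_evalV// => x; rewrite mem_rev => /uI. Qed.

Lemma sub_parabolic I F (w : C) : (forall s, s \in F -> parabolic I (g s)) ->
  parabolic F w -> parabolic I w.
Proof.
move=> FI [u + <-]; elim: u => [|i u IHu] uF; first by rewrite word_eval_nil; exact: parabolic1.
rewrite word_eval_cons; apply: parabolicM; first by apply/FI/uF; rewrite mem_head.
by apply: IHu => x xu; apply: uF; rewrite inE xu orbT.
Qed.

Lemma cat_eq_cat_cons (T : Type) (b u u1 u2 : seq T) (i : T) :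
  b ++ u = u1 ++ i :: u2 ->
  (exists2 b', b = u1 ++ i :: b' & u2 = b' ++ u) \/
  (exists2 u', u1 = b ++ u' & u = u' ++ i :: u2).
Proof.
elim: b u1 => [|x b IHb] [|y u1] //=; first by right; exists [::].
- by right; exists (y :: u1).
- by case=> -> <-; left; exists b.
- case=> -> /IHb[[b' -> ->]|[u' -> ->]]; first by left; exists b'.
  by right; exists u'.
Qed.

(** Letter by letter, a reduced word of [y] is split off the right end of [v]. This bounds lengths
    in a subgroup generated by descents of [v], whence its finiteness, and makes the longest element
    of a coset an upper bound in the weak order. *)
Lemma descent_parabolic_factor F v y : (forall s, s \in F -> right_descent v s) ->
  parabolic F y -> exists2 a, v = a * y & len v = (len a + len y)%N.
Proof.
move=> vF /parabolicP[u [<- + uF]]; elim/last_ind: u uF => [|u s IHu] uF.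
  by exists v; rewrite word_eval_nil ?mulg1// coxlen1 addn0.
rewrite size_rcons word_eval_rcons => szs.
have usz : size u = len (ev u).
  by apply/eqP; rewrite eqn_leq coxlen_min -ltnS szs coxlen_gen_le.
have [|//|a vE lenv] := IHu; first by move=> x xu; apply: uF; rewrite mem_rcons inE xu orbT.
have /vF vs : s \in F by apply: uF; rewrite mem_rcons mem_head.
have [b bsz bE] := coxlen_word a.
have evbu : ev (b ++ u) = v by rewrite word_eval_cat bE vE.
have [||u1 [i [u2 [buE evs]]]] := @coxeter_exchange (b ++ u) s; rewrite ?evbu//.
  by rewrite size_cat bsz usz.
move: evs; rewrite evbu => evs.
(* The deleted letter cannot lie in [u], as [rcons u s] is reduced. So it lies in the word of [a],
   and what remains of that word spells the new left factor. *)
have [[b' bE' u2E]|[u' u1E uE]] := cat_eq_cat_cons buE; last first.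
  have := coxlen_min C (u' ++ u2).
  suff -> : ev (u' ++ u2) = ev u * g s.
    by rewrite -szs uE !size_cat/=; lia.
  by apply: (mulgI a); rewrite mulgA -vE evs u1E -catA (word_eval_cat b) bE.
have vE' : v = ev (u1 ++ b') * (ev u * g s).
  by rewrite mulgA -word_eval_cat -catA -u2E -evs mulg_genK.
exists (ev (u1 ++ b')) => //.
have := coxlen_min C (u1 ++ b'); have := coxlenM (ev (u1 ++ b')) (ev u * g s).
by rewrite -vE'; move: bsz; rewrite bE' !size_cat/=; lia.
Qed.

Lemma finite_bounded_coxlen A k : (forall w, A w -> (len w <= k)%N) -> finite_set A.
Proof.
move=> Ak.
pose f (t : {j : 'I_k.+1 & j.-tuple 'I_n}) := ev (tagged t).
apply: (@sub_finite_set _ _ (f @` setT)); last exact/finite_image/finite_finset.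
move=> w /Ak wk; have [u usz <-] := coxlen_word w.
have uk : (size u < k.+1)%N by rewrite usz ltnS.
by exists (Tagged (fun j : 'I_k.+1 => j.-tuple 'I_n) (in_tuple u : (Ordinal uk).-tuple 'I_n)).
Qed.

Lemma finite_set_coxlen_max A : finite_set A -> A !=set0 ->
  exists2 w, A w & forall v, A v -> (len v <= len w)%N.
Proof.
move=> /finite_seqP[r ->] [w0 w0r].
have [|w /= wr max] := @arg_maxnP (seq_sub r) (SeqSub w0r) xpredT
  (fun w : seq_sub r => len (val w)) => //.
by exists (val w); [exact: valP|move=> v vr; exact: (max (SeqSub vr))].
Qed.

Lemma descent_parabolic_finite F v : (forall s, s \in F -> right_descent v s) ->
  finite_set (parabolic F : set C).
Proof.
move=> vF; apply: (@finite_bounded_coxlen _ (len v)) => y Fy.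
by have [a _ ->] := descent_parabolic_factor vF Fy; rewrite leq_addl.
Qed.

Lemma parabolic_coset_refl w I : parabolic_coset w I w.
Proof. by exists 1; [exact: parabolic1|rewrite mulg1]. Qed.

Lemma parabolic_cosetP w I x : parabolic_coset w I x <-> parabolic I (w^-1 * x).
Proof.
split=> [[y yI <-]|xI]; first by rewrite mulKg.
by exists (w^-1 * x) => //; rewrite mulVKg.
Qed.

Lemma parabolic_coset_rebase w I x : parabolic_coset w I x ->
  parabolic_coset w I = parabolic_coset x I.
Proof.
move=> /parabolic_cosetP wx; apply/seteqP; split=> y /parabolic_cosetP wy; apply/parabolic_cosetP.
  by have := parabolicM (parabolicV wx) wy; rewrite invgM invgK !mulgA mulgK.
by have := parabolicM wx wy; rewrite mulgA mulgK.
Qed.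

Lemma parabolic_coset_gen w I x s : s \in I -> parabolic_coset w I x ->
  parabolic_coset w I (x * g s).
Proof.
move=> sI wx; rewrite (parabolic_coset_rebase wx); apply/parabolic_cosetP.
by rewrite mulKg; exact: parabolic_gen.
Qed.

Lemma coset_max_descent w I (u : C) : parabolic_coset w I u ->
  (forall v, parabolic_coset w I v -> (len v <= len u)%N) ->
  forall s, s \in I -> right_descent u s.
Proof.
move=> wu max s sI; apply: contrapT => /right_ascentP us.
by have := max _ (parabolic_coset_gen sI wu); rewrite us ltnn.
Qed.

Lemma coset_max_ge w I (u : C) z : parabolic_coset w I u ->
  (forall v, parabolic_coset w I v -> (len v <= len u)%N) ->
  parabolic_coset w I z -> weak_le z u.
Proof.
move=> wu max wz.
have /parabolic_cosetP zu : parabolic_coset u I z by rewrite -(parabolic_coset_rebase wu).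
have [a uE lenu] := descent_parabolic_factor (coset_max_descent wu max) (parabolicV zu).
exists (u^-1 * z)^-1; first by rewrite invgM invgK mulgA mulgV mul1g.
suff az : a = z by rewrite -{1}az.
by apply: (mulIg (u^-1 * z)^-1); rewrite -uE invgM invgK mulgA mulgV mul1g.
Qed.

Lemma weak_le_coxlen v w : weak_le v w -> (len v <= len w)%N.
Proof. by move=> [x _ ->]; rewrite leq_addr. Qed.

Lemma weak_le_coxlen_eq v w : weak_le v w -> (len w <= len v)%N -> v = w.
Proof.
move=> [x -> ->]; rewrite -{2}[len v]addn0 leq_add2l leqn0 => /eqP/coxlen_eq0->.
by rewrite mulg1.
Qed.

Lemma finite_coset_longest w I : finite_set (parabolic I : set C) ->
  exists2 u, is_longest (parabolic_coset w I) u &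
    forall z, parabolic_coset w I z -> weak_le z u.
Proof.
move=> fI; have [||u wu max] := @finite_set_coxlen_max (parabolic_coset w I).
- exact: finite_image.
- by exists w; exact: parabolic_coset_refl.
exists u => [|z]; last exact: coset_max_ge wu max.
split=> // v wv vu; rewrite ltnNge; apply/negP => uv; apply: vu.
by apply: weak_le_coxlen_eq uv; exact: coset_max_ge wu max wv.
Qed.

(** The descent is the last letter of a reduced word of [w^-1 * x] taken in [I]. *)
Lemma weak_le_descent w x : weak_le w x -> w <> x ->
  forall I, parabolic I (w^-1 * x) ->
  exists2 s, s \in I & right_descent x s /\ weak_le w (x * g s).
Proof.
move=> [v -> lenwv] wx I; rewrite mulKg => /parabolicP[u [uE usz uI]].
case/lastP: u uE usz uI => [|u s] uE usz uI.
  by case: wx; rewrite -uE word_eval_nil mulg1.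
have uE' : ev u = v * g s by rewrite -uE word_eval_rcons mulg_genK.
have vs : right_descent v s.
  by rewrite /right_descent -uE' -usz size_rcons ltnS coxlen_min.
have lvs := right_descentP vs.
have lenwvs : len (w * v * g s) = (len w + len (v * g s))%N.
  apply/eqP; rewrite eqn_leq -{1}mulgA coxlenM/=.
  by have := coxlen_gen_le (w * v * g s) s; rewrite mulg_genK lenwv lvs addnS ltnS.
exists s; first by apply: uI; rewrite mem_rcons mem_head.
split; last by exists (v * g s); rewrite ?mulgA.
by rewrite /right_descent lenwvs lenwv lvs addnS.
Qed.

Lemma weak_le_quotient_descent w v s : len (w * v) = (len w + len v)%N ->
  right_descent (w * v) s -> weak_le w (w * v * g s) -> right_descent v s.
Proof.
move=> lenwv wvs [x wx lenx]; rewrite /right_descent.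
have <- : x = v * g s by apply: (mulgI w); rewrite -wx mulgA.
by move: wvs; rewrite /right_descent lenx lenwv ltn_add2l.
Qed.

(* The dihedral coset x <s,t> has its minimum above w: this is the local
   confluence of the descents that stay above w. *)
Lemma descent_diamond w x s (t : 'I_n) : weak_le w x ->
  right_descent x s -> weak_le w (x * g s) ->
  right_descent x t -> weak_le w (x * g t) ->
  exists2 y, weak_le w y &
    [/\ parabolic [set s; t]%SET (x^-1 * y), weak_le y (x * g s) & weak_le y (x * g t)].
Proof.
move=> [v xE lenx] xs wxs xt wxt; set F := [set s; t]%SET.
have vF r : r \in F -> right_descent v r.
  rewrite xE in lenx xs wxs xt wxt.
  by rewrite !inE => /orP[]/eqP->; [move: wxs|move: wxt]; exact: weak_le_quotient_descent.
(* [y0] is a longest element of the group generated by [s] and [t], which is finite because both are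
   descents of [v]. Splitting it off [v] leads to the bottom [w * a] of the diamond. *)
have [|y0 Fy0 max] := finite_set_coxlen_max (descent_parabolic_finite vF).
  by exists 1; exact: parabolic1.
have [a vE lenv] := descent_parabolic_factor vF Fy0.
have lenwa : len (w * a) = (len w + len a)%N.
  have := coxlenM (w * a) y0; have := coxlenM w a.
  by rewrite -mulgA -vE -xE lenx lenv; lia.
have y0F r : r \in F -> right_descent y0 r.
  move=> rF; apply: contrapT => /right_ascentP y0r.
  by have := max _ (parabolicM Fy0 (parabolic_gen rF)); rewrite y0r ltnn.
have le r : r \in F -> weak_le (w * a) (x * g r).
  move=> rF; exists (y0 * g r); first by rewrite xE vE !mulgA.
  apply/eqP; rewrite eqn_leq {1}xE {1}vE -!mulgA !(mulgA w) coxlenM/=.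
  have := right_descentP (y0F _ rF); have := coxlen_gen_le (x * g r) r.
  by rewrite mulg_genK lenx lenv lenwa; lia.
exists (w * a); first by exists a.
split; [|by apply: le; rewrite !inE eqxx ?orbT..].
by rewrite xE vE !invgM -!mulgA mulKg mulVg mulg1; exact: parabolicV.
Qed.

Definition above_coset_min w x0 I m : Prop :=
  [/\ parabolic_coset x0 I m, weak_le w m &
      forall s, s \in I -> right_descent m s -> ~ weak_le w (m * g s)].

Lemma above_coset_min_below w x0 I x : parabolic_coset x0 I x -> weak_le w x ->
  exists2 m, above_coset_min w x0 I m & weak_le m x.
Proof.
have [k] := ubnP (len x); elim: k x => // k IHk x xk Ax wx.
have [[s [sI [xs wxs]]]|no] :=
  pselect (exists s, s \in I /\ right_descent x s /\ weak_le w (x * g s)).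
  have [|||m mm mle] := IHk (x * g s) => //; [|exact: parabolic_coset_gen|].
    by apply: leq_trans xs _; rewrite -ltnS.
  exists m => //; apply: weak_le_trans mle _; exists (g s); first by rewrite mulg_genK.
  have := coxlenM (x * g s) (g s); rewrite mulg_genK (right_descentP xs).
  have := coxlen_gen_le 1 s; rewrite mul1g coxlen1; lia.
exists x; last exact: weak_le_refl.
by split=> // s sI xs wxs; apply: no; exists s.
Qed.

(** Newman's lemma for the moves from [x] to [x * g s], where [s] in [I] is a descent and [w] stays
    below: they terminate because the length drops, and [descent_diamond] is local confluence. *)
Lemma above_coset_min_uniq w x0 I x m1 m2 : parabolic_coset x0 I x -> weak_le w x ->
  above_coset_min w x0 I m1 -> above_coset_min w x0 I m2 ->
  weak_le m1 x -> weak_le m2 x -> m1 = m2.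
Proof.
have [k] := ubnP (len x); elim: k x m1 m2 => // k IHk x m1 m2 xk Ax wx mm1 mm2 m1x m2x.
have desc m : above_coset_min w x0 I m -> weak_le m x -> m <> x ->
    exists2 s, s \in I & right_descent x s /\ weak_le m (x * g s).
  move=> [Am _ _] mx mNx; apply: weak_le_descent => //.
  by apply/parabolic_cosetP; rewrite -(parabolic_coset_rebase Am).
have minx m m' : above_coset_min w x0 I m -> above_coset_min w x0 I m' -> weak_le m' x ->
    m = x -> m' = x.
  move=> [_ _ lm] mm' m'x mE; apply: contrapT => /(desc _ mm' m'x)[s sI [xs m'xs]].
  have [_ wm' _] := mm'.
  by rewrite mE in lm; apply: (lm s) => //; exact: weak_le_trans m'xs.
have [m1E|m1N] := pselect (m1 = x); first by rewrite m1E (minx _ _ mm1 mm2).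
have [m2E|m2N] := pselect (m2 = x); first by rewrite m2E (minx _ _ mm2 mm1).
have [s sI [xs m1xs]] := desc _ mm1 m1x m1N.
have [t tI [xt m2xt]] := desc _ mm2 m2x m2N.
have [_ wm1 _] := mm1; have [_ wm2 _] := mm2.
have wxs := weak_le_trans wm1 m1xs; have wxt := weak_le_trans wm2 m2xt.
have [y wy [Fy yxs yxt]] := descent_diamond wx xs wxs xt wxt.
have Ay : parabolic_coset x0 I y.
  rewrite (parabolic_coset_rebase Ax); apply/parabolic_cosetP.
  by apply: sub_parabolic Fy => r; rewrite !inE => /orP[]/eqP->; exact: parabolic_gen.
have [m3 mm3 m3y] := above_coset_min_below Ay wy.
(* [m3] lies below both [x * g s] and [x * g t], which are shorter than [x]; the induction
   hypothesis identifies it with [m1] on one side and with [m2] on the other. *)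
transitivity m3.
  apply: (IHk (x * g s)) => //; [|exact: parabolic_coset_gen|exact: weak_le_trans yxs].
  by apply: leq_trans xs _; rewrite -ltnS.
apply: (IHk (x * g t)) => //; [|exact: parabolic_coset_gen|exact: weak_le_trans yxt].
by apply: leq_trans xt _; rewrite -ltnS.
Qed.

(** If no such [s] exists, [x] is minimal among the elements of the coset above [w]. The whole coset
    lies below its longest element, so the minimal element under [y] must be [x]; then [x] is below
    [y], and the lengths force equality. *)
Lemma coset_above_descent w x0 I x y : finite_set (parabolic I : set C) ->
  parabolic_coset x0 I x -> parabolic_coset x0 I y -> weak_le w x -> weak_le w y ->
  y <> x -> (len y <= len x)%N ->
  exists s, [/\ right_descent x s, weak_le w (x * g s) & parabolic_coset x0 I (x * g s)].
Proof.
move=> fI Ax Ay wx wy yx lenyx; apply: contrapT => no.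
have mx : above_coset_min w x0 I x.
  by split=> // s sI xs wxs; apply: no; exists s; split=> //; exact: parabolic_coset_gen.
have [m mm my] := above_coset_min_below Ay wy.
have [u [Au _] top] := finite_coset_longest x0 fI.
have xu := top _ Ax; have mu := weak_le_trans my (top _ Ay).
have xm := above_coset_min_uniq Au (weak_le_trans wx xu) mx mm xu mu.
by apply: yx; rewrite -xm in my; rewrite (weak_le_coxlen_eq my lenyx).
Qed.

End CoxeterCombinatorics.

(** * Chain-supported measures and contractions of order complexes *)

Section WithinContinuity.
Variables (R : realType) (Y : topologicalType) (A : set Y).
Implicit Types f g : Y -> R.

Lemma within_cst (k : R) : {within A, continuous (fun=> k : R)}.
Proof. by move=> y; exact: cvg_cst. Qed.

Lemma withinD f g : {within A, continuous f} -> {within A, continuous g} ->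
  {within A, continuous (fun y => f y + g y)}.
Proof. by move=> cf cg y; apply: cvgD; [exact: cf|exact: cg]. Qed.

Lemma withinB f g : {within A, continuous f} -> {within A, continuous g} ->
  {within A, continuous (fun y => f y - g y)}.
Proof. by move=> cf cg y; apply: cvgB; [exact: cf|exact: cg]. Qed.

Lemma withinM f g : {within A, continuous f} -> {within A, continuous g} ->
  {within A, continuous (fun y => f y * g y)}.
Proof. by move=> cf cg y; apply: cvgM; [exact: cf|exact: cg]. Qed.

Lemma within_min f g : {within A, continuous f} -> {within A, continuous g} ->
  {within A, continuous (fun y => Num.min (f y) (g y))}.
Proof.
by move=> cf cg y; exact: (@continuous_min R (subspace A) f g y (cf y) (cg y)).
Qed.

Lemma within_max f g : {within A, continuous f} -> {within A, continuous g} ->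
  {within A, continuous (fun y => Num.max (f y) (g y))}.
Proof.
by move=> cf cg y; exact: (@continuous_max R (subspace A) f g y (cf y) (cg y)).
Qed.

Lemma within_sum (I : Type) (r : seq I) (F : I -> Y -> R) :
  (forall i, {within A, continuous (F i)}) ->
  {within A, continuous (fun y => \sum_(i <- r) F i y)}.
Proof.
move=> cF; elim: r => [|i r IHr].
  under eq_fun do rewrite big_nil; exact: within_cst.
under eq_fun do rewrite big_cons; exact: withinD.
Qed.

Lemma within_eq f g : (forall y, A y -> f y = g y) ->
  {within A, continuous f} -> {within A, continuous g}.
Proof. by move=> fg; apply: subspace_eq_continuous => y /set_mem /fg. Qed.

Lemma closed_within_preimage f (V : set R) : closed A -> closed V ->
  {within A, continuous f} -> closed (A `&` f @^-1` V).
Proof.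
move=> cA cV /continuous_closedP/(_ _ cV)/closed_subspaceP[V' cV' V'E].
by rewrite setIC -V'E; exact: closedI.
Qed.

Lemma closed_within_all_eq0 (P : eqType) (B : seq P) (F : P -> Y -> R) :
  closed A -> (forall p, {within A, continuous (F p)}) ->
  closed [set y | A y /\ forall p, p \in B -> F p y = 0].
Proof.
move=> cA cF; elim: B => [|p B IHB].
  by rewrite (_ : [set _ | _] = A)//; apply/seteqP; split=> y // [].
have := closedI (closed_within_preimage cA (@closed_eq _ (0 : R)) (cF p)) IHB.
congr closed; apply/seteqP; split=> y /=.
  move=> [[Ay p0] [_ B0]]; split=> // q; rewrite inE => /predU1P[->//|]; exact: B0.
move=> [Ay B0]; do !split=> //; first by apply: B0; rewrite mem_head.
by move=> q qB; apply: B0; rewrite inE qB orbT.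
Qed.

End WithinContinuity.

Section Mass.
Variables (R : realType) (P : choiceType).
Implicit Types (b c : P -> R) (T : set P) (p q m : P) (B : seq P).

Definition supp b : set P := [set p | b p != 0].

Definition mass b : R := \sum_(p \in [set: P]) b p.

Lemma mass_seq B b : uniq B -> (forall p, b p != 0 -> p \in B) ->
  mass b = \sum_(p <- B) b p.
Proof.
move=> uB bB; rewrite /mass (fsbigE B)//; last first.
  by move=> p _; apply: contraNeq; exact: bB.
by apply: eq_bigl => p; rewrite in_setT.
Qed.

Lemma finite_suppP b : finite_set (supp b) <->
  exists2 B, uniq B & forall p, b p != 0 -> p \in B.
Proof.
split=> [/finite_seqP[B BE]|[B _ bB]].
  exists (undup B); first exact: undup_uniq.
  by move=> p bp; rewrite mem_undup; have : supp b p by []; rewrite BE.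
by apply: (@sub_finite_set _ _ [set` B]) => //; exact: finite_seq.
Qed.

Lemma mass_ge0 b : (forall p, 0 <= b p) -> 0 <= mass b.
Proof. by move=> b0; apply: fsumr_ge0 => p _. Qed.

Lemma massD b c : finite_set (supp b) -> finite_set (supp c) ->
  mass (fun p => b p + c p) = mass b + mass c.
Proof.
move=> /finite_suppP[B uB bB] /finite_suppP[B' uB' cB'].
have uBB' := undup_uniq (B ++ B').
rewrite !(mass_seq uBB') ?big_split// => p.
- by move=> cp; rewrite mem_undup mem_cat cB' ?orbT.
- by move=> bp; rewrite mem_undup mem_cat bB.
apply: contraNT; rewrite mem_undup mem_cat negb_or => /andP[pB pB'].
by rewrite (contraNeq (@bB p) pB) (contraNeq (@cB' p) pB') addr0.
Qed.

Lemma finite_suppD b c : finite_set (supp b) -> finite_set (supp c) ->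
  finite_set (supp (fun p => b p + c p)).
Proof.
move=> fb fc; apply: (@sub_finite_set _ _ (supp b `|` supp c)); last by rewrite finite_setU.
move=> p; apply: contraPP => /not_orP[/negP + /negP]; rewrite !negbK => /eqP bp /eqP cp.
by rewrite /supp/= bp cp addr0 eqxx.
Qed.

Lemma sub_finite_supp b c : (forall p, c p = 0 -> b p = 0) ->
  finite_set (supp c) -> finite_set (supp b).
Proof.
move=> cb; apply: sub_finite_set => p; apply: contraPP => /negP.
by rewrite negbK => /eqP/cb bp; rewrite /supp/= bp eqxx.
Qed.

Lemma mass0 : mass (fun=> 0) = 0.
Proof. by rewrite (@mass_seq [::])// ?big_nil// => p; rewrite eqxx. Qed.

Lemma ler_mass b c : finite_set (supp b) -> finite_set (supp c) ->
  (forall p, b p <= c p) -> mass b <= mass c.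
Proof.
move=> fb fc bc; have -> : mass c = mass b + mass (fun p => c p - b p).
  rewrite -massD//; first by congr mass; apply/funext => p; rewrite addrC subrK.
  apply: finite_suppD => //; apply: sub_finite_supp fb => p ->; exact: oppr0.
by rewrite lerDl mass_ge0// => p; rewrite subr_ge0.
Qed.

Lemma ler_mass_supp b p : finite_set (supp b) -> (forall p, 0 <= b p) -> b p <= mass b.
Proof.
move=> /finite_suppP[B uB bB] b0; have [->|bp] := eqVneq (b p) 0; first exact: mass_ge0.
by rewrite (mass_seq uB bB) (big_rem _ (bB _ bp))/= lerDl sumr_ge0.
Qed.

Definition dirac_at m (u : R) p : R := if p == m then u else 0.

Lemma finite_supp_dirac m u : finite_set (supp (dirac_at m u)).
Proof.
apply: (@sub_finite_set _ _ [set m]) => // p; rewrite /supp /dirac_at/=.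
by case: (p =P m) => // _; rewrite eqxx.
Qed.

Lemma mass_dirac m u : mass (dirac_at m u) = u.
Proof.
rewrite (@mass_seq [:: m])//; first by rewrite big_seq1 /dirac_at eqxx.
by move=> p; rewrite /dirac_at inE; case: (p =P m) => // _; rewrite eqxx.
Qed.

Lemma supp_dirac m u p : supp (dirac_at m u) p -> p = m.
Proof. by rewrite /supp/= /dirac_at; case: (p =P m) => // _; rewrite eqxx. Qed.

Definition on_set T b p : R := if `[< T p >] then b p else 0.

Lemma on_setT T b p : T p -> on_set T b p = b p.
Proof. by move=> Tp; rewrite /on_set asboolT. Qed.

Lemma on_setN T b p : ~ T p -> on_set T b p = 0.
Proof. by move=> Tp; rewrite /on_set asboolF. Qed.

Lemma supp_on_set T b p : supp (on_set T b) p <-> T p /\ supp b p.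
Proof.
rewrite /supp/=; have [Tp|Tp] := pselect (T p); first by rewrite on_setT//; tauto.
by rewrite on_setN// eqxx; split=> // -[].
Qed.

Lemma finite_supp_on_set T b : finite_set (supp b) -> finite_set (supp (on_set T b)).
Proof. by apply: sub_finite_set => p /supp_on_set[]. Qed.

Lemma on_set_ge0 T b : (forall p, 0 <= b p) -> forall p, 0 <= on_set T b p.
Proof. by move=> b0 p; rewrite /on_set; case: ifP. Qed.

Lemma on_setC T b : b = fun p => on_set T b p + on_set (~` T) b p.
Proof.
apply/funext => p; have [Tp|Tp] := pselect (T p).
  by rewrite on_setT// on_setN ?addr0//; apply.
by rewrite on_setN// on_setT// add0r.
Qed.

Lemma on_set_id T b : supp b `<=` T -> on_set T b = b.
Proof.
move=> bT; apply/funext => p; have [bp|/negP] := pselect (supp b p).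
  by rewrite on_setT//; exact: bT.
by rewrite negbK /on_set => /eqP ->; rewrite if_same.
Qed.

Lemma on_set_eq0 T b : supp b `<=` ~` T -> on_set T b = fun=> 0.
Proof.
move=> bT; apply/funext => p; have [Tp|/on_setN//] := pselect (T p).
by rewrite on_setT//; apply: contrapT => /eqP bp; exact: (bT p).
Qed.

Lemma mass_on_setC T b : finite_set (supp b) ->
  mass b = mass (on_set T b) + mass (on_set (~` T) b).
Proof.
move=> fb; rewrite -massD; [|exact: finite_supp_on_set..].
by congr mass; exact: on_setC.
Qed.

End Mass.
Arguments mass {R P} b.
Arguments supp {R P} b _ /.
Arguments on_set {R P} T b p.
Arguments dirac_at {R P} m u p.

Section Families.
Variables (R : realType) (P : choiceType) (Y : topologicalType).
Implicit Types (A : set Y) (h k : Y -> P -> R).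

(* Continuous families of finitely supported functions with a common finite
   support: the continuous maps into a finite subcomplex. *)
Definition finite_family A h : Prop :=
  (forall p, {within A, continuous (h^~ p)}) /\
  exists B : seq P, forall y p, A y -> supp (h y) p -> p \in B.

Lemma finite_family_eq A h k : (forall y, A y -> h y = k y) ->
  finite_family A h -> finite_family A k.
Proof.
move=> hk [ch [B hB]]; split=> [p|].
  by apply: within_eq (ch p) => y /hk ->.
by exists B => y p Ay; rewrite -hk//; exact: hB.
Qed.

Lemma finite_familyU A A' h : closed A -> closed A' ->
  finite_family A h -> finite_family A' h -> finite_family (A `|` A') h.
Proof.
move=> cA cA' [ch [B hB]] [ch' [B' hB']]; split=> [p|].
  exact: withinU_continuous.
by exists (B ++ B') => y p [/hB|/hB'] + /[dup] => /[apply] pB; rewrite mem_cat pB ?orbT.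
Qed.

Lemma finite_familyS A A' h : A `<=` A' -> finite_family A' h -> finite_family A h.
Proof.
move=> AA' [ch [B hB]]; split=> [p|]; first exact: continuous_subspaceW (ch p).
by exists B => y p /AA'; exact: hB.
Qed.

Lemma finite_familyD A h k : finite_family A h -> finite_family A k ->
  finite_family A (fun y p => h y p + k y p).
Proof.
move=> [ch [B hB]] [ck [B' kB']]; split=> [p|]; first exact: withinD.
exists (B ++ B') => y p Ay; rewrite mem_cat; apply: contraNT.
rewrite negb_or => /andP[pB pB'].
by rewrite (contraNeq (hB y p Ay) pB) (contraNeq (kB' y p Ay) pB') addr0.
Qed.

Lemma finite_family_map A h (F : Y -> R -> R) :
  (forall y, A y -> F y 0 = 0) ->
  (forall p, {within A, continuous (fun y => F y (h y p))}) ->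
  finite_family A h -> finite_family A (fun y p => F y (h y p)).
Proof.
move=> F0 cF [_ [B hB]]; split=> //; exists B => y p Ay.
rewrite /supp/= => Fp; apply: (hB y) => //; apply: contra_neq Fp => ->; exact: F0.
Qed.

Lemma finite_family_on_set A h (T : set P) : finite_family A h ->
  finite_family A (fun y => on_set T (h y)).
Proof.
move=> [ch [B hB]]; split=> [p|].
  rewrite /on_set; case: `[< T p >]; [exact: ch|exact: within_cst].
by exists B => y p Ay /supp_on_set[_]; exact: hB.
Qed.

Lemma finite_family_dirac A (f : Y -> R) m : {within A, continuous f} ->
  finite_family A (fun y => dirac_at m (f y)).
Proof.
move=> cf; split=> [p|]; last by exists [:: m] => y p _ /supp_dirac ->; rewrite inE.
by rewrite /dirac_at; case: (p == m); [exact: cf|exact: within_cst].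
Qed.

Lemma finite_family_mass A h : finite_family A h -> {within A, continuous (mass \o h)}.
Proof.
move=> [ch [B hB]].
apply: (@within_eq _ _ _ (fun y => \sum_(p <- undup B) h y p)); last exact: within_sum.
by move=> y Ay; rewrite /= (mass_seq (undup_uniq B))// => p; rewrite mem_undup; exact: hB.
Qed.

(** Outside [T], only the finitely many points of the common support can carry mass, so the
    condition amounts to finitely many closed equations. *)
Lemma finite_family_closed A h (T : set P) : closed A -> finite_family A h ->
  closed [set y | A y /\ supp (h y) `<=` T].
Proof.
move=> cA hF; have [ch [B hB]] := finite_family_on_set (~` T) hF.
rewrite (_ : [set _ | _] = [set y | A y /\ forall p, p \in B -> on_set (~` T) (h y) p = 0]).
  exact: closed_within_all_eq0.
apply/seteqP; split=> y /= [Ay hy]; split=> // p.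
  by move=> _; rewrite (on_set_eq0 (T := ~` T))// => q /hy; rewrite setCK.
move=> hp; apply: contrapT => Tp.
have hp' : supp (on_set (~` T) (h y)) p by apply/supp_on_set.
by move: (hp'); rewrite /supp/= hy ?eqxx//; exact: hB hp'.
Qed.

End Families.

Section ChainMeasures.
Variables (R : realType) (d : Order.disp_t) (P : porderType d).
Implicit Types (b c : P -> R) (T U : set P) (p q m : P) (tau : R).

(** The total mass is left free: restricting a measure, splitting it and adding mass from a cone
    point then need no renormalization. Only [prob_chain] fixes it. *)
Record chain_measure T b : Prop := ChainMeasure {
  chain_measure_ge0 : forall p, 0 <= b p;
  chain_measure_supp : supp b `<=` T;
  chain_measure_chain : forall p q, supp b p -> supp b q -> (p >=< q)%O;
  chain_measure_fin : finite_set (supp b) }.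

Lemma chain_measureS T U b : T `<=` U -> chain_measure T b -> chain_measure U b.
Proof. by move=> TU [b0 bT bc fb]; split=> //; exact: subset_trans TU. Qed.

Lemma chain_measure_sub T U b : supp b `<=` U -> chain_measure T b -> chain_measure U b.
Proof. by move=> bU [b0 bT bc fb]; split. Qed.

Lemma chain_measure_on_set T U b : chain_measure T b -> chain_measure (T `&` U) (on_set U b).
Proof.
move=> [b0 bT bc fb]; split.
- exact: on_set_ge0.
- by move=> p /supp_on_set[Up /bT].
- by move=> p q /supp_on_set[_ bp] /supp_on_set[_]; exact: bc.
- exact: finite_supp_on_set.
Qed.

Lemma chain_measure_le T b c : (forall p, 0 <= c p <= b p) -> chain_measure T b ->
  chain_measure T c.
Proof.
move=> cb [b0 bT bc fb].
have sub : supp c `<=` supp b.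
  move=> p; apply: contra_neq => bp; apply/eqP; rewrite eq_le.
  by have := cb p; rewrite bp andbC.
split=> [p|||]; first by case/andP: (cb p).
- exact: subset_trans bT.
- by move=> p q /sub bp /sub; exact: bc.
- exact: sub_finite_set fb.
Qed.

(* A contraction of the order complex of T, in homogeneous form: a retraction
   of the cone over it (tau is the mass at the cone point). *)
Record cone_retraction T (rho : R -> (P -> R) -> P -> R) : Prop := ConeRetraction {
  cone_retraction0 : forall b, chain_measure T b -> rho 0 b = b;
  cone_retraction_chain : forall tau b, 0 <= tau -> chain_measure T b ->
    chain_measure T (rho tau b);
  cone_retraction_mass : forall tau b, 0 <= tau -> chain_measure T b ->
    mass (rho tau b) = tau + mass b;
  cone_retraction_family : forall (Y : topologicalType) (A : set Y)
      (tau : Y -> R) (h : Y -> P -> R),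
    closed A -> {within A, continuous tau} -> finite_family A h ->
    (forall y, A y -> 0 <= tau y) -> (forall y, A y -> chain_measure T (h y)) ->
    finite_family A (fun y => rho (tau y) (h y)) }.

(** A least element is comparable to everything, so all mass of the cone point can be put there. *)
Lemma cone_retraction_min T m : T m -> (forall p, T p -> (m <= p)%O) ->
  cone_retraction T (fun tau b p => b p + dirac_at m tau p).
Proof.
move=> Tm minm.
have dir0 : dirac_at m (0 : R) = (fun=> 0) :> (P -> R).
  by apply/funext => p; rewrite /dirac_at; case: ifP.
split.
- by move=> b _; apply/funext => p; rewrite dir0 addr0.
- move=> tau b tau0 [b0 bT bc fb].
  have suppD p : supp (fun p => b p + dirac_at m tau p) p -> p = m \/ supp b p.
    rewrite /= /dirac_at; case: (p =P m) => [|_]; first by left.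
    by rewrite addr0; right.
  split=> [p||p q|].
  + by rewrite addr_ge0// /dirac_at; case: ifP.
  + by move=> p /suppD[->|/bT].
  + move=> /suppD[->|bp] /suppD[->|bq]; first exact: comparablexx.
    * by rewrite /Order.comparable minm//; exact: bT.
    * by rewrite /Order.comparable (minm p) ?orbT//; exact: bT.
    * exact: bc.
  + by apply: finite_suppD => //; exact: finite_supp_dirac.
- move=> tau b _ [_ _ _ fb]; rewrite massD//; last exact: finite_supp_dirac.
  by rewrite mass_dirac addrC.
- by move=> Y A tau h _ ctau hF _ _; apply: finite_familyD => //; exact: finite_family_dirac.
Qed.

(** The order complex of the union is the union of the two order complexes. A point of the support
    that is not above [m] lies in [T1]; it forces larger points into [T1], and smaller ones are not
    above [m] either. *)
Lemma upset_chain_measureU T1 m b : (forall p q, T1 p -> (p <= q)%O -> T1 q) ->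
  chain_measure (T1 `|` [set p | (m <= p)%O]) b ->
  supp b `<=` T1 \/ supp b `<=` [set p | (m <= p)%O].
Proof.
move=> up [_ bT bc _]; have [|NT1] := pselect (supp b `<=` T1); first by left.
right=> q bq; apply: contrapT => /negP mq; apply: NT1 => p bp.
have T1q : T1 q by have [//|/= mq'] := bT _ bq; rewrite mq' in mq.
have [//|/= mp] := bT _ bp; have /orP[pq|qp] := bc _ _ bp bq.
  by rewrite (le_trans mp pq) in mq.
exact: up qp.
Qed.

(** * Gluing a cone onto a contractible up-set along a contractible link *)

Section Glue.
Variables (T1 : set P) (m : P) (rho1 rhoL : R -> (P -> R) -> P -> R).
Let U := [set p | (m <= p)%O].
Let L := T1 `&` U.
Hypothesis T1_up : forall p q, T1 p -> (p <= q)%O -> T1 q.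
Hypothesis rho1P : cone_retraction T1 rho1.
Hypothesis rhoLP : cone_retraction L rhoL.

Let out b := on_set (~` T1) b.
Let lnk b := on_set T1 b.
(* Mass taken from outside T1 and moved to the cone point; it reaches tau as
   soon as something is left outside T1. *)
Let taken tau b : R := mass (fun p => Num.min (out b p) tau).
Let rest tau b p : R := Num.max (out b p - tau) 0.
(* The cone point then holds tau + taken, which is split between the
   retractions of the cones over T1, L and U: all to T1 if nothing is taken,
   all to U as soon as something is left. *)
Let share1 tau b : R := Num.max (tau - 2 * taken tau b) 0.
Let shareL tau b : R := Num.max 0 (Num.min (3 * taken tau b) (3 * (tau - taken tau b))).
Let shareU tau b : R := tau + taken tau b - shareL tau b - share1 tau b.
Let inner tau b p :=
  rhoL (shareL tau b) (lnk b) p + rest tau b p + dirac_at m (shareU tau b) p.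
Let outer tau b := if share1 tau b == 0 then inner tau b else rho1 (share1 tau b) (inner tau b).

Let glue tau b := if `[< supp b `<=` T1 >] then rho1 tau b else outer tau b.

Let lnkP b : chain_measure U b -> chain_measure L (lnk b).
Proof. by move=> bU; rewrite /L setIC; exact: chain_measure_on_set. Qed.

Let outP b : chain_measure U b -> chain_measure U (out b).
Proof. by move=> bU; apply: chain_measureS (chain_measure_on_set _ bU) => p []. Qed.

Let taken_fin tau b : 0 <= tau -> chain_measure U b ->
  finite_set (supp (fun p => Num.min (out b p) tau)).
Proof.
move=> tau0 /outP[_ _ _]; apply: sub_finite_supp => p ->.
exact/min_idPl.
Qed.

Let taken_ge0 tau b : 0 <= tau -> chain_measure U b -> 0 <= taken tau b.
Proof.
by move=> tau0 /outP[ou0 _ _ _]; apply: mass_ge0 => p; rewrite le_min ou0.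
Qed.

Let rest_ge0 tau b p : 0 <= rest tau b p. Proof. by rewrite le_max lexx orbT. Qed.

Let rest_supp tau b p : 0 <= tau -> chain_measure U b -> supp (rest tau b) p ->
  supp (out b) p /\ tau <= taken tau b.
Proof.
move=> tau0 bU lp; have lt : tau < out b p.
  rewrite ltNge; apply: contra lp => le; apply/eqP/max_idPr.
  by rewrite subr_le0.
split; first by rewrite /= gt_eqF//; exact: le_lt_trans lt.
rewrite -[X in X <= _](min_idPr (ltW lt)).
apply: (@ler_mass_supp _ _ (fun p => Num.min (out b p) tau)); first exact: taken_fin.
by move=> q; rewrite le_min tau0 andbT; case: (outP bU).
Qed.

Let rest_fin tau b : 0 <= tau -> chain_measure U b -> finite_set (supp (rest tau b)).
Proof.
move=> tau0 bU; have [_ _ _] := outP bU.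
by apply: sub_finite_set => p /(rest_supp tau0 bU)[].
Qed.

Let share1_ge0 tau b : 0 <= share1 tau b. Proof. by rewrite le_max lexx orbT. Qed.
Let shareL_ge0 tau b : 0 <= shareL tau b. Proof. by rewrite le_max lexx. Qed.

Let shareU_ge0 tau b : 0 <= tau -> chain_measure U b -> 0 <= shareU tau b.
Proof.
move=> tau0 /(taken_ge0 tau0); rewrite /shareU /shareL /share1.
move: (taken tau b) => a a0; rewrite /Num.max /Num.min.
by do 3! case: ifPn; lra.
Qed.

Let rest_share tau b p : 0 <= tau -> chain_measure U b -> supp (rest tau b) p ->
  share1 tau b = 0 /\ shareL tau b = 0.
Proof.
move=> tau0 bU /(rest_supp tau0 bU)[_]; rewrite /shareL /share1.
move: (taken tau b) => a; rewrite /Num.max /Num.min.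
by split; do 2? case: ifPn; lra.
Qed.

Let mass_out tau b : 0 <= tau -> chain_measure U b ->
  mass (out b) = taken tau b + mass (rest tau b).
Proof.
move=> tau0 bU; rewrite -massD; [|exact: taken_fin|exact: rest_fin].
congr mass; apply/funext => p; rewrite /rest /Num.min /Num.max.
by do 2! case: ifPn; lra.
Qed.

(** The danger is that [rhoL] moves the part in [T1] to points not comparable with what is left
    outside. But as soon as [rest] is nonzero, [shareL] vanishes and [rhoL] is the identity. *)
Let innerP tau b : 0 <= tau -> chain_measure U b -> chain_measure U (inner tau b).
Proof.
move=> tau0 bU; have lL := cone_retraction_chain rhoLP (shareL_ge0 tau b) (lnkP bU).
have supp_inner p : supp (inner tau b) p ->
    [\/ supp (rhoL (shareL tau b) (lnk b)) p, supp (rest tau b) p | p = m].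
  move=> /= ip; have [->|pm] := eqVneq p m; first by constructor 3.
  have [r0|] := eqVneq (rhoL (shareL tau b) (lnk b) p) 0; last by constructor 1.
  by constructor 2; move: ip; rewrite /inner r0 /dirac_at (negPf pm) addr0 add0r.
have lr p q : supp (rhoL (shareL tau b) (lnk b)) p -> supp (rest tau b) q -> (p >=< q)%O.
  move=> rp lq; have [_ sL0] := rest_share tau0 bU lq.
  move: rp; rewrite sL0 (cone_retraction0 rhoLP (lnkP bU)) => /supp_on_set[_ bp].
  have [/supp_on_set[_ bq] _] := rest_supp tau0 bU lq.
  exact: chain_measure_chain bU _ _ bp bq.
have innerU : supp (inner tau b) `<=` U.
  move=> p /supp_inner[/(chain_measure_supp lL)[]//|/(rest_supp tau0 bU)[+ _]|->].
    by move=> /supp_on_set[_ /(chain_measure_supp bU)].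
  exact: lexx.
split=> // [p|p q ip iq|].
- rewrite /inner !addr_ge0//; first exact: chain_measure_ge0 lL _.
  by rewrite /dirac_at; case: ifP => // _; exact: shareU_ge0.
- have := innerU _ ip; have := innerU _ iq; rewrite /U/= => mq mp.
  case: (supp_inner _ ip) (supp_inner _ iq) => [rp|lp|->] [rq|lq|->]; do ?
    [by rewrite /Order.comparable ?mp ?mq ?lexx ?orbT|].
  + exact: chain_measure_chain lL _ _ rp rq.
  + exact: lr.
  + by rewrite comparable_sym; exact: lr.
  + have [/supp_on_set[_ bp] _] := rest_supp tau0 bU lp.
    have [/supp_on_set[_ bq] _] := rest_supp tau0 bU lq.
    exact: chain_measure_chain bU _ _ bp bq.
- apply: finite_suppD; last exact: finite_supp_dirac.
  by apply: finite_suppD; [exact: chain_measure_fin lL|exact: rest_fin].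
Qed.

Let mass_inner tau b : 0 <= tau -> chain_measure U b ->
  share1 tau b + mass (inner tau b) = tau + mass b.
Proof.
move=> tau0 bU; have lL := cone_retraction_chain rhoLP (shareL_ge0 tau b) (lnkP bU).
have fL := chain_measure_fin lL; have fl := rest_fin tau0 bU.
rewrite massD; [|exact: finite_suppD|exact: finite_supp_dirac].
rewrite massD// mass_dirac (cone_retraction_mass rhoLP)//; last exact: lnkP.
rewrite (mass_on_setC T1 (chain_measure_fin bU)) -/(lnk b) -/(out b).
by rewrite (mass_out tau0 bU) /shareU; lra.
Qed.

(** This is what the constants 2 and 3 achieve. With [a] for [taken tau b], the shares of T1, L and
    U are [tau - 2a], [3a], [0] while [2a <= tau], and [0], [3(tau - a)], [4a - 2tau] while
    [a <= tau <= 2a]. So no mass is put at [m] as long as [rho1] may still have to be applied. *)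
Let inner_link tau b : 0 <= tau -> chain_measure U b ->
  2 * taken tau b <= tau -> (forall p, rest tau b p = 0) ->
  chain_measure L (inner tau b).
Proof.
move=> tau0 bU le l0; have lL := cone_retraction_chain rhoLP (shareL_ge0 tau b) (lnkP bU).
suff -> : inner tau b = rhoL (shareL tau b) (lnk b) by [].
have -> : shareU tau b = 0 -> inner tau b = rhoL (shareL tau b) (lnk b).
  move=> sU0; apply/funext => p; rewrite /inner l0 sU0 addr0 /dirac_at.
  by case: ifP; rewrite addr0.
by [].
have := taken_ge0 tau0 bU; move: le; rewrite /shareU /shareL /share1.
by move: (taken tau b) => a; rewrite /Num.max /Num.min; do 3! case: ifPn; lra.
Qed.

Let share1_gt0 tau b : 0 <= tau -> chain_measure U b -> share1 tau b != 0 ->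
  chain_measure L (inner tau b).
Proof.
move=> tau0 bU s1; apply: inner_link => // [|p].
  by move: s1; rewrite /share1 /Num.max; case: ifPn; rewrite ?eqxx//; lra.
apply: contraNeq s1 => lp; apply/eqP; by case: (rest_share tau0 bU lp).
Qed.

Let outerP tau b : 0 <= tau -> chain_measure U b ->
  chain_measure (T1 `|` U) (outer tau b) /\ mass (outer tau b) = tau + mass b.
Proof.
move=> tau0 bU; rewrite -(mass_inner tau0 bU) /outer; case: eqP => [->|/eqP s1].
  rewrite add0r; split=> //; apply: chain_measureS (innerP tau0 bU) => p; by right.
have i1 : chain_measure T1 (inner tau b).
  by apply: chain_measureS (share1_gt0 tau0 bU s1) => p [].
rewrite (cone_retraction_mass rho1P)//; split=> //.
by apply: chain_measureS (cone_retraction_chain rho1P _ i1) => // p; left.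
Qed.

(** On the intersection nothing lies outside [T1], hence nothing is taken, and the two branches of
    [glue] agree. *)
Let outer_link tau b : 0 <= tau -> chain_measure L b -> outer tau b = rho1 tau b.
Proof.
move=> tau0 bL; have bT : supp b `<=` T1 by move=> p /(chain_measure_supp bL)[].
have ouz : out b = fun=> 0 by apply: on_set_eq0; rewrite setCK.
have a0 : taken tau b = 0.
  by rewrite -[RHS](mass0 R P) /taken ouz; congr mass; apply/funext => p; exact/min_idPl.
have s1 : share1 tau b = tau by rewrite /share1 a0 mulr0 subr0; exact/max_idPl.
have sL : shareL tau b = 0.
  rewrite /shareL a0 mulr0; apply/max_idPl.
  by rewrite ge_min lexx.
have iE : inner tau b = b.
  apply/funext => p; rewrite /inner sL /lnk on_set_id// (cone_retraction0 rhoLP bL).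
  rewrite /rest ouz /shareU a0 sL s1 sub0r (max_idPr _) ?oppr_le0// /dirac_at.
  by case: ifP; rewrite ?addr0// subr0 subrr addr0.
rewrite /outer s1 iE; case: eqP => // ->.
by rewrite (cone_retraction0 rho1P)//; apply: chain_measureS bL => p [].
Qed.

Let outer_family (Y : topologicalType) (A : set Y) (tau : Y -> R) (h : Y -> P -> R) :
  closed A -> {within A, continuous tau} -> finite_family A h ->
  (forall y, A y -> 0 <= tau y) -> (forall y, A y -> chain_measure U (h y)) ->
  finite_family A (fun y => outer (tau y) (h y)).
Proof.
move=> cA ctau hF tau0 hU.
have outF : finite_family A (fun y => out (h y)) by exact: finite_family_on_set.
have cout := proj1 outF.
have lnkF : finite_family A (fun y => lnk (h y)) by exact: finite_family_on_set.
have ctaken : {within A, continuous (fun y => taken (tau y) (h y))}.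
  apply: (@finite_family_mass _ _ _ _ (fun y p => Num.min (out (h y) p) (tau y))).
  apply: (finite_family_map (F := fun y x => Num.min x (tau y))) outF => [y Ay|p].
    by apply/min_idPl; exact: tau0.
  exact: within_min.
have restF : finite_family A (fun y => rest (tau y) (h y)).
  apply: (finite_family_map (F := fun y x => Num.max (x - tau y) 0)) outF => [y Ay|p].
    by apply/max_idPr; rewrite sub0r oppr_le0 tau0.
  by apply: within_max; [exact: withinB|exact: within_cst].
have c1 : {within A, continuous (fun y => share1 (tau y) (h y))}.
  apply: within_max; last exact: within_cst.
  by apply: withinB => //; apply: withinM => //; exact: within_cst.
have cL : {within A, continuous (fun y => shareL (tau y) (h y))}.
  apply: within_max; first exact: within_cst.
  apply: within_min; apply: withinM; [exact: within_cst|exact: ctaken|exact: within_cst|].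
  exact: withinB.
have cU : {within A, continuous (fun y => shareU (tau y) (h y))}.
  by apply: withinB => //; apply: withinB => //; exact: withinD.
have innerF : finite_family A (fun y => inner (tau y) (h y)).
  apply: finite_familyD; last exact: finite_family_dirac.
  apply: finite_familyD => //; apply: (cone_retraction_family rhoLP) => //.
  by move=> y Ay; exact/lnkP/hU.
have [crest [B hB]] := restF.
(* The test in [outer] is traded for a cover by two closed sets. On [A1] the formula with [rho1]
   holds even where [share1] vanishes, since [rho1] is the identity there. *)
pose A0 := A `&` (fun y => share1 (tau y) (h y)) @^-1` [set 0].
pose A1 := (A `&` (fun y => 2 * taken (tau y) (h y) - tau y) @^-1` [set x | x <= 0]) `&`
  [set y | A y /\ forall p, p \in B -> rest (tau y) (h y) p = 0].
have A0A : A0 `<=` A by move=> y [].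
have A1A : A1 `<=` A by move=> y [[]].
have cA0 : closed A0 by exact: closed_within_preimage.
have cA1 : closed A1.
  apply: closedI; last exact: closed_within_all_eq0.
  apply: closed_within_preimage => //.
  by apply: withinB => //; apply: withinM => //; exact: within_cst.
have A1L y : A1 y -> chain_measure L (inner (tau y) (h y)).
  move=> [[Ay /= le] [_ r0]]; apply: inner_link => //; [exact: tau0|exact: hU|lra|].
  move=> p; have [/r0//|] := boolP (p \in B).
  by apply: contraNeq; exact: hB.
apply: (@finite_familyS _ _ _ _ (A0 `|` A1)) => [y Ay|].
  have [s0|/eqP s0] := pselect (share1 (tau y) (h y) = 0); [by left|right].
  have s1 : 0 < tau y - 2 * taken (tau y) (h y).
    by move: s0; rewrite /share1 /Num.max; case: ifPn; rewrite ?eqxx//; lra.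
  split; first by split=> //=; lra.
  split=> // p _; apply: contraNeq s0 => rp; apply/eqP.
  by case: (rest_share (tau0 _ Ay) (hU _ Ay) rp).
apply: finite_familyU => //.
  apply: (@finite_family_eq _ _ _ _ (fun y => inner (tau y) (h y))).
    by move=> y [Ay /= s0]; rewrite /outer s0 eqxx.
  exact: finite_familyS innerF.
apply: (@finite_family_eq _ _ _ _
    (fun y => rho1 (share1 (tau y) (h y)) (inner (tau y) (h y)))).
  move=> y A1y; rewrite /outer; case: eqP => // ->; rewrite (cone_retraction0 rho1P)//.
  by apply: chain_measureS (A1L _ A1y) => p [].
apply: (cone_retraction_family rho1P) => //.
- exact: continuous_subspaceW c1.
- exact: finite_familyS innerF.
- by move=> y /A1L; apply: chain_measureS => p [].
Qed.

(** That the new retraction extends [rho1] is what allows infinitely many gluings to be taken to the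
    limit. *)
Lemma cone_retraction_glue : exists2 rho, cone_retraction (T1 `|` U) rho &
  forall tau b, 0 <= tau -> chain_measure T1 b -> rho tau b = rho1 tau b.
Proof.
have glue1 tau b : chain_measure T1 b -> glue tau b = rho1 tau b.
  by move=> bT; rewrite /glue asboolT//; exact: chain_measure_supp bT.
have glue2 tau b : 0 <= tau -> chain_measure U b -> glue tau b = outer tau b.
  move=> tau0 bU; rewrite /glue; case: asboolP => // bT; rewrite outer_link//.
  by apply: (chain_measure_sub _ bU) => p bp; split; [exact: bT|exact: chain_measure_supp bU _ bp].
have cases b : chain_measure (T1 `|` U) b -> chain_measure T1 b \/ chain_measure U b.
  move=> bT; have [bT1|bU] := upset_chain_measureU T1_up bT; [left|right];
  exact: chain_measure_sub bT.
exists glue; last by move=> tau b _; exact: glue1.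
split.
- move=> b /cases[bT|bU]; first by rewrite glue1// (cone_retraction0 rho1P).
  rewrite glue2// /outer /share1; case: eqP => [_|/eqP]; last first.
    rewrite sub0r max_r ?eqxx// oppr_le0 mulr_ge0// taken_ge0//.
  apply/funext => p; rewrite /inner.
  have a0 : taken 0 b = 0.
    rewrite -[RHS](mass0 R P); congr mass; apply/funext => q.
    by apply/min_idPr; case: (outP bU).
  have sL : shareL 0 b = 0.
    by rewrite /shareL a0 subr0 mulr0 minxx maxxx.
  have sU : shareU 0 b = 0.
    by rewrite /shareU sL /share1 a0 mulr0 addr0 !subr0 maxxx subr0.
  rewrite sL sU (cone_retraction0 rhoLP (lnkP bU)) /rest subr0 max_l; last first.
    by case: (outP bU).
  rewrite /dirac_at; have := congr1 (@^~ p) (on_setC T1 b) => /= <-.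
  by case: ifP => _; rewrite addr0.
- move=> tau b tau0 /cases[bT|bU].
    rewrite glue1//; apply: chain_measureS (cone_retraction_chain rho1P tau0 bT) => p; by left.
  by rewrite glue2//; case: (outerP tau0 bU).
- move=> tau b tau0 /cases[bT|bU].
    by rewrite glue1// (cone_retraction_mass rho1P).
  by rewrite glue2//; case: (outerP tau0 bU).
move=> Y A tau h cA ctau hF tau0 hT.
pose A1 := [set y | A y /\ supp (h y) `<=` T1].
pose A2 := [set y | A y /\ supp (h y) `<=` U].
have A1T y : A1 y -> chain_measure T1 (h y).
  by move=> [Ay hy]; apply: chain_measure_sub (hT _ Ay).
have A2U y : A2 y -> chain_measure U (h y).
  by move=> [Ay hy]; apply: chain_measure_sub (hT _ Ay).
have A1A : A1 `<=` A by move=> y [].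
have A2A : A2 `<=` A by move=> y [].
have cA1 : closed A1 by exact: finite_family_closed.
have cA2 : closed A2 by exact: finite_family_closed.
apply: (@finite_familyS _ _ _ _ (A1 `|` A2)) => [y Ay|].
  by have [hy|hy] := upset_chain_measureU T1_up (hT _ Ay); [left|right].
apply: finite_familyU => //.
  apply: (@finite_family_eq _ _ _ _ (fun y => rho1 (tau y) (h y))).
    by move=> y /A1T bT; rewrite glue1.
  apply: (cone_retraction_family rho1P) => //; [|exact: finite_familyS hF|by move=> y [/tau0]].
  exact: continuous_subspaceW ctau.
apply: (@finite_family_eq _ _ _ _ (fun y => outer (tau y) (h y))).
  by move=> y A2y; rewrite glue2//; [exact/tau0/A2A|exact: A2U].
apply: outer_family => //; [|exact: finite_familyS hF|by move=> y [/tau0]].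
exact: continuous_subspaceW ctau.
Qed.

End Glue.

(** A measure has finite support and a family has a common one, so either lives on a single [T k];
    by the extension property the choice of [k] does not matter. *)
Lemma cone_retraction_bigcup (T : nat -> set P) (rho : nat -> R -> (P -> R) -> P -> R) :
  (forall k, T k `<=` T k.+1) -> (forall k, cone_retraction (T k) (rho k)) ->
  (forall k tau b, 0 <= tau -> chain_measure (T k) b -> rho k.+1 tau b = rho k tau b) ->
  exists r, cone_retraction (\bigcup_k T k) r.
Proof.
move=> TS rhoP rhoS.
have Tle k l : (k <= l)%N -> T k `<=` T l.
  move=> /subnKC <-; elim: (l - k)%N => [|j IHj]; first by rewrite addn0.
  by rewrite addnS; apply: subset_trans IHj _.
have rhole k l tau b : (k <= l)%N -> 0 <= tau -> chain_measure (T k) b ->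
    rho l tau b = rho k tau b.
  move=> /subnKC <- tau0 bT; elim: (l - k)%N => [|j IHj]; first by rewrite addn0.
  rewrite addnS rhoS ?IHj//; apply: chain_measureS bT; apply: Tle; exact: leq_addr.
have bound (B : seq P) : exists k, forall p, p \in B -> (\bigcup_k T k) p -> T k p.
  elim: B => [|p B [k Bk]]; first by exists 0%N.
  have [[l _ Tlp]|NTp] := pselect ((\bigcup_k T k) p).
    exists (maxn k l) => q; rewrite inE => /predU1P[-> _|qB Tq].
      exact: Tle (leq_maxr _ _) _ Tlp.
    exact: Tle (leq_maxl _ _) _ (Bk _ qB Tq).
  by exists k => q; rewrite inE => /predU1P[->|] //; exact: Bk.
have lev b : chain_measure (\bigcup_k T k) b -> exists k, chain_measure (T k) b.
  move=> bT; have [B _ bB] := (finite_suppP b).1 (chain_measure_fin bT).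
  have [k Bk] := bound B; exists k; apply: (chain_measure_sub _ bT) => p bp.
  by apply: Bk; [exact: bB|exact: chain_measure_supp bT _ bp].
(* For a measure on the union a suitable level exists, so [xget] does not fall back on [0]. *)
pose r tau b := rho (xget 0%N [set k | chain_measure (T k) b]) tau b.
have rE k tau b : 0 <= tau -> chain_measure (T k) b -> r tau b = rho k tau b.
  move=> tau0 bT; rewrite /r; case: xgetP => [l _ /= bl|/(_ k)//].
  by have [kl|/ltnW lk] := leqP k l; [exact: rhole|exact/esym/rhole].
exists r; split.
- by move=> b /lev[k bk]; rewrite (rE k)// (cone_retraction0 (rhoP k)).
- move=> tau b tau0 /lev[k bk]; rewrite (rE k)//.
  by apply: chain_measureS (cone_retraction_chain (rhoP k) tau0 bk) => p; exists k.
- by move=> tau b tau0 /lev[k bk]; rewrite (rE k)// (cone_retraction_mass (rhoP k)).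
move=> Y A tau h cA ctau hF tau0 hT; have [_ [B hB]] := hF.
have [k Bk] := bound B.
have hk y : A y -> chain_measure (T k) (h y).
  move=> Ay; apply: chain_measure_sub (hT _ Ay) => p hp.
  by apply: Bk; [exact: hB hp|exact: chain_measure_supp (hT _ Ay) _ hp].
apply: (@finite_family_eq _ _ _ _ (fun y => rho k (tau y) (h y))).
  by move=> y Ay; rewrite (rE k)//; [exact: tau0|exact: hk].
exact: (cone_retraction_family (rhoP k)).
Qed.

End ChainMeasures.

(** * The cosets whose longest element lies above w *)

Section DavisPoset.
Variables (R : realType) (n : nat) (C : coxeterSystem n).
Implicit Types (w x y z : weak_order C) (s t : 'I_n) (I F : {set 'I_n}).
Implicit Types (A B : davis_poset C) (k : nat) (xs : seq (weak_order C)).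

Local Notation W := (weak_order C).
Local Notation Q := (davis_poset C).
Local Notation g := (@cox_gen n C).
Local Notation len := (@coxlen n C).

Lemma weak_leP x y : (x <= y)%O <-> weak_le (x : C) y.
Proof. by split=> [/asboolP|xy]//; exact/asboolP. Qed.

Lemma davis_leP A B : (A <= B)%O <-> sval A `<=` sval B.
Proof. by split=> [/asboolP|AB]//; exact/asboolP. Qed.

Lemma davis_cosetP A : exists w I, finite_set (parabolic I : set C) /\
  sval A = parabolic_coset w I.
Proof. exact/asboolP/(valP A). Qed.

Lemma davis_coset_longest A : exists2 u : C, is_longest (sval A) u &
  forall z : C, sval A z -> weak_le z u.
Proof. by have [w [I [fI ->]]] := davis_cosetP A; exact: finite_coset_longest. Qed.

Definition davis_top A : W := s2val (cid2 (davis_coset_longest A)).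

Lemma davis_top_longest A : is_longest (sval A) (davis_top A : C).
Proof. exact: (s2valP (cid2 (davis_coset_longest A))). Qed.

Lemma davis_top_mem A : sval A (davis_top A).
Proof. by case: (davis_top_longest A). Qed.

Lemma davis_top_ge A x : sval A x -> (x <= davis_top A)%O.
Proof. by move=> Ax; apply/weak_leP; exact: (s2valP' (cid2 (davis_coset_longest A))). Qed.

Lemma davis_top_homo : {homo davis_top : A B / (A <= B)%O}.
Proof. by move=> A B /davis_leP AB; apply: davis_top_ge; apply: AB; exact: davis_top_mem. Qed.

HB.instance Definition _ := Order.isOrderMorphism.Build _ Q _ W davis_top davis_top_homo.

Lemma finite_type_parabolic_coset x I : finite_set (parabolic I : set C) ->
  `[< finite_type_coset (parabolic_coset (x : C) I) >].
Proof. by move=> fI; apply/asboolP; exists x, I. Qed.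

Definition davis_coset x I (fI : finite_set (parabolic I : set C)) : Q :=
  @exist (set C) (fun A : set C => is_true `[< finite_type_coset A >]) _
    (finite_type_parabolic_coset x fI).

Lemma davis_coset_le x I (fI : finite_set (parabolic I : set C)) A :
  (davis_coset x fI <= A)%O <-> sval A x /\ forall s, s \in I -> sval A (x * g s)%g.
Proof.
split=> [/davis_leP xA|[Ax AxI]].
  have xx := parabolic_coset_refl (x : C) I.
  by split=> [|s sI]; apply: xA => //; exact: parabolic_coset_gen.
apply/davis_leP; have [w [J [_ AE]]] := davis_cosetP A; rewrite AE /= in Ax AxI *.
rewrite (parabolic_coset_rebase Ax) in AxI *; move=> y /parabolic_cosetP xy.
apply/parabolic_cosetP; apply: sub_parabolic xy => s /AxI/parabolic_cosetP.
by rewrite mulKg.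
Qed.

Lemma parabolic_set0_finite : finite_set (parabolic finset.set0 : set C).
Proof.
apply: (@sub_finite_set _ _ [set 1%g]) => // w [[|i u] uI <-] /=.
  by rewrite word_eval_nil.
by have := uI i (mem_head _ _); rewrite inE.
Qed.

Definition davis_vertex x : Q := davis_coset x parabolic_set0_finite.

Lemma davis_vertex_le x A : (davis_vertex x <= A)%O <-> sval A x.
Proof. by split=> [/davis_coset_le[]//|Ax]; apply/davis_coset_le; split=> // s; rewrite inE. Qed.

(** [F] accumulates the generators already imposed by the induction below. With [F] empty and [K]
    the descents of [x] that stay above [w], this is the part of the cone at [x] attached to earlier
    cosets. *)
Definition link_cosets x F (K : seq 'I_n) : set Q := [set A | [/\ sval A x,
  forall s, s \in F -> sval A (x * g s)%g & exists2 s, s \in K & sval A (x * g s)%g]].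

(** For one [s] of [K] these cosets form the up-set of the coset of [x] under [F] and [s], which has
    finite type because descents generate a finite subgroup. Gluing these cones one [s] at a time,
    each intersection has the same shape with [s] moved into [F]; hence the induction on [K] for all
    [F]. *)
Lemma link_cosets_retraction x F (K : seq 'I_n) : K != [::] ->
  (forall s, s \in F -> right_descent (x : C) s) ->
  (forall s, s \in K -> right_descent (x : C) s) ->
  exists rho, cone_retraction (R := R) (link_cosets x F K) rho.
Proof.
elim: K F => // s K IHK F _ xF xK.
have xsF r : r \in (s |: F)%SET -> right_descent (x : C) r.
  by rewrite !inE => /predU1P[->|/xF//]; apply: xK; rewrite mem_head.
have fsF := descent_parabolic_finite xsF; pose m := davis_coset x fsF.
have mP A : (m <= A)%O <-> link_cosets x F [:: s] A.
  split=> [/davis_coset_le[Ax AF]|[Ax AF [r]]].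
    split=> // [r rF|]; first by apply: AF; rewrite !inE rF orbT.
    by exists s; rewrite ?mem_head//; apply: AF; rewrite !inE eqxx.
  rewrite inE => /eqP-> As; apply/davis_coset_le; split=> // t.
  by rewrite !inE => /predU1P[->//|/AF].
have [->|KN0] := eqVneq K [::].
  by eexists; apply: (@cone_retraction_min _ _ _ _ m) => [|A /mP//]; exact/mP.
have xK' r : r \in K -> right_descent (x : C) r by move=> rK; apply: xK; rewrite inE rK orbT.
have [rhoL rhoLP] := IHK (s |: F)%SET KN0 xsF xK'.
have [rho1 rho1P] := IHK F KN0 xF xK'.
have LE : link_cosets x F K `&` [set A | (m <= A)%O] = link_cosets x (s |: F)%SET K.
  apply/seteqP; split=> A /= => [[[Ax AF AK] /davis_coset_le[_ AsF]]|[Ax AsF AK]].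
    by split.
  split; last exact/davis_coset_le.
  by split=> // r rF; apply: AsF; rewrite !inE rF orbT.
have TE : link_cosets x F K `|` [set A | (m <= A)%O] = link_cosets x F (s :: K).
  apply/seteqP; split=> A /= => [[[Ax AF [r rK Ar]]|/mP[Ax AF [r]]]|[Ax AF [r]]].
  - by split=> //; exists r; rewrite // inE rK orbT.
  - by rewrite inE => /eqP-> As; split=> //; exists s; rewrite ?mem_head.
  - rewrite inE => /predU1P[->|rK] Ar; [right|left]; last by split=> //; exists r.
    by apply/mP; split=> //; exists s; rewrite ?mem_head.
have [] := @cone_retraction_glue R _ _ (link_cosets x F K) m rho1 rhoL => //.
- move=> A B [Ax AF [r rK Ar]] /davis_leP AB; split; [exact: AB|by move=> t /AF/AB|].
  by exists r => //; exact: AB.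
- by rewrite LE.
- by rewrite TE => rho rhoP _; exists rho.
Qed.

Section Above.
Variable w : W.

Definition cosets_above : set Q := [set A | (w <= davis_top A)%O].

Let level k xs : set Q := [set A | exists x,
  [/\ sval A x, (w <= x)%O & (len x <= k)%N \/ x \in xs]].

Let level_add k xs x rho : len x = k.+1 -> (w <= x)%O -> (len w <= k)%N ->
  x \notin xs -> (forall y, y \in xs -> len y = k.+1) ->
  cone_retraction (R := R) (level k xs) rho ->
  exists2 rho', cone_retraction (level k (x :: xs)) rho' &
    forall tau b, 0 <= tau -> chain_measure (level k xs) b -> rho' tau b = rho tau b.
Proof.
move=> xk wx wk xxs xsk rhoP.
pose K := [seq s <- enum 'I_n | `[< right_descent (x : C) s /\ weak_le (w : C) (x * g s)%g >]].
have memK s : s \in K <-> right_descent (x : C) s /\ weak_le (w : C) (x * g s)%g.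
  by rewrite mem_filter mem_enum andbT; split=> [/asboolP|]// H; exact/asboolP.
have KN0 : K != [::].
  have wNx : (w : C) <> x by move=> wE; move: wk; rewrite wE xk ltnn.
  have [|s _ xs'] := @weak_le_descent _ _ _ _ ((weak_leP _ _).1 wx) wNx finset.setT.
    by have [u <-] := cox_generated ((w : C)^-1 * x)%g; exists u => // s; rewrite inE.
  have /memK : right_descent (x : C) s /\ weak_le (w : C) (x * g s)%g by [].
  by case: (K).
have [||rhoL rhoLP] := @link_cosets_retraction x finset.set0 K KN0.
- by move=> s; rewrite inE.
- by move=> s /memK[].
have LE : level k xs `&` [set A | (davis_vertex x <= A)%O] = link_cosets x finset.set0 K.
  apply/seteqP; split=> A.
    move=> [[y [Ay wy yk]] /davis_vertex_le Ax].
    have [x0 [I [fI AE]]] := davis_cosetP A; rewrite AE in Ay Ax.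
    have yNx : (y : C) <> x.
      by move=> yx; case: yk; rewrite yx ?xk ?ltnn// (negPf xxs).
    have ylex : (len y <= len x)%N.
      by rewrite xk; case: yk => [/leqW//|/xsk->].
    (* The earlier element [y] may be as long as [x]. The descent found still leads to length at
       most [k], hence to an element that was present before all of [xs]. *)
    have [s [xs' wxs Axs]] := coset_above_descent fI Ax Ay
      ((weak_leP _ _).1 wx) ((weak_leP _ _).1 wy) yNx ylex.
    split; rewrite ?AE//; first by move=> r; rewrite inE.
    by exists s => //; exact/memK.
  move=> [Ax _ [s /memK[xs' wxs] Axs]]; split; last exact/davis_vertex_le.
  exists (x * g s)%g; split=> //; first exact/weak_leP.
  by left; rewrite -ltnS -xk.
have TE : level k xs `|` [set A | (davis_vertex x <= A)%O] = level k (x :: xs).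
  apply/seteqP; split=> A => [[[y [Ay wy yk]]|/davis_vertex_le Ax]|[y [Ay wy yk]]].
  - exists y; split=> //; case: yk => [|yxs]; [by left|right].
    by rewrite inE yxs orbT.
  - by exists x; split=> //; right; rewrite mem_head.
  - case: yk => [yk|]; first by left; exists y; split=> //; left.
    rewrite inE => /predU1P[yx|yxs]; last by left; exists y; split=> //; right.
    by right; apply/davis_vertex_le; rewrite -yx.
have [] := @cone_retraction_glue R _ _ (level k xs) (davis_vertex x) rho rhoL => //.
- by move=> A B [y [Ay wy yk]] /davis_leP AB; exists y; split=> //; exact: AB.
- by rewrite LE.
- by rewrite TE => rho' rho'P rho'E; exists rho'.
Qed.

Let level_all k rho : (len w <= k)%N -> cone_retraction (R := R) (level k [::]) rho ->
  exists2 rho', cone_retraction (level k.+1 [::]) rho' &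
    forall tau b, 0 <= tau -> chain_measure (level k [::]) b -> rho' tau b = rho tau b.
Proof.
move=> wk rhoP.
have [B BE] : exists B : seq W, [set` B] = [set x : W | (w <= x)%O /\ len x = k.+1].
  have /finite_seqP[B ->] : finite_set [set x : C | (w <= (x : W))%O /\ len x = k.+1].
    by apply: (@finite_bounded_coxlen _ _ _ k.+1) => x [_ ->].
  by exists B.
have memB x : x \in B -> (w <= x)%O /\ len x = k.+1.
  by move=> xB; have : [set` B] x by []; rewrite BE.
have [rho' rho'P rho'E] : exists2 rho', cone_retraction (level k (undup B)) rho' &
    forall tau b, 0 <= tau -> chain_measure (level k [::]) b -> rho' tau b = rho tau b.
  have := undup_uniq B; have : {subset undup B <= B} by move=> x; rewrite mem_undup.
  elim: (undup B) => [|x xs IHxs] xsB /=; first by exists rho.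
  move=> /andP[xxs uxs]; have [|//|r rP rE] := IHxs.
    by move=> y yxs; apply: xsB; rewrite inE yxs orbT.
  have [wx xk] := memB _ (xsB _ (mem_head _ _)).
  have [|r' r'P r'E] := level_add xk wx wk xxs _ rP.
    by move=> y yxs; case: (memB y (xsB y _)) => //; rewrite inE yxs orbT.
  exists r' => // tau b tau0 bk; rewrite r'E ?rE//.
  by apply: chain_measureS bk => A [y [Ay wy [yk|//]]]; exists y; split=> //; left.
suff <- : level k (undup B) = level k.+1 [::] by exists rho'.
apply/seteqP; split=> A [x [Ax wx xk]]; exists x; split=> //.
  by left; case: xk => [/leqW//|]; rewrite mem_undup => /memB[_ ->].
case: xk => //; rewrite leq_eqVlt => /predU1P[xk|]; last by left.
right; rewrite mem_undup; have : [set x : W | (w <= x)%O /\ len x = k.+1] x by [].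
by rewrite -BE.
Qed.

Lemma cosets_above_retraction : exists rho, cone_retraction (R := R) cosets_above rho.
Proof.
pose T j := level (len w + j)%N [::].
have T0 : T 0%N = [set A | (davis_vertex w <= A)%O].
  apply/seteqP; split=> A.
    move=> [x [Ax wx [|//]]]; rewrite addn0 => xw; apply/davis_vertex_le.
    by rewrite (weak_le_coxlen_eq ((weak_leP _ _).1 wx) xw).
  by move=> /davis_vertex_le Aw; exists w; split=> //; left; rewrite addn0.
have base : exists rho, cone_retraction (R := R) (T 0%N) rho.
  rewrite T0; eexists; apply: (@cone_retraction_min _ _ _ _ (davis_vertex w)) => //.
  exact: lexx.
(* Each stage is packed with its proof, so that the recursive choice also records that the next
   stage extends it. *)
have step j (r : {rho | cone_retraction (R := R) (T j) rho}) :
    {r' : {rho | cone_retraction (T j.+1) rho} |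
      forall tau b, 0 <= tau -> chain_measure (T j) b -> sval r' tau b = sval r tau b}.
  apply: cid; have [|rho' rho'P rho'E] := level_all _ (svalP r); first exact: leq_addr.
  by rewrite -addnS in rho'P; exists (exist _ rho' rho'P).
pose seq_rho := fix f j : {rho | cone_retraction (R := R) (T j) rho} :=
  if j is j'.+1 then sval (step j' (f j')) else cid base.
have [|||r rP] := @cone_retraction_bigcup R _ _ T (fun j => sval (seq_rho j)).
- move=> j A [x [Ax wx [xk|//]]]; exists x; split=> //; left.
  by rewrite addnS; exact: leqW.
- by move=> j; exact: svalP.
- by move=> j tau b tau0 bT /=; rewrite (svalP (step j (seq_rho j))).
exists r; suff <- : \bigcup_j T j = cosets_above by [].
apply/seteqP; split=> A.
  by move=> [j _ [x [Ax wx _]]]; exact: le_trans wx (davis_top_ge Ax).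
(* The longest element of [A] itself witnesses that [A] meets the elements above [w]. *)
move=> wA; exists (len (davis_top A) - len w)%N => //.
exists (davis_top A); split=> //; first exact: davis_top_mem.
by left; rewrite subnKC//; exact/weak_le_coxlen/weak_leP.
Qed.

Definition coset_retraction := sval (cid cosets_above_retraction).

Lemma coset_retractionP : cone_retraction cosets_above coset_retraction.
Proof. exact: svalP. Qed.

End Above.
End DavisPoset.

(** * Splitting a measure along its chain, and pushforward *)

Section LowerPart.
Variables (R : realType) (d : Order.disp_t) (P : porderType d).
Implicit Types (b : P -> R) (p q : P) (s : R).

Definition mass_below b p : R := mass (on_set [set q | (q < p)%O] b).

(* The part of b within its first s units of mass, counted along the chain. *)
Definition lower_part s b p : R := Num.max 0 (Num.min (b p) (s - mass_below b p)).
Definition upper_part s b p : R := b p - lower_part s b p.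

Lemma lower_part_ge0 s b p : 0 <= lower_part s b p.
Proof. by rewrite le_max lexx. Qed.

Lemma lower_part_le s b p : 0 <= b p -> lower_part s b p <= b p.
Proof. by move=> b0; rewrite ge_max b0 ge_min lexx. Qed.

Lemma lower_part_bounds s b p : 0 <= b p -> 0 <= lower_part s b p <= b p.
Proof. by move=> b0; rewrite lower_part_ge0 lower_part_le. Qed.

Lemma upper_part_bounds s b p : 0 <= b p -> 0 <= upper_part s b p <= b p.
Proof.
by move=> b0; rewrite subr_ge0 lower_part_le//= gerDl oppr_le0 lower_part_ge0.
Qed.

Lemma lower_partK s b : (fun p => lower_part s b p + upper_part s b p) = b.
Proof. by apply/funext => p; rewrite /upper_part addrC subrK. Qed.

Lemma chain_measure_lower s T b : chain_measure T b -> chain_measure T (lower_part s b).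
Proof.
by move=> bT; apply: (chain_measure_le _ bT) => p; apply: lower_part_bounds; case: bT.
Qed.

Lemma chain_measure_upper s T b : chain_measure T b -> chain_measure T (upper_part s b).
Proof.
by move=> bT; apply: (chain_measure_le _ bT) => p; apply: upper_part_bounds; case: bT.
Qed.

Lemma mass_below_ge0 b p : (forall p, 0 <= b p) -> 0 <= mass_below b p.
Proof. by move=> b0; apply: mass_ge0; exact: on_set_ge0. Qed.

Lemma mass_lower_upper s T b : chain_measure T b ->
  mass (lower_part s b) + mass (upper_part s b) = mass b.
Proof.
move=> bT; rewrite -massD ?lower_partK//; apply: chain_measure_fin.
  exact: chain_measure_lower bT.
exact: chain_measure_upper bT.
Qed.

Lemma lower_part_supp s T b : chain_measure T b -> supp (lower_part s b) `<=` supp b.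
Proof.
move=> bT p; apply: contra_neq => bp; apply/eqP; rewrite eq_le lower_part_ge0 andbT -bp.
by apply: lower_part_le; case: bT.
Qed.

Lemma upper_part_supp s T b : chain_measure T b -> supp (upper_part s b) `<=` supp b.
Proof.
move=> bT p; apply: contra_neq => bp; rewrite /upper_part bp sub0r.
by apply/eqP; rewrite oppr_eq0 eq_le lower_part_ge0 andbT -[X in _ <= X]bp lower_part_le// bp.
Qed.

Lemma mass_below_lt T b p q : chain_measure T b -> (p < q)%O ->
  mass_below b p + b p <= mass_below b q.
Proof.
move=> [b0 _ _ fb] pq; rewrite -[b p](mass_dirac p) -massD; last exact: finite_supp_dirac.
- apply: ler_mass; last 2 first.
  + exact: finite_supp_on_set.
  + move=> r; rewrite /dirac_at; case: eqP => [->|_].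
      by rewrite on_setN ?add0r ?on_setT//= ltxx.
    rewrite addr0; have [rp|rp] := pselect (r < p)%O; last by rewrite on_setN// on_set_ge0.
    by rewrite !on_setT//=; exact: lt_trans pq.
  + by apply: finite_suppD; [exact: finite_supp_on_set|exact: finite_supp_dirac].
- exact: finite_supp_on_set.
Qed.

(** If [q < p], the mass below [p] includes all mass up to [q]. It is less than [s] because [p]
    meets the lower part, so [q] is used up there and leaves nothing for the upper part. *)
Lemma lower_upper_le s T b p q : chain_measure T b ->
  supp (lower_part s b) p -> supp (upper_part s b) q -> (p <= q)%O.
Proof.
move=> bT lp uq; have bp := lower_part_supp bT lp; have bq := upper_part_supp bT uq.
have [//|qp] := orP (chain_measure_chain bT bp bq).
have [->|pNq] := eqVneq p q; first exact: lexx.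
have qltp : (q < p)%O by rewrite lt_neqAle eq_sym pNq.
have le := mass_below_lt bT qltp.
have sp : mass_below b p < s.
  rewrite ltNge; apply: contraL lp => sp; rewrite negbK; apply/eqP/max_idPl.
  by rewrite ge_min subr_le0 sp orbT.
have sq : s < mass_below b q + b q.
  rewrite ltNge; apply: contraL uq => sq; rewrite negbK /upper_part /lower_part.
  rewrite (min_idPl _) ?lerBrDl// (max_idPr _) ?subrr//.
  exact: chain_measure_ge0 bT q.
by have := lt_le_trans sq le; rewrite ltNge (ltW sp).
Qed.

Lemma lower_part0 b : (forall p, 0 <= b p) -> lower_part 0 b = fun=> 0.
Proof.
move=> b0; apply/funext => p; apply/max_idPl; rewrite ge_min sub0r oppr_le0.
by rewrite mass_below_ge0// orbT.
Qed.

Lemma lower_part1 T b : chain_measure T b -> mass b = 1 -> lower_part 1 b = b.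
Proof.
move=> bT b1; apply/funext => p; have [b0 _ _ fb] := bT.
have le : mass_below b p + b p <= 1.
  rewrite -b1 -[b p](mass_dirac p) -massD; last exact: finite_supp_dirac.
    apply: ler_mass => //.
      by apply: finite_suppD; [exact: finite_supp_on_set|exact: finite_supp_dirac].
    move=> r; rewrite /dirac_at; case: eqP => [->|_].
      by rewrite on_setN ?add0r//= ltxx.
    by rewrite addr0 /on_set; case: ifP.
  exact: finite_supp_on_set.
rewrite /lower_part (min_idPl _); first by apply/max_idPr.
by rewrite lerBrDl.
Qed.

Section Family.
Variables (Y : topologicalType) (A : set Y) (s : Y -> R) (h : Y -> P -> R).
Hypotheses (cs : {within A, continuous s}) (hF : finite_family A h).
Hypothesis h_ge0 : forall y p, A y -> 0 <= h y p.

Lemma lower_part_family : finite_family A (fun y => lower_part (s y) (h y)).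
Proof.
have [ch [B hB]] := hF; split=> [p|].
  apply: within_max; first exact: within_cst.
  apply: within_min => //; apply: withinB => //.
  by apply: (@finite_family_mass _ _ _ _ (fun y => on_set _ (h y))); exact: finite_family_on_set.
exists B => y p Ay lp; apply: (hB y) => //; apply: contra_neq lp => hp.
apply/eqP; rewrite eq_le lower_part_ge0 andbT -hp.
by apply: lower_part_le; exact: h_ge0.
Qed.

Lemma upper_part_family : finite_family A (fun y => upper_part (s y) (h y)).
Proof.
have [cl _] := lower_part_family; have [ch [B hB]] := hF; split=> [p|].
  exact: withinB.
exists B => y p Ay lp; apply: (hB y) => //; apply: contra_neq lp => hp.
have /andP[u0 uh] := upper_part_bounds (s y) (h_ge0 p Ay).
by apply/eqP; rewrite eq_le u0 andbT -hp.
Qed.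

End Family.
End LowerPart.

Section Pushforward.
Variables (R : realType) (P Q : choiceType) (f : P -> Q).
Implicit Types (b : P -> R).

Definition push_measure b q : R := mass (on_set [set p | f p = q] b).

Lemma push_measure_ge0 b : (forall p, 0 <= b p) -> forall q, 0 <= push_measure b q.
Proof. by move=> b0 q; apply: mass_ge0; exact: on_set_ge0. Qed.

Lemma supp_push_measure b q : supp (push_measure b) q -> exists2 p, supp b p & f p = q.
Proof.
move=> bq; apply: contrapT => no; move: bq; rewrite /= /push_measure.
rewrite on_set_eq0 ?mass0 ?eqxx// => p bp fp; apply: no; by exists p.
Qed.

Lemma finite_supp_push_measure b : finite_set (supp b) -> finite_set (supp (push_measure b)).
Proof.
move=> fb; apply: (@sub_finite_set _ _ (f @` supp b)); last exact: finite_image.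
by move=> q /supp_push_measure[p bp <-]; exists p.
Qed.

Lemma push_measure_seq (B : seq P) b q : uniq B -> (forall p, supp b p -> p \in B) ->
  push_measure b q = \sum_(p <- B | f p == q) b p.
Proof.
move=> uB bB; rewrite /push_measure (mass_seq uB); last by move=> p /supp_on_set[_]; exact: bB.
rewrite [RHS]big_mkcond/=; apply: eq_bigr => p _; rewrite /on_set.
by case: eqP => fp; [rewrite asboolT|rewrite asboolF].
Qed.

Lemma mass_push_measure b : finite_set (supp b) -> mass (push_measure b) = mass b.
Proof.
move=> fb; have [B uB bB] := (finite_suppP b).1 fb.
rewrite (mass_seq uB bB) (@mass_seq _ _ (undup (map f B))) ?undup_uniq//; last first.
  move=> q /supp_push_measure[p bp <-]; rewrite mem_undup; apply: map_f; exact: bB.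
under eq_bigr do rewrite (push_measure_seq _ uB bB) big_mkcond/=.
rewrite exchange_big/=; apply: eq_big_seq => p pB.
rewrite (bigD1_seq (f p)) ?undup_uniq ?mem_undup ?map_f//= eqxx big1 ?addr0// => q.
by rewrite eq_sym => /negPf->.
Qed.

Lemma push_measure0 : push_measure (fun=> 0) = fun=> 0.
Proof.
apply/funext => q; rewrite /push_measure on_set_id ?mass0// => p.
by rewrite /= eqxx.
Qed.

Lemma push_measure_family (Y : topologicalType) (A : set Y) (h : Y -> P -> R) :
  finite_family A h -> finite_family A (fun y => push_measure (h y)).
Proof.
move=> hF; have [_ [B hB]] := hF; split=> [q|].
  apply: (@finite_family_mass _ _ _ _ (fun y => on_set _ (h y))).
  exact: finite_family_on_set.
exists (map f B) => y q Ay /supp_push_measure[p hp <-]; apply: map_f; exact: hB hp.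
Qed.

End Pushforward.

Lemma chain_measure_push (R : realType) d d' (P : porderType d) (Q : porderType d')
    (f : P -> Q) (b : P -> R) T : {homo f : x y / (x <= y)%O} -> chain_measure T b ->
  chain_measure (f @` T) (push_measure f b).
Proof.
move=> fh [b0 bT bc fb]; split; first exact: push_measure_ge0.
- by move=> q /supp_push_measure[p /bT Tp <-]; exists p.
- move=> q q' /supp_push_measure[p bp <-] /supp_push_measure[p' bp' <-].
  by have /orP[/fh|/fh] := bc _ _ bp bp'; rewrite /Order.comparable => ->; rewrite ?orbT.
- exact: finite_supp_push_measure.
Qed.

(** * Sweeping a measure on W into the cosets *)

Section Sweep.
Variables (R : realType) (n : nat) (C : coxeterSystem n).
Local Notation W := (weak_order C).
Local Notation Q := (davis_poset C).
Local Notation len := (@coxlen n C).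
Implicit Types (w x : W) (A : Q) (l : seq W) (mu : W -> R) (nu : Q -> R).

(* mu + nu is a measure on a chain of the poset W + Q where w <= A means
   w <= davis_top A. *)
Definition joint_chain mu nu : Prop := [/\ chain_measure setT mu,
  chain_measure setT nu & forall w A, supp mu w -> supp nu A -> (w <= davis_top A)%O].

(** [foldr] acts on the last entry first, so in a list ordered by length the long elements are swept
    first. Zero atoms are skipped because the retraction for [w] is controlled only on measures
    carried by cosets above [w]. *)
Definition sweep l mu nu : Q -> R :=
  foldr (fun w b => if mu w == 0 then b else @coset_retraction R n C w (mu w) b) nu l.

Definition by_length l := uniq l /\ pairwise (fun x y => (len x <= len y)%N) l.

(** The last clause is the invariant of the induction: lower bounds of the data survive the sweep.
    Applied to the next atom [w], it places the accumulated measure where the retraction for [w] is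
    controlled. *)
Lemma sweepP l mu nu : joint_chain mu nu -> by_length l ->
  [/\ chain_measure setT (sweep l mu nu),
      mass (sweep l mu nu) = \sum_(w <- l) mu w + mass nu &
      forall p, (forall w, w \in l -> supp mu w -> (p <= w)%O) ->
        (forall A, supp nu A -> (p <= davis_top A)%O) ->
        forall A, supp (sweep l mu nu) A -> (p <= davis_top A)%O].
Proof.
move=> [muc nuc munu]; elim: l => [|w l IHl] [/= ul pl].
  by split=> //; rewrite big_nil add0r.
move: ul pl => /andP[wl ul] /andP[/allP wlen pl].
have [accc accm accp] := IHl (conj ul pl); rewrite big_cons.
case: eqP => [->|/eqP muw].
  rewrite add0r; split=> // p pl0 pnu; apply: accp => // x xl; apply: pl0.
  by rewrite inE xl orbT.
(* Atoms later in the list are comparable to [w] and not shorter, so they lie above it. *)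
have accw : chain_measure (cosets_above w) (sweep l mu nu).
  apply: chain_measure_sub accc; apply: accp => [x xl mux|A nuA]; last exact: munu.
  have [//|xw] := orP (chain_measure_chain muc muw mux).
  have := wlen _ xl; move/weak_leP: xw => /weak_le_coxlen_eq /[apply] xw.
  by move: wl; rewrite -xw xl.
have rP := @coset_retractionP R n C w.
have muw0 : 0 <= mu w by case: muc.
split.
- exact: chain_measureS (cone_retraction_chain rP muw0 accw).
- by rewrite (cone_retraction_mass rP)// accm addrA.
- move=> p pl0 pnu A /(chain_measure_supp (cone_retraction_chain rP muw0 accw)) wA.
  by apply: le_trans wA; apply: pl0; rewrite ?mem_head.
Qed.

Lemma sweep_family l (Y : topologicalType) (A : set Y) (mu : Y -> W -> R)
    (nu : Y -> Q -> R) : by_length l -> closed A ->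
  finite_family A mu -> finite_family A nu ->
  (forall y, A y -> joint_chain (mu y) (nu y)) ->
  finite_family A (fun y => sweep l (mu y) (nu y)).
Proof.
move=> + cA muF nuF joint; elim: l => [//|w l IHl] lP.
have lP' : by_length l by case: lP => /= /andP[_ ul] /andP[].
have accF := IHl lP'.
(* Two closed sets, one for each branch of [sweep]; on the overlap the branches agree because a
   retraction without mass at the cone point is the identity. *)
pose A0 := A `&` (fun y => mu y w) @^-1` [set 0].
pose A1 := [set y | A y /\ supp (sweep l (mu y) (nu y)) `<=` cosets_above w].
have cA0 : closed A0 by apply: closed_within_preimage => //; exact: (proj1 muF).
have cA1 : closed A1 by exact: finite_family_closed.
have A1c y : A1 y -> chain_measure (cosets_above w) (sweep l (mu y) (nu y)).
  by move=> [Ay sub]; have [accc _ _] := sweepP (joint _ Ay) lP'; exact: chain_measure_sub accc.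
apply: (@finite_familyS _ _ _ _ (A0 `|` A1)) => [y Ay|].
  have [mu0|/eqP muw] := pselect (mu y w = 0); [by left|right; split=> // B].
  have [muc nuc munu] := joint _ Ay; have [_ _ accp] := sweepP (joint _ Ay) lP'.
  apply: accp => [x xl mux|B' nuB]; last exact: munu.
  case: lP => /= /andP[wl _] /andP[/allP wlen _].
  have [//|xw] := orP (chain_measure_chain muc muw mux).
  have := wlen _ xl; move/weak_leP: xw => /weak_le_coxlen_eq /[apply] xw.
  by move: wl; rewrite -xw xl.
apply: finite_familyU => //.
  apply: (@finite_family_eq _ _ _ _ (fun y => sweep l (mu y) (nu y))).
    by move=> y [Ay /= ->]; rewrite eqxx.
  by apply: finite_familyS accF => y [].
apply: (@finite_family_eq _ _ _ _
    (fun y => @coset_retraction R n C w (mu y w) (sweep l (mu y) (nu y)))).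
  move=> y /A1c accc /=; case: eqP => // ->.
  by rewrite (cone_retraction0 (@coset_retractionP R n C w)).
apply: (cone_retraction_family (@coset_retractionP R n C w)) => //.
- by apply: continuous_subspaceW (proj1 muF w) => y [].
- by apply: finite_familyS accF => y [].
- by move=> y [Ay _]; have [[]] := joint _ Ay.
Qed.

Lemma by_length_sort (l : seq W) : uniq l ->
  by_length (sort (fun x y => (len x <= len y)%N) l).
Proof.
move=> ul; split; first by rewrite sort_uniq.
rewrite -sorted_pairwise; last by move=> x y z; exact: leq_trans.
by apply: sort_sorted => x y; exact: leq_total.
Qed.

Lemma sweep_filter l mu nu : sweep l mu nu = sweep [seq w <- l | mu w != 0] mu nu.
Proof. by elim: l => //= w l ->; case: eqP => //= /eqP/negPf->. Qed.

(** Along a chain of W the length is strictly increasing, so a measure determines the ordered list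
    of its atoms. *)
Lemma by_length_unique l l' mu : chain_measure setT mu -> by_length l -> by_length l' ->
  (forall w, supp mu w -> w \in l) -> (forall w, supp mu w -> w \in l') ->
  [seq w <- l | mu w != 0] = [seq w <- l' | mu w != 0].
Proof.
move=> muc lP l'P mul mul'.
have strict k : by_length k ->
    sorted (fun x y => (len x < len y)%N) [seq w <- k | mu w != 0].
  move=> [uk pk]; rewrite sorted_pairwise; last by move=> x y z; exact: ltn_trans.
  have : pairwise [rel x y : W | (len x <= len y)%N && (x != y)] [seq w <- k | mu w != 0].
    by rewrite pairwise_relI -uniq_pairwise filter_uniq// pairwise_filter.
  apply: (@sub_in_pairwise _ [pred w | mu w != 0]); last exact: filter_all.
  move=> x y /= mux muy /andP[xy xNy]; rewrite ltn_neqAle xy andbT.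
  apply: contraNneq xNy => lenxy.
  have /orP[/weak_leP le|/weak_leP le] := chain_measure_chain muc mux muy.
    by rewrite (weak_le_coxlen_eq le)// lenxy.
  by rewrite (weak_le_coxlen_eq le)// lenxy.
apply: (@irr_sorted_eq _ (fun x y => (len x < len y)%N)).
- by move=> x y z; exact: ltn_trans.
- by move=> x; exact: ltnn.
- exact: strict.
- exact: strict.
move=> w; rewrite !mem_filter; case muw: (mu w != 0) => //=.
by rewrite mul ?mul'.
Qed.

(** The list is chosen for each measure separately, whereas continuity needs one list for a whole
    family; [sweep_measureE] reconciles the two. *)
Definition sweep_measure mu nu : Q -> R :=
  sweep (xget [::] [set l | by_length l /\ forall w, supp mu w -> w \in l]) mu nu.

Lemma sweep_measureE l mu nu : chain_measure setT mu -> by_length l ->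
  (forall w, supp mu w -> w \in l) -> sweep_measure mu nu = sweep l mu nu.
Proof.
move=> muc lP mul; rewrite /sweep_measure; case: xgetP => [l' _ [l'P mul']|/(_ l)[]//].
by rewrite sweep_filter (by_length_unique muc l'P lP)// -sweep_filter.
Qed.

Lemma exists_by_length (B : seq W) : exists2 l, by_length l & l =i B.
Proof.
exists (sort (fun x y => (len x <= len y)%N) (undup B)).
  by apply: by_length_sort; exact: undup_uniq.
by move=> w; rewrite mem_sort mem_undup.
Qed.

Lemma sweep_measureP mu nu : joint_chain mu nu ->
  [/\ chain_measure setT (sweep_measure mu nu),
      mass (sweep_measure mu nu) = mass mu + mass nu &
      forall p, (forall w, supp mu w -> (p <= w)%O) ->
        (forall A, supp nu A -> (p <= davis_top A)%O) ->
        forall A, supp (sweep_measure mu nu) A -> (p <= davis_top A)%O].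
Proof.
move=> joint; have [muc _ _] := joint.
have [B _ muB] := (finite_suppP mu).1 (chain_measure_fin muc).
have [l lP lB] := exists_by_length B.
have mul w : supp mu w -> w \in l by move=> /muB; rewrite lB.
rewrite (sweep_measureE _ muc lP mul); have [? ? lp] := sweepP joint lP.
rewrite (mass_seq (proj1 lP) mul); split=> // p pmu; apply: lp => w _; exact: pmu.
Qed.

Lemma sweep_measure_family (Y : topologicalType) (A : set Y) (mu : Y -> W -> R)
    (nu : Y -> Q -> R) : closed A -> finite_family A mu -> finite_family A nu ->
  (forall y, A y -> joint_chain (mu y) (nu y)) ->
  finite_family A (fun y => sweep_measure (mu y) (nu y)).
Proof.
move=> cA muF nuF joint; have [_ [B muB]] := muF; have [l lP lB] := exists_by_length B.
apply: (@finite_family_eq _ _ _ _ (fun y => sweep l (mu y) (nu y))).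
  move=> y Ay; have [muc _ _] := joint _ Ay.
  by rewrite (sweep_measureE _ muc lP)// => w; rewrite lB; exact: muB.
exact: sweep_family.
Qed.

Lemma sweep_measure0 nu : sweep_measure (fun=> 0) nu = nu.
Proof. by rewrite /sweep_measure; elim: (xget _ _) => //= w l IHl; rewrite eqxx. Qed.

End Sweep.

(** * Points of a homotopy colimit as measures *)

Section SeqChain.
Variables (d : Order.disp_t) (P : porderType d).
Implicit Types (p q : P) (l : seq P).

Definition seq_chain_fun p l (s : path <%O p l) (i : 'I_(size l).+1) : P :=
  nth p (p :: l) i.

Lemma seq_chain_homo p l (s : path <%O p l) :
  {homo seq_chain_fun s : i j / (i <= j)%O}.
Proof.
move=> i j ij; apply: (le_sorted_leq_nth p); [|exact: (ltn_ord i)|exact: (ltn_ord j)|exact: ij].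
by move: (s : sorted <%O (p :: l)); rewrite lt_sorted_uniq_le => /andP[].
Qed.

HB.instance Definition _ p l (s : path <%O p l) :=
  Order.isOrderMorphism.Build _ _ _ _ (seq_chain_fun s) (seq_chain_homo s).

Definition seq_chain p l (s : path <%O p l) : chain P (size l) :=
  (seq_chain_fun s : {omorphism 'I_(size l).+1 -> P}).

Lemma seq_chain_uniq p l : path <%O p l -> uniq (p :: l).
Proof. by move=> s; move: (s : sorted <%O (p :: l)); rewrite lt_sorted_uniq_le => /andP[]. Qed.

Section Index.
Variables (m : nat) (c : chain P m) (p : P) (l : seq P) (s : path <%O p l).
Hypothesis cs : forall i, c i \in p :: l.

Lemma chain_index_subproof i : (index (c i) (p :: l) < (size l).+1)%N.
Proof. by rewrite -[(size l).+1]/(size (p :: l)) index_mem. Qed.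

(** The path is an argument so that the morphism instance below, whose monotonicity rests on it, can
    be inferred from the term. *)
Definition chain_rank of path <%O p l := fun i =>
  Ordinal (chain_index_subproof i) : 'I_(size l).+1.

Lemma chain_rank_homo : {homo chain_rank s : i j / (i <= j)%O}.
Proof.
move=> i j ij; rewrite leEord leqNgt; apply/negP => lt.
have idx k : index (c k) (p :: l) \in [pred n | (n < size (p :: l))%N].
  by rewrite inE index_mem.
have := lt_sorted_ltn_nth p (s : sorted <%O (p :: l)) (idx j) (idx i).
rewrite !nth_index// (lt : (index (c j) (p :: l) < index (c i) (p :: l))%N).
by rewrite lt_leAnge (omorph_le c ij) andbF.
Qed.

HB.instance Definition _ :=
  Order.isOrderMorphism.Build _ _ _ _ (chain_rank s) chain_rank_homo.

Lemma seq_chain_rank i : c i = seq_chain s (chain_rank s i).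
Proof. by rewrite /seq_chain /= /seq_chain_fun /= nth_index. Qed.

Lemma chain_rank_eq i (j : 'I_(size l).+1) : (chain_rank s i == j) = (c i == nth p (p :: l) j).
Proof.
apply/eqP/eqP => [<-|cij]; first by rewrite /= nth_index.
apply: val_inj; change (index (c i) (p :: l) = j :> nat).
by rewrite cij index_uniq//; exact: seq_chain_uniq.
Qed.

End Index.
End SeqChain.

Section CellMeasure.
Variables (R : realType) (d : Order.disp_t) (P : porderType d).
Implicit Types (p q : P) (l : seq P) (nu : P -> R).

Definition cell_measure m (c : chain P m) (t : 'rV[R]_m.+1) p : R :=
  \sum_(i | c i == p) t 0 i.

Lemma supp_cell_measure m (c : chain P m) t p :
  supp (cell_measure c t) p -> exists i, c i = p.
Proof.
apply: contraNP => no; apply/eqP; apply: big1 => i /eqP cip.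
by case: no; exists i.
Qed.

Lemma mass_cell_measure m (c : chain P m) t : mass (cell_measure c t) = \sum_i t 0 i.
Proof.
rewrite (@mass_seq _ _ (undup (codom c))) ?undup_uniq//; last first.
  by move=> p /supp_cell_measure[i <-]; rewrite mem_undup codom_f.
under eq_bigr do rewrite /cell_measure big_mkcond/=.
rewrite exchange_big/=; apply: eq_bigr => i _.
rewrite (bigD1_seq (c i)) ?undup_uniq ?mem_undup ?codom_f//= eqxx big1 ?addr0// => q.
by rewrite eq_sym => /negPf->.
Qed.

Definition prob_chain (G : set P) nu : Prop := chain_measure G nu /\ mass nu = 1.

Lemma prob_cell_measure m (c : chain P m) (t : simplex R m) :
  prob_chain [set p | (c ord0 <= p)%O] (cell_measure c (set_val t)).
Proof.
have [t0 t1] := set_valP t; split; last by rewrite mass_cell_measure.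
split.
- by move=> p; apply: sumr_ge0.
- by move=> p /supp_cell_measure[i <-]; apply: omorph_le; rewrite leEord.
- move=> p q /supp_cell_measure[i <-] /supp_cell_measure[j <-].
  rewrite /Order.comparable.
  by have /orP[/(omorph_le c)->|/(omorph_le c)->] := leq_total i j; rewrite ?orbT.
- apply/finite_suppP; exists (undup (codom c)); first exact: undup_uniq.
  by move=> p /supp_cell_measure[i <-]; rewrite mem_undup codom_f.
Qed.

(** Faces and degeneracies do not change the measure, so it depends only on the point of the
    homotopy colimit. *)
Lemma cell_measure_push m n (f : 'I_m.+1 -> 'I_n.+1) (c : chain P n) (c' : chain P m)
    (t : 'rV[R]_m.+1) : (forall i, c' i = c (f i)) ->
  cell_measure c' t = cell_measure c (simplex_push_row f t).
Proof.
move=> cf; apply/funext => p; rewrite /cell_measure.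
under [RHS]eq_bigr do rewrite mxE.
rewrite (partition_big f (fun j => c j == p))/=; last by move=> i; rewrite cf.
apply: eq_bigr => j /eqP cj; apply: eq_bigl => i; rewrite cf.
by case: (f i =P j) => [->|_]; rewrite ?andbF// cj eqxx.
Qed.

Lemma simplex_nonempty m : simplex R m (delta_mx 0 ord0).
Proof.
split=> [i|]; first by rewrite mxE; case: andb.
rewrite (bigD1 ord0)//= mxE !eqxx big1 ?addr0// => i /negPf i0.
by rewrite mxE i0 andbF.
Qed.

Definition to_simplex m (t : 'rV[R]_m.+1) : simplex R m :=
  if pselect (simplex R m t) is left h then exist _ t (mem_set h)
  else exist _ (delta_mx 0 ord0) (mem_set (simplex_nonempty m)).

Lemma to_simplexK m t : simplex R m t -> set_val (to_simplex t) = t.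
Proof. by rewrite /to_simplex; case: pselect. Qed.

Definition seq_row p l nu : 'rV[R]_(size l).+1 := \row_i nu (nth p (p :: l) i).

Lemma cell_measure_seq_row p l (s : path <%O p l) nu :
  (forall q, supp nu q -> q \in p :: l) -> cell_measure (seq_chain s) (seq_row p l nu) = nu.
Proof.
move=> nul; apply/funext => q; rewrite /cell_measure.
have [ql|ql] := boolP (q \in p :: l); last first.
  rewrite big1 => [|i /eqP iq]; first by apply/esym/eqP; apply: contraNT ql => /nul.
  by move: ql; rewrite -iq mem_nth// ltn_ord.
have qi : (index q (p :: l) < (size l).+1)%N by rewrite -[(size l).+1]/(size (p :: l)) index_mem.
rewrite (bigD1 (Ordinal qi))/= ?mxE ?nth_index//; last by rewrite /seq_chain_fun/= nth_index.
rewrite big1 ?addr0// => i /andP[/eqP iq /eqP]; case.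
apply: val_inj; change (i = index q (p :: l) :> nat).
by rewrite -iq index_uniq//; exact: seq_chain_uniq.
Qed.

Lemma simplex_seq_row p l (s : path <%O p l) nu (G : set P) : prob_chain G nu ->
  (forall q, supp nu q -> q \in p :: l) -> simplex R (size l) (seq_row p l nu).
Proof.
move=> [[nu0 _ _ _] nu1] nul; split=> [i|]; first by rewrite mxE.
by rewrite -(mass_cell_measure (seq_chain s)) cell_measure_seq_row.
Qed.

End CellMeasure.

Lemma cell_measure_comp (R : realType) d d' (P : porderType d) (Q : porderType d')
     (F : {omorphism P -> Q}) m (c : chain P m)
    (t : 'rV[R]_m.+1) :
  cell_measure (F \o c : {omorphism _ -> _}) t = push_measure F (cell_measure c t).
Proof.
apply/funext => q; rewrite (@push_measure_seq _ _ _ _ (undup (codom c))) ?undup_uniq//; last first.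
  by move=> p /supp_cell_measure[i <-]; rewrite mem_undup codom_f.
rewrite /cell_measure; under [RHS]eq_bigr do rewrite big_mkcond/=.
rewrite exchange_big/= [LHS]big_mkcond/=; apply: eq_bigr => i _.
rewrite big_mkcond/= (bigD1_seq (c i)) ?undup_uniq ?mem_undup ?codom_f//= eqxx.
by rewrite big1 ?addr0// => p; rewrite eq_sym => /negPf->; rewrite if_same.
Qed.

Section MeasurePoint.
Variables (R : realType) (d : Order.disp_t) (Q : porderType d) (E : diagram Q).
Implicit Types (q : Q) (l : seq Q) (nu : Q -> R).

Definition seq_pt q l (s : path <%O q l) (x : E q) nu : hocolim R E :=
  hocolim_pi (@hocolim_pt R _ _ E (size l) (seq_chain s) x (to_simplex (seq_row q l nu))).

(** A single gluing along [chain_rank] moves a cell into that of any strict chain containing its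
    values, dealing with repeated and missing vertices at once. *)
Lemma hocolim_pi_cell m (c : chain Q m) q l (s : path <%O q l) :
  (forall i, c i \in q :: l) ->
  forall (k : (q <= c ord0)%O) (x : E q) (t : simplex R m),
  hocolim_pi (hocolim_pt (diag_map E k x) t) = seq_pt s x (cell_measure c (set_val t)).
Proof.
move=> cl k x t; apply/hocolim_piP/rst_step.
have := @HocolimGlue R _ _ E _ _ (chain_rank cl s : {omorphism _ -> _}) (seq_chain s) c
  (seq_chain_rank s cl) k x t.
congr (hocolim_glue _ (hocolim_pt _ _)); apply: val_inj.
rewrite [RHS]to_simplexK; last first.
  apply: (simplex_seq_row s (prob_cell_measure c t)) => p.
  by move=> /supp_cell_measure[i <-].
apply/rowP => j; rewrite !mxE; apply: eq_bigl => i.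
exact: chain_rank_eq.
Qed.

Section Cocone.
Variables (X : topologicalType) (G : set Q) (e : forall q, G q -> X -> E q).
Arguments e : clear implicits.

(** The chain may exceed the support, so that one chain can serve all members of a family on a
    closed piece where some coordinates vanish. *)
Record frame nu := Frame {
  frame_head : Q;
  frame_tail : seq Q;
  frame_path : path <%O frame_head frame_tail;
  frame_mem : forall q, q \in frame_head :: frame_tail -> G q;
  frame_supp : forall q, supp nu q -> q \in frame_head :: frame_tail }.

Definition frame_pt nu (F : frame nu) x : hocolim R E :=
  seq_pt (frame_path F) (e (frame_head F) (@frame_mem nu F _ (mem_head _ _)) x) nu.

Hypothesis e_map : forall q q' (Gq : G q) (Gq' : G q') (k : (q <= q')%O) x,
  e q' Gq' x = diag_map E k (e q Gq x).

Lemma frame_pt_sub nu (F F' : frame nu) x : prob_chain G nu ->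
  {subset frame_head F :: frame_tail F <= frame_head F' :: frame_tail F'} ->
  frame_pt F x = frame_pt F' x.
Proof.
move=> nuP FF'; case: F FF' => q l s Gl nul /= FF'; case: F' FF' => q' l' s' Gl' nul' /= FF'.
rewrite /frame_pt /=.
have k : (q' <= q)%O.
  have := FF' q (mem_head _ _); rewrite inE => /predU1P[->//|ql'].
  move: s'; rewrite lt_path_sortedE => /andP[/allP/(_ _ ql')/ltW] //.
have cl i : seq_chain s i \in q' :: l'.
  apply: FF'; rewrite /seq_chain /= /seq_chain_fun.
  exact: (mem_nth q (ltn_ord i : (i < size (q :: l))%N)).
have tE := to_simplexK (simplex_seq_row s nuP nul).
have := @hocolim_pi_cell _ (seq_chain s) q' l' s' cl k (e q' (Gl' q' (mem_head _ _)) x)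
  (to_simplex (seq_row q l nu)).
rewrite tE cell_measure_seq_row// => <-; rewrite /seq_pt; congr (hocolim_pi (hocolim_pt _ _)).
exact: e_map.
Qed.

Lemma frame_restrict nu (F : frame nu) : prob_chain G nu ->
  exists F' : frame nu, forall q, q \in frame_head F' :: frame_tail F' -> supp nu q.
Proof.
case: F => q l s Gl nul [_ nu1].
have sl : sorted <%O [seq p <- q :: l | nu p != 0].
  by apply: (@sorted_filter _ <%O) (s : sorted <%O (q :: l)); exact: lt_trans.
have memf p : (p \in [seq p <- q :: l | nu p != 0]) = (nu p != 0) && (p \in q :: l).
  exact: mem_filter.
(* Total mass one guarantees that the support has a first element to serve as head. *)
case fE : [seq p <- q :: l | nu p != 0] sl memf => [|p k] sl memf.
  have nu0 p : nu p = 0.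
    apply/eqP; apply: contraT => /= nup; have := memf p.
    by rewrite nup nul.
  have : nu = fun=> 0 by apply/funext.
  by move: nu1 => /[swap] ->; rewrite mass0 => /esym/eqP; rewrite oner_eq0.
unshelve eexists; first unshelve eapply (@Frame nu p k sl).
- by move=> r; rewrite memf => /andP[_]; exact: Gl.
- by move=> r nur; rewrite memf nur/= nul.
by move=> r /=; rewrite memf => /andP[].
Qed.

(** The union of two chains need not be a chain, so the comparison goes down to the chain formed by
    the support, which both frames contain. *)
Lemma frame_pt_indep nu (F F' : frame nu) x : prob_chain G nu -> frame_pt F x = frame_pt F' x.
Proof.
move=> nuP; have [F0 F0P] := frame_restrict F nuP.
transitivity (frame_pt F0 x); [apply/esym|]; apply: frame_pt_sub => // q /F0P;
exact: frame_supp.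
Qed.

Lemma prob_chain_frame nu : prob_chain G nu -> inhabited (frame nu).
Proof.
move=> [[nu0 nuG nuc fnu] nu1]; have [B uB nuB] := (finite_suppP nu).1 fnu.
pose B' := [seq q <- B | nu q != 0].
have memB' q : q \in B' = (nu q != 0).
  by rewrite mem_filter; apply: andb_idr; exact: nuB.
have sB : sorted <%O (sort <=%O B').
  rewrite lt_sorted_uniq_le sort_uniq filter_uniq//=.
  apply: (@sort_sorted_in _ [pred q | nu q != 0]); last exact: filter_all.
  by move=> p q np nq; exact: nuc.
case lE : (sort <=%O B') sB => [|q l] sl.
  have nuz q : nu q = 0.
    by apply/eqP; apply: contraT; rewrite -memB' -(mem_sort <=%O) lE.
  by move: nu1; rewrite (_ : nu = fun=> 0) ?mass0; [move/esym/eqP; rewrite oner_eq0|exact/funext].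
have meml p : p \in q :: l = (nu p != 0) by rewrite -lE mem_sort memB'.
constructor; apply: (@Frame nu q l sl) => p; rewrite meml => //; exact: nuG.
Qed.

Definition measure_pt nu (nuP : prob_chain G nu) : X -> hocolim R E :=
  frame_pt (inhabited_witness (prob_chain_frame nuP)).

Lemma measure_ptE nu (nuP : prob_chain G nu) (F : frame nu) x :
  measure_pt nuP x = frame_pt F x.
Proof. exact: frame_pt_indep. Qed.

End Cocone.
End MeasurePoint.

(** * Continuity of the point attached to a measure *)

Lemma continuous_finite_closed_cover (Y Z : topologicalType) (I : choiceType) (r : seq I)
    (A : I -> set Y) (f : Y -> Z) :
  (forall i, i \in r -> closed (A i)) ->
  (forall i, i \in r -> {within A i, continuous f}) ->
  (forall y, exists2 i, i \in r & A i y) -> continuous f.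
Proof.
move=> cA cf cov; apply/continuous_subspace_setT.
suff [_] : closed (\big[setU/set0]_(i <- r) A i) /\
    {within \big[setU/set0]_(i <- r) A i, continuous f}.
  apply: continuous_subspaceW => y _; have [i ir Ay] := cov y.
  by rewrite -bigcup_seq; exists i.
elim: r cA cf {cov} => [|i r IHr] cA cf.
  by rewrite big_nil; split; [exact: closed0|exact: continuous_subspace0].
have [||cU cfU] := IHr.
- by move=> j jr; apply: cA; rewrite inE jr orbT.
- by move=> j jr; apply: cf; rewrite inE jr orbT.
have ci := cA i (mem_head _ _).
rewrite big_cons; split; first exact: closedU.
by apply: withinU_continuous => //; apply: cf; rewrite mem_head.
Qed.

Lemma continuous_pair (T U V : topologicalType) (f : T -> U) (g : T -> V) :
  continuous f -> continuous g -> continuous (fun x => (f x, g x)).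
Proof. by move=> cf cg x; apply: cvg_pair; [exact: cf|exact: cg]. Qed.

Lemma continuous_rowP (R : realType) (Y : topologicalType) k (f : Y -> 'rV[R]_k) :
  (forall i, continuous (fun y => f y 0 i)) -> continuous f.
Proof.
move=> cf y S [P fP PS]; apply: (@filterS _ (nbhs y) _ [set y' | forall i j, P i j (f y' i j)]).
  by move=> y' fy'; apply: PS => i j; exact: fy'.
apply: filter_forall => i; apply: filter_forall => j; rewrite (ord1 i).
by apply: cf; have := fP i j; rewrite (ord1 i).
Qed.

Lemma hocolim_pi_continuous (R : realType) d (P : porderType d) (E : diagram P) :
  continuous (@hocolim_pi R d P E).
Proof. exact: pi_continuous. Qed.

Section MeasurePointContinuous.
Variables (R : realType) (d : Order.disp_t) (Q : porderType d) (E : diagram Q).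
Variables (X : topologicalType) (G : set Q) (e : forall q, G q -> X -> E q).
Arguments e : clear implicits.
Hypothesis e_map : forall q q' (Gq : G q) (Gq' : G q') (k : (q <= q')%O) x,
  e q' Gq' x = diag_map E k (e q Gq x).
Hypothesis e_continuous : forall q (Gq : G q), continuous (e q Gq).

Lemma seq_pt_continuous (Y : topologicalType) (A : set Y) (x : Y -> X) (nu : Y -> Q -> R)
    q l (s : path <%O q l) (Gq : G q) : continuous x ->
  (forall p, {within A, continuous (nu^~ p)}) ->
  (forall y, A y -> simplex R (size l) (seq_row q l (nu y))) ->
  {within A, continuous (fun y => seq_pt s (e q Gq (x y)) (nu y) : hocolim R E)}.
Proof.
move=> cx cnu nuS.
have crow : continuous (fun y : subspace A => to_simplex (seq_row q l (nu y))).
  apply: (@continuous_comp_initial _ _ _ set_val).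
  apply: (@subspace_eq_continuous _ _ _ (fun y => seq_row q l (nu y))).
    by move=> y /set_mem Ay /=; rewrite to_simplexK//; exact: nuS.
  apply: continuous_rowP => i; under eq_fun do rewrite mxE; exact: cnu.
have cex : continuous (fun y : subspace A => e q Gq (x y)).
  apply: continuous_subspaceT => y; apply: continuous_comp; first exact: cx.
  exact: e_continuous.
move=> y; apply: (@continuous_comp (subspace A) (hocolim_cells R E)); last first.
  exact: hocolim_pi_continuous.
apply: (@continuous_comp (subspace A)
  (hocolim_cell R E (existT _ (size l) (seq_chain s))) (hocolim_cells R E)); last first.
  exact: existT_continuous.
exact: continuous_pair cex crow y.
Qed.

Lemma measure_pt_continuous (Y : topologicalType) (x : Y -> X) (nu : Y -> Q -> R)
    (nuP : forall y, prob_chain G (nu y)) : continuous x -> finite_family setT nu ->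
  continuous (fun y => measure_pt e (nuP y) (x y)).
Proof.
move=> cx nuF; have [cnu [B0 hB0]] := nuF; pose B := undup B0.
have hB y p : supp (nu y) p -> p \in B by rewrite mem_undup; exact: hB0.
(* [r] lists all orderings of all subsets of [B]. A list that is not a chain in [G] has an empty
   piece; on any other nonempty piece the list is a frame for every member of the family. *)
pose r := flatten [seq permutations (mask (val m) B) | m <- enum {: (size B).-tuple bool}].
pose A (k : seq Q) := [set y | [/\ sorted <%O k, forall q, q \in k -> G q &
  supp (nu y) `<=` [set` k]]].
apply: (@continuous_finite_closed_cover _ _ _ r A).
- move=> k _; have [[sk Gk]|ngood] := pselect (sorted <%O k /\ forall q, q \in k -> G q).
    have := @finite_family_closed _ _ _ _ _ [set` k] closedT nuF; congr closed.
    by apply/seteqP; split=> y [] ; split.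
  rewrite (_ : A k = set0); first exact: closed0.
  by apply/seteqP; split=> y // [sk Gk _]; apply: ngood.
- move=> [|q l] _.
    rewrite (_ : A _ = set0); first exact: continuous_subspace0.
    apply/seteqP; split=> y // [_ _ nu0]; have [_ ] := nuP y.
    rewrite (_ : nu y = fun=> 0) ?mass0 => [/esym/eqP|]; first by rewrite oner_eq0.
    by apply/funext => p; apply: contrapT => /eqP /nu0.
  have [[sk Gk]|ngood] :=
    pselect (sorted <%O (q :: l) /\ forall p, p \in q :: l -> G p); last first.
    rewrite (_ : A _ = set0); first exact: continuous_subspace0.
    by apply/seteqP; split=> y // [sk Gk _]; apply: ngood.
  apply: (@subspace_eq_continuous _ _ _
    (fun y => seq_pt (sk : path <%O q l) (e q (Gk q (mem_head _ _)) (x y)) (nu y))).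
    move=> y /set_mem [_ _ nuk].
    exact/esym/(measure_ptE e_map (nuP y) (@Frame _ _ _ _ _ q l sk Gk nuk)).
  apply: seq_pt_continuous => // [p|y [_ _ nuk]].
    by apply: continuous_subspaceW (cnu p).
  exact: (simplex_seq_row (sk : path <%O q l) (nuP y) nuk).
move=> y; have [F] := prob_chain_frame (nuP y).
have [[q l s Gl nul] /= F'P] := frame_restrict F (nuP y).
exists (q :: l); last by split.
apply/flattenP; exists (permutations (mask [seq nu y p != 0 | p <- B] B)).
  have szm : size [seq nu y p != 0 | p <- B] == size B by rewrite size_map.
  by apply/mapP; exists (Tuple szm); rewrite ?mem_enum.
rewrite mem_permutations -filter_mask; apply: uniq_perm.
- exact: seq_chain_uniq.
- by rewrite filter_uniq// undup_uniq.
move=> p; rewrite mem_filter; apply/idP/andP => [/F'P np|[np _]]; last exact: nul.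
by split=> //; exact: hB np.
Qed.

End MeasurePointContinuous.

Section QuotientProduct.
Variables (R : realType).

(* The tube lemma over a compact neighbourhood of s. *)
Lemma hocolim_prod_continuous d (P : porderType d) (E : diagram P) (Z : topologicalType)
    (h : hocolim R E * R -> Z) :
  continuous (fun ps : hocolim_cells R E * R => h (hocolim_pi ps.1, ps.2)) -> continuous h.
Proof.
move=> ch [z s] O; rewrite nbhsE => -[V [oV Vzs] VO].
have [p pz] : exists p, hocolim_pi p = z by exists (hocolim_repr z); exact: hocolim_reprK.
have /continuousP/(_ _ oV) oW := ch.
set W := (X in open X) in oW.
have Wps : W (p, s) by rewrite /W /preimage/= pz.
have [[U1 U2] /= [pU1 sU2] U12] : nbhs (p, s) W by exact: open_nbhs_nbhs.
have [r /= r0 rU2] := (nbhs_ballP _ _).1 sU2.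
have r20 : 0 < r / 2 by rewrite divr_gt0.
pose K := closed_ball s (r / 2).
have cK : near_covering K by apply/compact_near_coveringP; exact: closed_ballR_compact.
(* [G] is defined on the quotient, hence saturated; its openness is tested on cells, where
   compactness of [K] applies. *)
pose G := [set z' | forall s', K s' -> V (h (z', s'))].
have oG : open G.
  rewrite /open/= /quotient_open openE => p' Gp'.
  have : \forall p'' \near p', K `<=` (fun s' => W (p'', s')).
    apply: (@cK _ (nbhs p') (fun p'' s' => W (p'', s'))) => s' Ks'.
    have : nbhs (p', s') W by apply: open_nbhs_nbhs; split=> //; exact: Gp'.
    by move=> [[A B] /= [p'A s'B] AB]; exists (B, A) => //= -[s'' p''] /= [Bs Ap]; exact: AB.
  by apply: filterS => p'' Kp'' s' Ks'; exact: Kp''.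
exists (G, K) => /=.
  split; last first.
    apply: (@filterS _ (nbhs s) _ (ball s (r / 2)) K); last exact: nbhsx_ballx.
    exact: subset_closed_ball.
  apply: (@open_nbhs_nbhs (hocolim R E) z G); split=> // s' Ks'; rewrite -pz.
  apply: (U12 (p, s')); split=> /=; first exact: nbhs_singleton.
  apply: rU2; apply: closed_ball_subset Ks' => //.
  by rewrite ltr_pdivrMr// ltr_pMr// ltr1n.
by move=> [z' s'] /= [Gz' Ks']; apply: VO; exact: Gz'.
Qed.

End QuotientProduct.

Lemma sigT_prod_continuous (I : choiceType) (X : I -> topologicalType)
    (S Z : topologicalType) (f : {i & X i} * S -> Z) :
  (forall i, continuous (fun xs : X i * S => f (existT _ i xs.1, xs.2))) -> continuous f.
Proof.
move=> cf [[i a] s] U nU; have [[A B] /= [aA sB] AB] := cf i (a, s) U nU.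
exists (existT X i @` A, B) => /=; first by split=> //; exact: existT_nbhs.
by move=> [b s'] /= [[a' Aa' <-] Bs']; exact: (AB (a', s')).
Qed.

Lemma cell_measure_family (R : realType) d (P : porderType d) (Y : topologicalType)
    m (c : chain P m) (t : Y -> simplex R m) : continuous t ->
  finite_family setT (fun y => cell_measure c (set_val (t y))).
Proof.
move=> ct; split=> [p|]; last first.
  by exists (codom c) => y p _ /supp_cell_measure[i <-]; exact: codom_f.
under eq_fun do rewrite /cell_measure big_mkcond/=.
apply: (@within_sum _ _ _ _ _ (fun i y => if c i == p then set_val (t y) 0 i else 0)) => i.
case: (c i == p); last exact: within_cst.
apply: continuous_subspaceT => y.
apply: (@continuous_comp _ _ _ (fun y => set_val (t y)) (fun v : 'rV[R]_m.+1 => v 0 i)).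
  by apply: continuous_comp; [exact: ct|exact: initial_continuous].
exact: coord_continuous.
Qed.

Lemma eqfun_continuous (Y Z : topologicalType) (f g : Y -> Z) :
  f =1 g -> continuous f -> continuous g.
Proof. by move=> /funext ->. Qed.

(** * Maps of homotopy colimits induced by operators on measures *)

Section ChainOperator.
Variables (R : realType) (d d' : Order.disp_t) (P : porderType d) (Q : porderType d').
Variables (E : diagram P) (E' : diagram Q).

(* Compatible maps E p -> E' q, indexed by the relation carry p q. *)
Record transport := Transport {
  carry : P -> set Q;
  transport_map : forall p q, carry p q -> E p -> E' q;
  transport_continuous : forall p q (h : carry p q), continuous (transport_map h);
  carry_le : forall p p' q, (p <= p')%O -> carry p' q -> carry p q;
  transport_mapr : forall p q q' (h : carry p q) (h' : carry p q') (k : (q <= q')%O) x,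
    transport_map h' x = diag_map E' k (transport_map h x);
  transport_mapl : forall p p' q (k : (p <= p')%O) (h : carry p' q) (h' : carry p q) x,
    transport_map h (diag_map E k x) = transport_map h' x }.

Record measure_operator (T : transport) (Op : R -> (P -> R) -> Q -> R) : Prop :=
  MeasureOperator {
    measure_operator_prob : forall s nu p, prob_chain [set p' | (p <= p')%O] nu ->
      prob_chain (carry T p) (Op s nu);
    measure_operator_family : forall (Y : topologicalType) (s : Y -> R) (h : Y -> P -> R),
      continuous s -> finite_family setT h -> (forall y, prob_chain setT (h y)) ->
      finite_family setT (fun y => Op (s y) (h y)) }.

Variables (T : transport) (Op : R -> (P -> R) -> Q -> R).
Hypothesis OpP : measure_operator T Op.

Definition operator_cells (p : hocolim_cells R E) (s : R) : hocolim R E' :=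
  let: existT (existT m c) (x, t) := p in
  measure_pt (@transport_map T (c ord0))
    (measure_operator_prob OpP s (prob_cell_measure c t)) x.

(** Both sides have the same measure, and [carry] can only shrink when its first argument grows, so
    a frame for the larger base [c' ord0] also serves [c ord0]. *)
Lemma operator_cells_glue p q s : hocolim_glue p q ->
  operator_cells p s = operator_cells q s.
Proof.
case=> m n f c c' cf h x t /=.
have nuE : cell_measure c (set_val (simplex_push f t)) = cell_measure c' (set_val t).
  exact/esym/cell_measure_push.
have nuP := measure_operator_prob OpP s (prob_cell_measure c' t).
have [F] := prob_chain_frame nuP.
rewrite (measure_ptE (@transport_mapr T (c' ord0)) _ F).
case: F => q0 l sl Gl nul.
have Gl' r : r \in q0 :: l -> carry T (c ord0) r by move=> /Gl; exact: carry_le.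
have nul' r : supp (Op s (cell_measure c (set_val (simplex_push f t)))) r -> r \in q0 :: l.
  by rewrite nuE; exact: nul.
rewrite (measure_ptE (@transport_mapr T (c ord0)) _ (Frame sl Gl' nul')).
rewrite /frame_pt /= nuE; congr seq_pt.
exact: transport_mapl.
Qed.

Definition operator_map (zs : hocolim R E * R) : hocolim R E' :=
  operator_cells (hocolim_repr zs.1) zs.2.

Lemma operator_mapE p s : operator_map (hocolim_pi p, s) = operator_cells p s.
Proof.
have /hocolim_piP := hocolim_reprK (hocolim_pi p); rewrite /operator_map /=.
move: (hocolim_repr _) => q.
elim=> {p q} [p q pq|//|p q _ ->//|p q r _ -> _ ->//].
exact: operator_cells_glue.
Qed.

(** [hocolim_prod_continuous] lifts the question to single cells, where the measures are carried by
    the values of one chain and so form a finite family. *)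
Lemma operator_map_continuous : continuous operator_map.
Proof.
apply: hocolim_prod_continuous; under eq_fun do rewrite operator_mapE.
apply: (@sigT_prod_continuous _ _ R) => -[m c] /=.
pose Y := (hocolim_cell R E (existT _ m c) * R)%type.
have cfst : continuous (fun y : Y => y.1) by move=> y; exact: cvg_fst.
have csnd : continuous (fun y : Y => y.2) by move=> y; exact: cvg_snd.
have cx : continuous (fun y : Y => y.1.1).
  by move=> y; apply: continuous_comp; [exact: cfst|exact: cvg_fst].
have ct : continuous (fun y : Y => y.1.2).
  by move=> y; apply: continuous_comp; [exact: cfst|exact: cvg_snd].
have nuF : finite_family setT (fun y : Y => Op y.2 (cell_measure c (set_val y.1.2))).
  apply: (measure_operator_family OpP) => //; first exact: cell_measure_family.
  move=> y; have [cm m1] := prob_cell_measure c y.1.2; split=> //.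
  exact: chain_measureS cm.
have := @measure_pt_continuous R _ Q E' _ _ _ (@transport_mapr T (c ord0))
  (@transport_continuous T (c ord0)) Y _ _
  (fun y => measure_operator_prob OpP y.2 (prob_cell_measure c y.1.2)) cx nuF.
by apply: eqfun_continuous => -[[x t] s].
Qed.

Lemma operator_mapP m (c : chain P m) (x : E (c ord0)) t s
    (F : frame (carry T (c ord0)) (Op s (cell_measure c (set_val t)))) :
  operator_map (hocolim_pi (hocolim_pt x t), s) =
  frame_pt (@transport_map T (c ord0)) F x.
Proof. by rewrite operator_mapE /= (measure_ptE (@transport_mapr T (c ord0)) _ F). Qed.

End ChainOperator.

(** * Homotopy equivalences are weak homotopy equivalences *)

Lemma within_comp (T U V : topologicalType) (A : set T) (B : set U) (f : U -> V) (h : T -> U) :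
  {within B, continuous f} -> {within A, continuous h} ->
  (forall x, A x -> B (h x)) -> {within A, continuous (fun x => f (h x))}.
Proof.
move=> /subspace_continuousP cf /subspace_continuousP ch AB; apply/subspace_continuousP => x Ax.
apply: (@cvg_comp _ _ _ h f _ (within B (nbhs (h x)))); last exact/cf/AB.
move=> S; rewrite /within /= => nS.
have nS' : \forall y \near within A (nbhs x), B (h y) -> S (h y) := ch _ Ax _ nS.
move: nS'; rewrite !near_withinE; apply: filterS => y /= BS Ay.
by apply: BS => //; exact: AB.
Qed.

Lemma within_compT (T U V : topologicalType) (A : set T) (f : U -> V) (h : T -> U) :
  continuous f -> {within A, continuous h} -> {within A, continuous (fun x => f (h x))}.
Proof.
move=> cf ch; have cfT : {within setT, continuous f} by exact: continuous_subspaceT.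
by apply: within_comp cfT ch _.
Qed.

Lemma withinV (R : realType) (T : topologicalType) (A : set T) (f : T -> R) :
  (forall x, A x -> f x != 0) -> {within A, continuous f} ->
  {within A, continuous (fun x => (f x)^-1)}.
Proof.
move=> f0 /subspace_continuousP cf; apply/subspace_continuousP => x Ax.
by apply: cvgV; [exact: f0|exact: cf].
Qed.

Section FreeHomotopy.
Variable R : realType.
Local Notation I01 := (@unit_interval R).

Lemma unit_interval0 : I01 0. Proof. by rewrite /unit_interval /= lexx ler01. Qed.
Lemma unit_intervalB s : I01 s -> I01 (1 - s).
Proof. by rewrite /unit_interval /= subr_ge0 gerBl andbC. Qed.

(** * Collars of the cube and change of base point *)

Section WallDistance.
Variable n : nat.
Implicit Types t : 'rV[R]_n.

(** On the cube this is the sup-norm distance to the boundary. The starting value [2^-1] bounds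
    every term from above; in dimension zero, where the boundary is empty, it keeps the distance
    positive. *)
Definition wall_distance t : R := \big[Num.min/2^-1]_(i < n) Num.min (t 0 i) (1 - t 0 i).

Lemma wall_distance_le t i : wall_distance t <= t 0 i /\ wall_distance t <= 1 - t 0 i.
Proof.
have : wall_distance t <= Num.min (t 0 i) (1 - t 0 i) by exact: bigmin_le_cond.
by rewrite le_min => /andP[].
Qed.

Lemma wall_distanceP t : wall_distance t = 2^-1 \/
  exists i, wall_distance t = t 0 i \/ wall_distance t = 1 - t 0 i.
Proof.
rewrite /wall_distance; elim/big_rec: _ => [|i x _ IHx]; first by left.
have [le|lt] := leP (Num.min (t 0 i) (1 - t 0 i)) x; last by [].
by right; exists i; have [|] := leP (t 0 i) (1 - t 0 i); [left|right].
Qed.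

Lemma cube_wall_distance t : cube t <-> 0 <= wall_distance t.
Proof.
split=> [ct|d0 i].
  have [->|[i [->|->]]] := wall_distanceP t; first by rewrite invr_ge0.
    by have /andP[] := ct i.
  by have /andP[] := ct i; rewrite subr_ge0.
have [di di'] := wall_distance_le t i; rewrite /unit_interval /= (le_trans d0 di)/=.
by rewrite -subr_ge0; exact: le_trans di'.
Qed.

Lemma cube_boundary_wall_distance t : cube t -> (cube_boundary t <-> wall_distance t = 0).
Proof.
move=> ct; split=> [[_ [i ti]]|d0].
  apply/eqP; rewrite eq_le (cube_wall_distance t).1// andbT.
  have [di di'] := wall_distance_le t i.
  by case: ti => ti; [rewrite -ti|rewrite -(subrr 1) -[X in _ - X]ti].
split=> //; have [|[i [|]]] := wall_distanceP t; rewrite d0.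
- by move=> /esym/eqP; rewrite invr_eq0 pnatr_eq0.
- by move=> ti; exists i; left.
- by move=> /esym/eqP; rewrite subr_eq0 => /eqP ti; exists i; right.
Qed.

Lemma wall_distance_continuous : continuous wall_distance.
Proof.
apply/continuous_subspace_setT; rewrite /wall_distance.
elim: (index_enum _) => [|i r IHr].
  under eq_fun do rewrite big_nil; exact: within_cst.
under eq_fun do rewrite big_cons.
have ct : {within setT, continuous (fun t : 'rV[R]_n => t 0 i)}.
  by apply: continuous_subspaceT; exact: coord_continuous.
apply: within_min => //; apply: within_min => //.
by apply: withinB => //; exact: within_cst.
Qed.

Lemma closed_cube : closed (@cube R n).
Proof.
rewrite (_ : @cube R n = wall_distance @^-1` [set x | 0 <= x]); last first.
  by apply/seteqP; split=> t /cube_wall_distance.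
by apply: preimage_closed; [move=> t _; exact: wall_distance_continuous|exact: closed_ge].
Qed.

Lemma closed_unit_interval_cube : closed (I01 `*` @cube R n).
Proof.
have cI : closed I01.
  rewrite (_ : I01 = [set x | 0 <= x] `&` [set x | x <= 1]).
    by apply: closedI; [exact: closed_ge|exact: closed_le].
  by apply/seteqP; split=> s /= => [/andP[]|[s0 s1]] //; apply/andP.
apply: (@closedI _ (fst @^-1` I01) (snd @^-1` @cube R n)).
  by apply: preimage_closed cI => st _; exact: cvg_fst.
apply: (@preimage_closed _ _ (snd : R * 'rV[R]_n -> _)) => //; last exact: closed_cube.
by move=> st _; exact: cvg_snd.
Qed.

End WallDistance.

Section Collar.
Variables (n : nat) (X : topologicalType).
Local Notation D := (I01 `*` @cube R n).
Variables (M : R * 'rV[R]_n -> X) (width : R -> R) (rim : R * R -> X).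
Hypothesis cM : {within D, continuous M}.
Hypothesis cwidth : continuous width.
Hypothesis width_ge0 : forall s, I01 s -> 0 <= width s <= 4^-1.
Let rim_dom := [set sd : R * R | I01 sd.1 /\ 0 <= sd.2 <= width sd.1].
Hypothesis crim : {within rim_dom, continuous rim}.
Hypothesis M_rim : forall s t, I01 s -> cube_boundary t -> M (s, t) = rim (s, width s).

Definition shrink (st : R * 'rV[R]_n) : 'rV[R]_n :=
  \row_i ((st.2 0 i - width st.1) / (1 - 2 * width st.1)).

(* M on the cube shrunk by width s, and rim (s, .) on the collar around it. *)
Definition collar (st : R * 'rV[R]_n) : X :=
  if wall_distance st.2 <= width st.1 then rim (st.1, wall_distance st.2)
  else M (st.1, shrink st).

Let width_pos s : I01 s -> 0 < 1 - 2 * width s.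
Proof. by move=> /width_ge0/andP[_]; lra. Qed.

Lemma shrink_cube st : D st -> width st.1 <= wall_distance st.2 -> cube (shrink st).
Proof.
move=> [Is ct] le i; have wp := width_pos Is; rewrite mxE /unit_interval /=.
have [di di'] := wall_distance_le st.2 i.
apply/andP; split.
  by apply: divr_ge0; [rewrite subr_ge0 (le_trans le)|exact: ltW].
by rewrite ler_pdivrMr// mul1r; have := le_trans le di'; lra.
Qed.

Lemma shrink_boundary st : D st -> width st.1 = wall_distance st.2 ->
  cube_boundary (shrink st).
Proof.
move=> Dst wd; split; first by apply: shrink_cube => //; rewrite wd.
have [Is ct] := Dst; have wp := width_pos Is; have /andP[_ w4] := width_ge0 Is.
(* [width] is at most [4^-1], so the distance is not the starting value and some coordinate realizes
   it. *)
have [d2|[i di]] := wall_distanceP st.2; first by move: w4; rewrite wd d2; lra.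
exists i; rewrite mxE; case: di => di; [left|right].
  by rewrite wd di subrr mul0r.
have -> : st.2 0 i - width st.1 = 1 - 2 * width st.1 by rewrite wd di; lra.
by rewrite divff// gt_eqF.
Qed.

Lemma collar_continuous : {within D, continuous collar}.
Proof.
have cw : {within D, continuous (fun st : R * 'rV[R]_n => width st.1)}.
  apply: continuous_subspaceT => st; apply: continuous_comp; last exact: cwidth.
  exact: cvg_fst.
have cd : {within D, continuous (fun st : R * 'rV[R]_n => wall_distance st.2)}.
  apply: continuous_subspaceT => st; apply: continuous_comp; last exact: wall_distance_continuous.
  exact: cvg_snd.
have c1 : {within D, continuous (fun st : R * 'rV[R]_n => st.1)}.
  by apply: continuous_subspaceT => st; exact: cvg_fst.
pose A := D `&` (fun st => wall_distance st.2 - width st.1) @^-1` [set x | x <= 0].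
pose B := D `&` (fun st => wall_distance st.2 - width st.1) @^-1` [set x | 0 <= x].
have cD : closed D := @closed_unit_interval_cube n.
have cA : closed A by apply: closed_within_preimage => //; exact: withinB.
have cB : closed B by apply: closed_within_preimage => //; exact: withinB.
have AD : A `<=` D by move=> st [].
have BD : B `<=` D by move=> st [].
rewrite (_ : D = A `|` B); last first.
  apply/seteqP; split=> [st Dst|st [[]|[]]//].
  by have [le|/ltW le] := leP (wall_distance st.2 - width st.1) 0; [left|right].
apply: withinU_continuous => //.
  apply: (@subspace_eq_continuous _ _ _ (fun st => rim (st.1, wall_distance st.2))).
    by move=> st /set_mem [_ /=]; rewrite subr_le0 /from_subspace /collar => ->.
  apply: within_comp crim _ _.
    by apply: continuous_pair; [exact: continuous_subspaceW c1|exact: continuous_subspaceW cd].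
  move=> [s t] [[Is ct] /=]; rewrite subr_le0 => le; split=> //=.
  by rewrite le andbT; exact/cube_wall_distance.
apply: (@subspace_eq_continuous _ _ _ (fun st => M (st.1, shrink st))).
  move=> [s t] /set_mem [Dst /=]; rewrite subr_ge0 /from_subspace /collar /= => ge.
  case: ifPn => // le; have wd : width s = wall_distance t by apply/eqP; rewrite eq_le ge le.
  by rewrite M_rim ?wd//; [case: Dst|exact: (@shrink_boundary (s, t))].
apply: within_comp cM _ _; last first.
  move=> [s t] [[Is ct] /=]; rewrite subr_ge0 => ge; split=> //=.
  exact: (@shrink_cube (s, t)).
apply: continuous_pair; first exact: continuous_subspaceW c1.
apply: continuous_rowP => i; under eq_fun do rewrite mxE.
apply: withinM.
  apply: withinB; last exact: continuous_subspaceW cw.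
  apply: continuous_subspaceT => st.
  apply: (@continuous_comp _ _ _ snd (fun t : 'rV[R]_n => t 0 i)); first exact: cvg_snd.
  exact: coord_continuous.
apply: withinV => [st [[Is _] _]|]; first by rewrite gt_eqF// width_pos.
apply: withinB; first exact: within_cst.
by apply: withinM; [exact: within_cst|exact: continuous_subspaceW cw].
Qed.

Lemma collar_boundary s t : I01 s -> cube_boundary t -> collar (s, t) = rim (s, 0).
Proof.
move=> Is bt; rewrite /collar (cube_boundary_wall_distance (proj1 bt)).1//=.
by have /andP[-> _] := width_ge0 Is.
Qed.

Lemma collar_width0 s t : width s = 0 -> cube t ->
  (cube_boundary t -> rim (s, 0) = M (s, t)) -> collar (s, t) = M (s, t).
Proof.
move=> w0 ct bt; rewrite /collar /= w0; case: ifPn => [d0|_].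
  have dE : wall_distance t = 0 by apply/eqP; rewrite eq_le d0; exact/cube_wall_distance.
  by rewrite dE bt//; apply/cube_boundary_wall_distance.
congr (M (s, _)); apply/rowP => i.
by rewrite mxE /= w0 mulr0 !subr0 divr1.
Qed.

End Collar.

Lemma within_paste n (X : topologicalType) (D : set (R * 'rV[R]_n)) (c : R)
    (f h : R * 'rV[R]_n -> X) : closed D ->
  {within D `&` [set st | st.1 <= c], continuous f} ->
  {within D `&` [set st | c <= st.1], continuous h} ->
  (forall st, D st -> st.1 = c -> f st = h st) ->
  {within D, continuous (fun st => if st.1 <= c then f st else h st)}.
Proof.
move=> cD cf ch fh.
have c1 : {within D, continuous (fun st : R * 'rV[R]_n => st.1)}.
  by apply: continuous_subspaceT => st; exact: cvg_fst.
have cA : closed (D `&` [set st | st.1 <= c]).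
  exact: (@closed_within_preimage _ _ _ _ [set x | x <= c]).
have cB : closed (D `&` [set st | c <= st.1]).
  exact: (@closed_within_preimage _ _ _ _ [set x | c <= x]).
apply: (@continuous_subspaceW _ _ D
    ((D `&` [set st | st.1 <= c]) `|` (D `&` [set st | c <= st.1]))).
  by move=> st Dst; have [le|/ltW le] := leP st.1 c; [left|right].
apply: withinU_continuous => //.
  apply: (@subspace_eq_continuous _ _ _ f) cf => st /set_mem [_ /= le].
  by rewrite /from_subspace /= le.
apply: (@subspace_eq_continuous _ _ _ h) ch => st /set_mem [Dst /= ge].
rewrite /from_subspace /=; case: ifPn => // le.
by apply/esym/fh => //; apply/eqP; rewrite eq_le le.
Qed.

Section Transport.
Variables (n : nat) (X : topologicalType).
Implicit Types (a b : 'rV[R]_n -> X) (gamma : R -> X).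
Local Notation D := (I01 `*` @cube R n).

Definition free_homotopic gamma a b : Prop := exists K : R * 'rV[R]_n -> X,
  [/\ {within D, continuous K}, forall t, cube t -> K (0, t) = a t,
      forall t, cube t -> K (1, t) = b t &
      forall s t, I01 s -> cube_boundary t -> K (s, t) = gamma s].

Lemma free_homotopic_rev gamma a b : free_homotopic gamma a b ->
  free_homotopic (fun s => gamma (1 - s)) b a.
Proof.
move=> [K [cK K0 K1 Kb]]; exists (fun st => K (1 - st.1, st.2)); split=> /=.
- apply: within_comp cK _ _; last first.
    by move=> [s t] [Is ct]; split=> //; exact: unit_intervalB.
  apply: continuous_subspaceT; apply: continuous_pair; last by move=> st; exact: cvg_snd.
  by move=> st; apply: cvgB; [exact: cvg_cst|exact: cvg_fst].
- by move=> t ct; rewrite subr0 K1.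
- by move=> t ct; rewrite subrr K0.
- by move=> s t Is bt; rewrite Kb//; exact: unit_intervalB.
Qed.

(** Homotopy extension from the boundary of the cube. At time [s] a shrunk copy of [b] is surrounded
    by a collar on which [gamma] runs from [gamma s] at the boundary to [gamma 1]; the factor 4 in
    [rim] undoes the one in [width]. *)
Lemma free_homotopic_exists gamma b : continuous gamma -> cube_loop (gamma 1) b ->
  exists2 a, cube_loop (gamma 0) a & free_homotopic gamma a b.
Proof.
move=> cg [cb bb].
pose M (st : R * 'rV[R]_n) := b st.2; pose width (s : R) := (1 - s) / 4.
pose rim (sd : R * R) := gamma (sd.1 + 4 * sd.2).
have cM : {within D, continuous M}.
  apply: within_comp cb _ _; last by move=> st [].
  by apply: continuous_subspaceT => st; exact: cvg_snd.
have cw : continuous width.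
  by move=> s; apply: cvgM; [apply: cvgB; [exact: cvg_cst|exact: cvg_id]|exact: cvg_cst].
have w0 s : I01 s -> 0 <= width s <= 4^-1.
  by rewrite /width /unit_interval /= => /andP[s0 s1]; apply/andP; split; lra.
have cr : continuous rim.
  move=> sd; apply: (@continuous_comp _ _ _ (fun sd : R * R => sd.1 + 4 * sd.2)); last exact: cg.
  by apply: cvgD; [exact: cvg_fst|apply: cvgM; [exact: cvg_cst|exact: cvg_snd]].
have Mr s t : I01 s -> cube_boundary t -> M (s, t) = rim (s, width s).
  move=> _ bt; rewrite /M /rim bb//; congr gamma; rewrite /width /=; lra.
have cK := collar_continuous cM cw w0 (continuous_subspaceT cr) Mr.
have Kb s t : I01 s -> cube_boundary t -> collar M width rim (s, t) = gamma s.
  by move=> Is bt; rewrite (collar_boundary M rim w0)// /rim /= mulr0 addr0.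
exists (fun t => collar M width rim (0, t)).
  split; last by move=> t bt; rewrite Kb//; exact: unit_interval0.
  apply: within_comp cK _ _; last by move=> t ct; split=> //; exact: unit_interval0.
  apply: continuous_subspaceT; apply: continuous_pair; last by move=> t; exact: cvg_id.
  exact: (@cst_continuous _ R).
exists (collar M width rim); split=> // t ct.
rewrite collar_width0//; first by rewrite /width subrr mul0r.
by move=> bt; rewrite /rim /= mulr0 addr0 /M bb.
Qed.

(** Following [Ka], then [G], then [Kb] backwards leads from [a] to [b], while the boundary runs out
    along [gamma] and back. A collar that retraces [gamma] pins the boundary to [gamma 0]. *)
Lemma free_homotopic_unique gamma a a' b b' : continuous gamma ->
  free_homotopic gamma a a' -> free_homotopic gamma b b' ->
  cube_homotopic (gamma 1) a' b' -> cube_homotopic (gamma 0) a b.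
Proof.
move=> cg [Ka [cKa Ka0 Ka1 Kab]] [Kb [cKb Kb0 Kb1 Kbb]] [G [cG G0 G1 Gb]].
pose M (st : R * 'rV[R]_n) := if st.1 <= 3^-1 then Ka (3 * st.1, st.2)
  else if st.1 <= 2 / 3 then G (3 * st.1 - 1, st.2) else Kb (3 - 3 * st.1, st.2).
(* [phi s] is the parameter on [gamma] at which [M] has its boundary at time [s], so [rim] at depth
   [width s] matches it. *)
pose phi (s : R) : R := Num.min 1 (Num.min (3 * s) (3 - 3 * s)).
pose width (s : R) : R := phi s / 4; pose rim (sd : R * R) := gamma (4 * sd.2).
have cD : closed D := @closed_unit_interval_cube n.
have c1 : continuous (fun st : R * 'rV[R]_n => st.1) by move=> st; exact: cvg_fst.
have c2 : continuous (fun st : R * 'rV[R]_n => st.2) by move=> st; exact: cvg_snd.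
have c31 : continuous (fun st : R * 'rV[R]_n => 3 * st.1).
  by move=> st; apply: cvgM; [exact: cvg_cst|exact: c1].
have cM : {within D, continuous M}.
  apply: within_paste => //.
  - apply: within_comp cKa _ _.
      by apply: continuous_subspaceT; exact: continuous_pair.
    move=> [s t] /= [[/= /andP[s0 s1] ct] le]; split=> //=.
    by rewrite /unit_interval /=; apply/andP; split; lra.
  - apply: within_paste.
    + have c1D := @continuous_subspaceT _ _ D _ c1.
      exact: (@closed_within_preimage _ _ _ _ [set x | 3^-1 <= x]).
    + apply: within_comp cG _ _.
        apply: continuous_subspaceT; apply: continuous_pair => // st.
        by apply: cvgB; [exact: c31|exact: cvg_cst].
      move=> [s t] /= [[[/= /andP[s0 s1] ct] ge] le]; split=> //=.
      by rewrite /unit_interval /=; apply/andP; split; lra.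
    + apply: within_comp cKb _ _.
        apply: continuous_subspaceT; apply: continuous_pair => // st.
        by apply: cvgB; [exact: cvg_cst|exact: c31].
      move=> [s t] /= [[[/= /andP[s0 s1] ct] ge] le]; split=> //=.
      by rewrite /unit_interval /=; apply/andP; split; lra.
    + move=> [s t] /= [[_ ct] _] ->.
      have -> : 3 * (2 / 3) - 1 = 1 :> R by lra.
      have -> : 3 - 3 * (2 / 3) = 1 :> R by lra.
      by rewrite G1// Kb1.
  - move=> [s t] /= [_ ct] ->; rewrite divff// subrr ifT; last by lra.
    by rewrite Ka1// G0.
have w0 s : I01 s -> 0 <= width s <= 4^-1.
  rewrite /width /phi /unit_interval /= /Num.min => /andP[s0 s1].
  by case: (ltP (3 * s) (3 - 3 * s)) => ?; case: (ltP 1 _) => ?; apply/andP; split; lra.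
have cw : continuous width.
  apply/continuous_subspace_setT; apply: withinM; last exact: within_cst.
  have c3 : {within setT, continuous (fun s : R => 3 * s)}.
    by apply: continuous_subspaceT => s; apply: cvgM; [exact: cvg_cst|exact: cvg_id].
  apply: within_min; first exact: within_cst.
  by apply: within_min => //; apply: withinB => //; exact: within_cst.
have cr : continuous rim.
  move=> sd; apply: (@continuous_comp _ _ _ (fun sd : R * R => 4 * sd.2)); last exact: cg.
  by apply: cvgM; [exact: cvg_cst|exact: cvg_snd].
have phiE s : I01 s -> phi s = if s <= 3^-1 then 3 * s else if s <= 2 / 3 then 1 else 3 - 3 * s.
  rewrite /unit_interval /phi /= /Num.min => /andP[s0 s1].
  case: (ltP (3 * s) (3 - 3 * s)) => ?; case: (ltP 1 _) => ?;
    by case: (leP s 3^-1) => ?; [|case: (leP s (2 / 3)) => ?]; lra.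
have Mr s t : I01 s -> cube_boundary t -> M (s, t) = rim (s, width s).
  move=> Is bt; rewrite /rim /= /width mulrC mulfVK// phiE// /M /=.
  have := Is; rewrite /unit_interval /= => /andP[s0 s1].
  case: ifPn => l1; [|case: ifPn => l2].
  - by rewrite Kab// /unit_interval /=; apply/andP; split; lra.
  - by rewrite Gb// /unit_interval /=; apply/andP; split; lra.
  - by rewrite Kbb// /unit_interval /=; apply/andP; split; lra.
have cK := collar_continuous cM cw w0 (continuous_subspaceT cr) Mr.
exists (collar M width rim); split=> //.
- move=> t ct; have M0 : M (0, t) = a t by rewrite /M /= mulr0 Ka0// ifT.
  rewrite collar_width0// /width /phi.
    by rewrite mulr0 subr0 /Num.min; case: (ltP 0 3) => ?; case: (ltP 1 _) => ?; lra.
  by move=> bt; rewrite M0 -Ka0// Kab ?/rim ?mulr0//; exact: unit_interval0.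
- move=> t ct; have M1 : M (1, t) = b t.
    by rewrite /M /= mulr1 subrr !ifF ?Kb0//; apply/negbTE; rewrite -ltNge; lra.
  rewrite collar_width0// /width /phi.
    by rewrite mulr1 subrr /Num.min; case: (ltP 3 0) => ?; case: (ltP 1 _) => ?; lra.
  by move=> bt; rewrite M1 -Kb0// Kbb ?/rim ?mulr0//; exact: unit_interval0.
- by move=> s t Is bt; rewrite (collar_boundary M rim w0)// /rim /= mulr0.
Qed.

End Transport.

Lemma joined_by_path_trans (X : topologicalType) (x y z : X) :
  joined_by_path R x y -> joined_by_path R y z -> joined_by_path R x z.
Proof.
move=> [g [cg g0 g1]] [h [ch h0 h1]].
exists (fun s => if s <= 2^-1 then g (2 * s) else h (2 * s - 1)); split.
- pose A := [set s : R | 0 <= s <= 2^-1]; pose B := [set s : R | 2^-1 <= s <= 1].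
  have cAB (u v : R) : closed [set s : R | u <= s <= v].
    rewrite (_ : [set _ | _] = [set s | u <= s] `&` [set s | s <= v]).
      by apply: closedI; [exact: closed_ge|exact: closed_le].
    by apply/seteqP; split=> s /= => [/andP[]|[]] // -> ->.
  have c2 : continuous (fun s : R => 2 * s).
    by move=> s; apply: cvgM; [exact: cvg_cst|exact: cvg_id].
  rewrite (_ : I01 = A `|` B); last first.
    apply/seteqP; split=> [s /andP[s0 s1]|s [|]]; rewrite /A /B /unit_interval /=.
    + by have [le|lt] := leP s 2^-1; [left|right]; rewrite ?s0 ?le// s1 ltW.
    + by move=> /andP[s0 s1]; apply/andP; split; lra.
    + by move=> /andP[s0 s1]; apply/andP; split; lra.
  apply: withinU_continuous; [exact: cAB|exact: cAB|..].
    apply: (@subspace_eq_continuous R A X (fun s : R => g (2 * s))).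
      by move=> s /set_mem /andP[_ le]; rewrite /from_subspace le.
    apply: within_comp cg (continuous_subspaceT c2) _.
    by move=> s /andP[s0 s1]; apply/andP; split; lra.
  apply: (@subspace_eq_continuous R B X (fun s : R => h (2 * s - 1))).
    move=> s /set_mem /andP[ge _]; rewrite /from_subspace; case: ifPn => // le.
    have -> : s = 2^-1 by apply/eqP; rewrite eq_le le.
    by rewrite divff// subrr h0 g1.
  apply: within_comp ch _ _.
    by apply: continuous_subspaceT => s; apply: cvgB; [exact: c2|exact: cvg_cst].
  by move=> s /andP[s0 s1]; apply/andP; split; lra.
- by rewrite mulr0 ifT.
- rewrite mulr1 ifF; first by rewrite -[RHS]h1; congr h; lra.
  by apply/negbTE; rewrite -ltNge; lra.
Qed.

Lemma joined_by_path_sym (X : topologicalType) (x y : X) :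
  joined_by_path R x y -> joined_by_path R y x.
Proof.
move=> [g [cg g0 g1]]; exists (fun s => g (1 - s)); rewrite subr0 subrr; split=> //.
apply: within_comp cg _ unit_intervalB.
by apply: continuous_subspaceT => s; apply: cvgB; [exact: cvg_cst|exact: cvg_id].
Qed.

Lemma joined_by_path_comp (X Y : topologicalType) (f : X -> Y) (x y : X) :
  continuous f -> joined_by_path R x y -> joined_by_path R (f x) (f y).
Proof.
move=> cf [g [cg g0 g1]]; exists (fun s => f (g s)); rewrite g0 g1; split=> //.
exact: within_compT cf cg.
Qed.

Section HomotopyInverse.
Variables (X Y : topologicalType) (f : X -> Y) (g : Y -> X) (H : X * R -> X).
Hypotheses (cf : continuous f) (cg : continuous g) (cH : continuous H).
Hypotheses (H0 : forall x, H (x, 0) = x) (H1 : forall x, H (x, 1) = g (f x)).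

Let cHx x : continuous (fun s => H (x, s)).
Proof.
move=> s; apply: (@continuous_comp _ _ _ (fun s => (x, s)) H); last exact: cH.
have cid : continuous (@id R) by move=> s'; exact: cvg_id.
exact: (@continuous_pair R X R _ _ (@cst_continuous R X x) cid).
Qed.

Lemma homotopy_joined_by_path x : joined_by_path R x (g (f x)).
Proof. by exists (fun s => H (x, s)); split=> //; exact: continuous_subspaceT. Qed.

Lemma homotopy_free_homotopic n x (a : 'rV[R]_n -> X) : cube_loop x a ->
  free_homotopic (fun s => H (x, s)) a (fun t => g (f (a t))).
Proof.
move=> [ca ab]; exists (fun st => H (a st.2, st.1)); split=> //=; last first.
  by move=> s t _ bt; rewrite ab.
apply: within_compT cH _.
apply: continuous_pair; last by apply: continuous_subspaceT => st; exact: cvg_fst.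
apply: within_comp ca _ _; last by move=> st [].
by apply: continuous_subspaceT => st; exact: cvg_snd.
Qed.

Lemma cube_homotopic_comp n y (a b : 'rV[R]_n -> Y) :
  cube_homotopic y a b -> cube_homotopic (g y) (g \o a) (g \o b).
Proof.
move=> [K [cK K0 K1 Kb]]; exists (g \o K); split=> //=.
- exact: within_compT cg cK.
- by move=> t ct; rewrite K0.
- by move=> t ct; rewrite K1.
- by move=> s t Is bt; rewrite Kb.
Qed.

Lemma homotopy_pi_injective n x (a b : 'rV[R]_n -> X) : cube_loop x a -> cube_loop x b ->
  cube_homotopic (f x) (f \o a) (f \o b) -> cube_homotopic x a b.
Proof.
move=> la lb /cube_homotopic_comp gab; rewrite -[x]H0.
apply: (@free_homotopic_unique _ _ (fun s => H (x, s)) a (g \o (f \o a)) b (g \o (f \o b))).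
- exact: cHx.
- exact: homotopy_free_homotopic.
- exact: homotopy_free_homotopic.
- by rewrite H1.
Qed.

Lemma homotopy_pi0_injective x x' : joined_by_path R (f x) (f x') -> joined_by_path R x x'.
Proof.
move=> /(joined_by_path_comp cg) p; apply: joined_by_path_trans (homotopy_joined_by_path x) _.
apply: joined_by_path_trans p _; apply: joined_by_path_sym; exact: homotopy_joined_by_path.
Qed.

(** The loop [g \o b] is carried back to [x] along the path traced by [H], which gives [a]. Both
    [g \o b] and the image of [a] are freely homotopic to [a] along that same path, so uniqueness
    compares them at [g (f x)]. *)
Lemma homotopy_pi_lift n x (b : 'rV[R]_n -> Y) : cube_loop (f x) b ->
  exists2 a, cube_loop x a &
    cube_homotopic (g (f x)) (g \o (f \o a)) (g \o b).
Proof.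
move=> [cb bb]; have lgb : cube_loop (H (x, 1)) (g \o b).
  split; last by move=> t bt; rewrite /= bb// H1.
  exact: within_compT cg cb.
have [a la Ta] := free_homotopic_exists (@cHx x) lgb; rewrite H0 in la; exists a => //.
have Tg := homotopy_free_homotopic la.
rewrite -H1 -[1 : R]subr0.
apply: (@free_homotopic_unique _ _ (fun s => H (x, 1 - s)) _ a _ a).
- move=> s; apply: (@continuous_comp _ _ _ (fun s : R => 1 - s) (fun s => H (x, s))).
    by apply: cvgB; [exact: cvg_cst|exact: cvg_id].
  exact: cHx.
- exact: (free_homotopic_rev Tg).
- exact: (free_homotopic_rev Ta).
rewrite subrr H0; have [ca ba] := la; exists (fun st => a st.2); split=> //.
  apply: within_comp ca _ _; last by move=> st [].
  by apply: continuous_subspaceT => st; exact: cvg_snd.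
by move=> s t _ bt; exact: ba.
Qed.

End HomotopyInverse.

Theorem homotopy_equivalence_weak (X Y : topologicalType) (f : X -> Y) (g : Y -> X)
    (H : X * R -> X) (K : Y * R -> Y) :
  continuous f -> continuous g -> continuous H -> continuous K ->
  (forall x, H (x, 0) = x) -> (forall x, H (x, 1) = g (f x)) ->
  (forall y, K (y, 0) = y) -> (forall y, K (y, 1) = f (g y)) ->
  weak_homotopy_equivalence R f.
Proof.
move=> cf cg cH cK H0 H1 K0 K1; split=> //.
  split; first exact: (homotopy_pi0_injective cg cH H0 H1).
  move=> y; exists (g y); apply: joined_by_path_sym.
  exact: (homotopy_joined_by_path cK K0 K1).
move=> n x _; split=> [a b la lb|b lb]; first exact: (homotopy_pi_injective cg cH H0 H1).
have [a la gfa] := homotopy_pi_lift cg cH H0 H1 lb.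
(* By the homotopy [K], [g] is injective on classes; this cancels the outer [g] left by the
   lifting. *)
exists a => //; apply: (homotopy_pi_injective cf cK K0 K1) => //.
have [ca ba] := la; split; last by move=> t bt; rewrite /= ba.
exact: within_compT cf ca.
Qed.

End FreeHomotopy.

(** * The homotopy inverse of the comparison map *)

Lemma hocolim_map_continuous (R : realType) d d' (P : porderType d) (Q : porderType d')
    (D : diagram Q) (F : {omorphism P -> Q}) : continuous (hocolim_map R D F).
Proof.
apply/quotient_continuous.
apply: (@eqfun_continuous (hocolim_cells R (diagram_comp D F)) _
  (fun p => hocolim_pi (hocolim_cells_map p))).
  by move=> p; exact/esym/hocolim_mapE.
have cm : continuous (@hocolim_cells_map R _ _ P Q D F).
  move=> [[m c] [x t]] U nU.
  apply: (@existT_continuous _ (hocolim_cell R (diagram_comp D F)) (existT _ m c) (x, t)).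
  have := @existT_continuous _ (hocolim_cell R D) (existT _ m (F \o c : {omorphism _ -> _})) (x, t).
  by move=> /(_ U nU); apply: (@filterS _ (nbhs (x, t)) _) => -[].
by move=> p; apply: continuous_comp; [exact: cm|exact: hocolim_pi_continuous].
Qed.

Variant hocolim_spec (R : realType) d (P : porderType d) (E : diagram P) :
    hocolim R E -> Prop :=
  HocolimSpec m (c : chain P m) (x : E (c ord0)) (t : simplex R m) :
    hocolim_spec (hocolim_pi (hocolim_pt x t)).

Lemma hocolimP (R : realType) d (P : porderType d) (E : diagram P) (z : hocolim R E) :
  hocolim_spec z.
Proof. by rewrite -[z]hocolim_reprK; case: (hocolim_repr z) => -[m c] [x t]. Qed.

Section CellFrame.
Variables (R : realType) (d : Order.disp_t) (P : porderType d).

Lemma simplex_barycenter m : simplex R m (const_mx m.+1%:R^-1).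
Proof.
split=> [i|]; first by rewrite mxE invr_ge0.
under eq_bigr do rewrite mxE.
by rewrite sumr_const card_ord -[LHS]mulr_natl divff// pnatr_eq0.
Qed.

(** The barycentre gives positive weight to every value of [c], so a frame of its measure enumerates
    them all. *)
Lemma chain_enum m (c : chain P m) : exists q l, [/\ path <%O q l,
  forall i, c i \in q :: l & forall p, p \in q :: l -> (c ord0 <= p)%O].
Proof.
have tE := to_simplexK (@simplex_barycenter m).
have tP := prob_cell_measure c (to_simplex (const_mx (m.+1%:R^-1 : R))).
have [[q l s Gl tl]] := prob_chain_frame tP.
exists q, l; split=> // i; apply: tl; rewrite tE /supp /= /cell_measure gt_eqF//.
under eq_bigr do rewrite mxE.
rewrite (bigD1 i)//= ltr_pwDl ?invr_gt0//.
by apply: sumr_ge0 => j _; rewrite invr_ge0.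
Qed.

Lemma hocolim_pi_frame (E : diagram P) m (c : chain P m) (x : E (c ord0)) (t : simplex R m)
    (F : frame [set p | (c ord0 <= p)%O] (cell_measure c (set_val t))) :
  hocolim_pi (hocolim_pt x t) = frame_pt (fun p h => diag_map E h) F x.
Proof.
have e_map p p' (h : [set p | (c ord0 <= p)%O] p) (h' : [set p | (c ord0 <= p)%O] p')
    (k : (p <= p')%O) y : diag_map E h' y = diag_map E k (diag_map E h y).
  exact: diag_map_comp.
have [q [l [s cl lc]]] := chain_enum c.
have nul p : supp (cell_measure c (set_val t)) p -> p \in q :: l.
  by move=> /supp_cell_measure[i <-].
rewrite (frame_pt_indep e_map F (Frame s lc nul) x (prob_cell_measure c t)) /frame_pt /=.
have k : (q <= c ord0)%O.
  have := cl ord0; rewrite inE => /predU1P[->//|ql].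
  by move: s; rewrite lt_path_sortedE => /andP[/allP/(_ _ ql)/ltW].
rewrite -(hocolim_pi_cell s cl k) -(diag_map_comp E _ k (lexx (c ord0))).
by rewrite diag_map_id.
Qed.

Lemma frame_pt_eq (E : diagram P) (X X' : topologicalType) (G G' : set P)
    (e : forall q, G q -> X -> E q) (e' : forall q, G' q -> X' -> E q)
    (nu nu' : P -> R) (F : frame G nu) (F' : frame G' nu') x x' : nu = nu' ->
  frame_head F = frame_head F'-> frame_tail F = frame_tail F' ->
  (forall q (h : G q) (h' : G' q), e q h x = e' q h' x') ->
  frame_pt e F x = frame_pt e' F' x'.
Proof.
case: F => q l s Gl nul; case: F' => q' l' s' Gl' nul' /= nunu' qq' ll' ee'.
subst q' l'; rewrite /frame_pt /= -nunu' (ee' _ _ (Gl' q (mem_head _ _))).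
by rewrite (bool_irrelevance s s').
Qed.

Lemma operator_map_id (E : diagram P) (T : transport E E) (Op : R -> (P -> R) -> P -> R)
    (OpP : measure_operator T Op) s z :
  (forall nu, prob_chain setT nu -> Op s nu = nu) ->
  (forall p p', (p <= p')%O -> carry T p p') ->
  (forall p p' (h : carry T p p') (k : (p <= p')%O) x,
    transport_map h x = diag_map E k x) ->
  operator_map OpP (z, s) = z.
Proof.
move=> Ops leT mapT; case: z / (hocolimP z) => m c x t.
have cP := prob_cell_measure c t.
have [F] := prob_chain_frame cP.
have OpE : Op s (cell_measure c (set_val t)) = cell_measure c (set_val t).
  by apply: Ops; case: cP => cm c1; split=> //; exact: chain_measureS cm.
have nul p : supp (Op s (cell_measure c (set_val t))) p -> p \in frame_head F :: frame_tail F.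
  by rewrite OpE; exact: frame_supp.
have Gl p : p \in frame_head F :: frame_tail F -> carry T (c ord0) p.
  by move=> /frame_mem; exact: leT.
rewrite [RHS](hocolim_pi_frame x F) (operator_mapP OpP x (Frame (frame_path F) Gl nul)).
apply: frame_pt_eq => // p h h'; exact: mapT.
Qed.

End CellFrame.

Lemma chain_measure0 (R : realType) d (P : porderType d) (T : set P) :
  chain_measure T (fun=> 0 : R).
Proof.
split=> // [p|p q|]; rewrite /supp /= ?eqxx//.
by rewrite (_ : [set _ | _] = set0) ?finite_set0//; apply/seteqP; split=> p //=; rewrite eqxx.
Qed.

Lemma chain_measureD (R : realType) d (P : porderType d) (T : set P) (b c : P -> R) :
  chain_measure T b -> chain_measure T c -> (forall p q, supp b p -> supp c q -> (p <= q)%O) ->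
  chain_measure T (fun p => b p + c p).
Proof.
move=> [b0 bT bc fb] [c0 cT cc fc] bLc.
have bcP p : supp (fun p => b p + c p) p -> supp b p \/ supp c p.
  rewrite /supp /=; have [->|] := eqVneq (b p) 0; last by left.
  by rewrite add0r; right.
split.
- by move=> p; rewrite addr_ge0.
- by move=> p /bcP[/bT|/cT].
- move=> p q /bcP[bp|cp] /bcP[bq|cq]; [exact: bc|apply: le_comparable; exact: bLc| |exact: cc].
  by apply: ge_comparable; exact: bLc.
- exact: finite_suppD.
Qed.

Lemma finite_family0 (R : realType) (P : choiceType) (Y : topologicalType) (A : set Y) :
  finite_family A (fun (_ : Y) (_ : P) => 0 : R).
Proof. by split=> [p|]; [exact: within_cst|exists [::] => y p _; rewrite /supp /= eqxx]. Qed.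

Lemma prob_chain_setT (R : realType) d (P : porderType d) (G : set P) (nu : P -> R) :
  prob_chain G nu -> chain_measure setT nu.
Proof. by case=> cnu _; exact: chain_measureS cnu. Qed.

Lemma upper_part0 (R : realType) d (P : porderType d) (b : P -> R) :
  (forall p, 0 <= b p) -> upper_part 0 b = b.
Proof. by move=> b0; apply/funext => p; rewrite /upper_part lower_part0// subr0. Qed.

Lemma upper_part1 (R : realType) d (P : porderType d) (T : set P) (b : P -> R) :
  chain_measure T b -> mass b = 1 -> upper_part 1 b = fun=> 0.
Proof. by move=> cb b1; apply/funext => p; rewrite /upper_part (lower_part1 cb)// subrr. Qed.

Section Comparison.
Variables (R : realType) (n : nat) (C : coxeterSystem n) (D : diagram (weak_order C)).
Local Notation W := (weak_order C).
Local Notation Q := (davis_poset C).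
Implicit Types (mu : W -> R) (nu : Q -> R) (w : W) (A : Q) (s : R).

Definition longest_element : {omorphism Q -> W} := @davis_top n C.
Local Notation L := longest_element.
Local Notation DL := (diagram_comp D L).

Lemma joint_chain_vertices mu : chain_measure setT mu -> joint_chain mu (fun=> 0).
Proof.
by split=> //; [exact: chain_measure0|move=> w A _; rewrite /supp /= eqxx].
Qed.

Lemma joint_chain_split s nu : chain_measure setT nu ->
  joint_chain (push_measure L (lower_part s nu)) (upper_part s nu).
Proof.
move=> cnu; split.
- apply: chain_measureS (chain_measure_push (omorph_le L) (chain_measure_lower s cnu)) => //.
- exact: chain_measure_upper.
- move=> w A /supp_push_measure[B lB <-] uA.
  exact/davis_top_homo/(lower_upper_le cnu lB uA).
Qed.

Definition sweep_transport : transport D DL.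
Proof.
apply: (@Transport _ _ _ _ D DL (fun w => [set A | (w <= L A)%O]) (fun w A h => diag_map D h)).
- by move=> w A h; exact: (@diag_map_continuous _ _ D _ _ h).
- by move=> w w' A ww' /=; exact: le_trans.
- by move=> w A A' h h' k x; exact: (diag_map_comp D h (omorph_le L k) h' x).
- by move=> w w' A k h h' x; exact: (esym (diag_map_comp D k h h' x)).
Defined.

Definition coset_transport : transport DL DL.
Proof.
apply: (@Transport _ _ _ _ DL DL (fun B => [set A | (L B <= L A)%O]) (fun B A h => diag_map D h)).
- by move=> B A h; exact: (@diag_map_continuous _ _ D (L B) (L A) h).
- by move=> B B' A BB' /=; apply: le_trans; exact: omorph_le.
- by move=> B A A' h h' k x; exact: (diag_map_comp D h (omorph_le L k) h' x).
- by move=> B B' A k h h' x; exact: (esym (diag_map_comp D (omorph_le L k) h h' x)).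
Defined.

Definition element_transport : transport D D.
Proof.
apply: (@Transport _ _ _ _ D D (fun w => [set w' | (w <= w')%O]) (fun w w' h => diag_map D h)).
- by move=> w w' h; exact: (@diag_map_continuous _ _ D _ _ h).
- by move=> w w' v ww' /=; exact: le_trans.
- by move=> w v v' h h' k x; exact: (diag_map_comp D h k h' x).
- by move=> w w' v k h h' x; exact: (esym (diag_map_comp D k h h' x)).
Defined.

Definition sweep_op s mu : Q -> R := sweep_measure mu (fun=> 0).
Definition coset_op s nu : Q -> R :=
  sweep_measure (push_measure L (lower_part s nu)) (upper_part s nu).
(** Sweeping moves mass upwards, so here the upper part is swept and the lower one stays in W below
    it. In [coset_op] the lower part is sent to W and swept onto the upper one, because
    [joint_chain] places elements below cosets. *)
Definition element_op s mu w : R :=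
  lower_part s mu w + push_measure L (sweep_measure (upper_part s mu) (fun=> 0)) w.

Lemma sweep_opP : measure_operator sweep_transport sweep_op.
Proof.
split=> [s mu w muP|Y s mu cs muF muP].
  have [cs ms lb] := sweep_measureP (joint_chain_vertices (prob_chain_setT muP)).
  have [[_ muw _ _] mu1] := muP.
  split; last by rewrite /sweep_op ms mu1 mass0 addr0.
  apply: chain_measure_sub cs => A; apply: lb => // B.
  by rewrite /supp /= eqxx.
apply: sweep_measure_family; [exact: closedT|exact: muF|exact: finite_family0|].
by move=> y _; exact/joint_chain_vertices/(prob_chain_setT (muP y)).
Qed.

Lemma coset_opP : measure_operator coset_transport coset_op.
Proof.
split=> [s nu B nuP|Y s nu cs nuF nuP].
  have cnu := prob_chain_setT nuP; have [[_ nuB _ _] nu1] := nuP.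
  have [cs ms lb] := sweep_measureP (joint_chain_split s cnu).
  split; last first.
    rewrite /coset_op ms mass_push_measure ?(mass_lower_upper s cnu)//.
    by have [] := chain_measure_lower s cnu.
  apply: chain_measure_sub cs => A; apply: lb => [w /supp_push_measure[A' lA' <-]|A' uA'].
    by apply/davis_top_homo/nuB/(lower_part_supp cnu lA').
  by apply/davis_top_homo/nuB/(upper_part_supp cnu uA').
have nu0 y p : setT y -> 0 <= nu y p by move=> _; have [[]] := nuP y.
have csT : {within setT, continuous s} by exact: continuous_subspaceT.
apply: sweep_measure_family; [exact: closedT| | |].
- by apply: push_measure_family; exact: lower_part_family.
- exact: upper_part_family.
- by move=> y _; exact/joint_chain_split/(prob_chain_setT (nuP y)).
Qed.

Lemma element_opP : measure_operator element_transport element_op.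
Proof.
split=> [s mu w muP|Y s mu cs muF muP].
  have cmu := prob_chain_setT muP; have [cmuw mu1] := muP.
  have cu := chain_measure_upper s cmu; have clo := chain_measure_lower s cmuw.
  have [cs ms lb] := sweep_measureP (joint_chain_vertices cu).
  have cp := chain_measure_push (omorph_le L) cs.
  have lbT v A : (forall w', supp (upper_part s mu) w' -> (v <= w')%O) ->
      supp (sweep_measure (upper_part s mu) (fun=> 0)) A -> (v <= L A)%O.
    by move=> vu; apply: lb => // B; rewrite /supp /= eqxx.
  split; last first.
    rewrite /element_op massD ?mass_push_measure ?ms ?mass0 ?addr0 ?(mass_lower_upper s cmu)//.
    - by case: cs.
    - by case: clo.
    - by case: cp.
  apply: chain_measureD => //.
    apply: chain_measure_sub cp => v /supp_push_measure[A uA <-]; apply: lbT uA => w' uw'.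
    by have [_ + _ _] := chain_measure_upper s cmuw; apply.
  move=> v v' lv /supp_push_measure[A uA <-]; apply: lbT uA => w' uw'.
  exact: lower_upper_le cmu lv uw'.
have mu0 y p : setT y -> 0 <= mu y p by move=> _; have [[]] := muP y.
have csT : {within setT, continuous s} by exact: continuous_subspaceT.
apply: finite_familyD; first exact: lower_part_family.
apply: push_measure_family; apply: sweep_measure_family; [exact: closedT| | |].
- exact: upper_part_family.
- exact: finite_family0.
- by move=> y _; apply/joint_chain_vertices/chain_measure_upper/(prob_chain_setT (muP y)).
Qed.

Definition sweep_map (z : hocolim R D) : hocolim R DL := operator_map sweep_opP (z, 0).
Definition coset_homotopy : hocolim R DL * R -> hocolim R DL := operator_map coset_opP.
(** [element_op] is the identity at time 1, hence the reversal of time. *)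
Definition element_homotopy (zs : hocolim R D * R) : hocolim R D :=
  operator_map element_opP (zs.1, 1 - zs.2).

Lemma coset_homotopy0 z : coset_homotopy (z, 0) = z.
Proof.
apply: operator_map_id => [nu [[nu0 _ _ _] _]|B A BA|B A h k x].
- by rewrite /coset_op lower_part0// upper_part0// push_measure0 sweep_measure0.
- exact: (omorph_le L BA).
- by rewrite /=; congr diag_map; exact: bool_irrelevance.
Qed.

(** At time 1 the lower part is everything, so both points have the same measure over the same base
    [L (c ord0)], and one frame describes them. *)
Lemma coset_homotopy1 z : coset_homotopy (z, 1) = sweep_map (hocolim_map R D L z).
Proof.
case: z / (hocolimP z) => m c x t; rewrite hocolim_mapE.
have [cnu nu1] := prob_cell_measure c t.
have opE : coset_op 1 (cell_measure c (set_val t)) =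
    sweep_op 0 (cell_measure (L \o c : {omorphism _ -> _}) (set_val t)).
  by rewrite /coset_op /sweep_op (lower_part1 cnu)// (upper_part1 cnu)// cell_measure_comp.
have [F] := prob_chain_frame (measure_operator_prob coset_opP 1 (prob_cell_measure c t)).
rewrite /coset_homotopy (operator_mapP coset_opP x F).
have nul A : supp (sweep_op 0 (cell_measure (L \o c : {omorphism _ -> _}) (set_val t))) A ->
    A \in frame_head F :: frame_tail F.
  by rewrite -opE; exact: frame_supp.
have Gl A : A \in frame_head F :: frame_tail F -> carry sweep_transport (L (c ord0)) A.
  exact: frame_mem.
apply/esym; pose cL : chain W m := (L \o c : {omorphism _ -> _}).
apply: etrans (operator_mapP sweep_opP (c := cL) x (Frame (frame_path F) Gl nul)) _.
apply: frame_pt_eq => // A h h'; rewrite /=; congr diag_map; exact: bool_irrelevance.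
Qed.

Lemma element_homotopy0 z : element_homotopy (z, 0) = z.
Proof.
rewrite /element_homotopy subr0; apply: operator_map_id => [mu muP|w v wv|w v h k x] //.
- have [cmu mu1] := muP; apply/funext => w.
  rewrite /element_op (lower_part1 cmu)// (upper_part1 cmu)// sweep_measure0 push_measure0.
  exact: addr0.
- by rewrite /=; congr diag_map; exact: bool_irrelevance.
Qed.

(** The measures agree, but the right-hand point sits over the longest element of the first coset of
    a frame of the swept measure. As [c ord0] lies below it, a frame for that point serves the other
    as well. *)
Lemma element_homotopy1 z : element_homotopy (z, 1) = hocolim_map R D L (sweep_map z).
Proof.
rewrite /element_homotopy subrr /sweep_map; case: z / (hocolimP z) => m c x t.
have cP := prob_cell_measure c t; have [[nu0 _ _ _] nu1] := cP.
have gP := measure_operator_prob sweep_opP 0 cP; have [F] := prob_chain_frame gP.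
rewrite (operator_mapP sweep_opP x F).
case: F => q l s Gl nul; rewrite /frame_pt /seq_pt /= hocolim_mapE /=.
set gnu := sweep_op 0 _ in gP nul *.
set c' : chain W _ := (L \o seq_chain s : {omorphism _ -> _}).
set t' := to_simplex _; set x' := diag_map D _ x.
have c'E : cell_measure c' (set_val t') = element_op 0 (cell_measure c (set_val t)).
  rewrite cell_measure_comp to_simplexK; last exact: (simplex_seq_row s gP nul).
  rewrite cell_measure_seq_row//; apply/funext => w.
  by rewrite /element_op lower_part0// upper_part0// add0r.
have c'P := prob_cell_measure c' t'; have [F'] := prob_chain_frame c'P.
rewrite (@hocolim_pi_frame _ _ _ D _ c' x' t' F').
have cc' : (c ord0 <= c' ord0)%O := Gl q (mem_head _ _).
have Gl' w : w \in frame_head F' :: frame_tail F' -> carry element_transport (c ord0) w.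
  by move=> /frame_mem /= c'w; exact: le_trans c'w.
have nul' w : supp (element_op 0 (cell_measure c (set_val t))) w ->
    w \in frame_head F' :: frame_tail F'.
  by rewrite -c'E; exact: frame_supp.
rewrite (operator_mapP element_opP x (Frame (frame_path F') Gl' nul')).
by apply: frame_pt_eq => // w h h'; exact: diag_map_comp.
Qed.

Lemma longest_element_weak_equivalence : weak_homotopy_equivalence R (hocolim_map R D L).
Proof.
apply: (@homotopy_equivalence_weak R _ _ _ sweep_map coset_homotopy element_homotopy).
- exact: hocolim_map_continuous.
- move=> z; apply: (@continuous_comp _ (hocolim R D * R)%type _ (fun z => (z, 0))).
    apply: (@continuous_pair (hocolim R D) (hocolim R D) R id (fun=> 0)).
      by move=> ?; exact: cvg_id.
    exact: cst_continuous.
  exact: operator_map_continuous.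
- exact: operator_map_continuous.
- move=> zs; apply: (@continuous_comp (hocolim R D * R)%type (hocolim R D * R)%type _
    (fun zs => (zs.1, 1 - zs.2)) (operator_map element_opP)).
    apply: (@continuous_pair (hocolim R D * R)%type _ R fst (fun zs => 1 - zs.2)).
      by move=> ?; exact: cvg_fst.
    by move=> ?; apply: cvgB; [exact: cvg_cst|exact: cvg_snd].
  exact: operator_map_continuous.
- exact: coset_homotopy0.
- exact: coset_homotopy1.
- exact: element_homotopy0.
- exact: element_homotopy1.
Qed.

End Comparison.

Theorem theorem3p2 (R : realType) (n : nat) (C : coxeterSystem n) :
  exists L : {omorphism davis_poset C -> weak_order C},
    (forall A : davis_poset C, is_longest (sval A) (L A)) /\
    forall D : diagram (weak_order C),
      weak_homotopy_equivalence R (hocolim_map R D L).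
Proof.
exists (longest_element C); split; first exact: davis_top_longest.
exact: longest_element_weak_equivalence.
Qed.
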